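(* Let $g=(g_1,\dots,g_m)\in\mathbb R[X]^m$ such that $M(g)$ is Archimedean and suppose that $S(g)$ has nonempty interior near its convex boundary. Suppose that $g_i$ is strictly quasiconcave on $(\operatorname{convbd}S(g))\cap Z(g_i)$ for each $i\in\{1,\dots,m\}$. Then there exists $d\in\mathbb N$ such that $$\operatorname{conv}S(g)=S_d(g).$$
   Context: $\mathbb N=\{1,2,\dots\}$, $\mathbb N_0=\mathbb N\cup\{0\}$, $n,m\in\mathbb N_0$. $\mathbb R[X]=\mathbb R[X_1,\dots,X_n]$, and $\mathbb R[X]_d$ is the space of polynomials of degree at most $d$. For $g=(g_1,\dots,g_m)\in\mathbb R[X]^m$ set $g_0:=1$ and $S(g):=\{x\in\mathbb R^n\mid g_1(x)\ge0,\dots,g_m(x)\ge0\}$. For $d\in\mathbb N_0$, $$M_d(g):=\Big\{\sum_{i=0}^m\sum_j p_{ij}^2g_i\ \Big|\ p_{ij}\in\mathbb R[X],\ \deg(p_{ij}^2g_i)\le d\Big\}$$ (the inner sums are finite of arbitrary length; $\deg 0:=-\infty$), and $M(g):=\bigcup_{d\in\mathbb N_0}M_d(g)$. $M(g)$ is called Archimedean if for every $p\in\mathbb R[X]$ there is $N\in\mathbb N$ with $N+p\in M(g)$ and $N-p\in M(g)$. For $d\in\mathbb N$, $$S_d(g):=\{(L(X_1),\dots,L(X_n))\mid L\colon\mathbb R[X]_d\to\mathbb R\text{ linear},\ L(M_d(g))\subseteq\mathbb R_{\ge0},\ L(1)=1\}\subseteq\mathbb R^n.$$ For $S\subseteq\mathbb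 R^n$, $\operatorname{conv}S$ is the convex hull, the convex boundary is $\operatorname{convbd}S:=S\cap\partial\operatorname{conv}S$ (boundary in $\mathbb R^n$), and $S$ has nonempty interior near its convex boundary if $\operatorname{convbd}S\subseteq\overline{S^\circ}$. $Z(p):=\{x\in\mathbb R^n\mid p(x)=0\}$. A polynomial $p\in\mathbb R[X]$ is strictly quasiconcave at $x\in\mathbb R^n$ if for all $v\in\mathbb R^n\setminus\{0\}$: $(\nabla p(x))^Tv=0$ implies $v^T(\operatorname{Hess}p)(x)v<0$; it is strictly quasiconcave on a set if it is so at each point of the set. *)

(* Defs.v *)
(* mpoly has to be imported before normedtype: the converse order is rejected
   because of a clash of associativity at level 2. *)
From mathcomp Require Import all_boot all_order all_algebra.
From mathcomp.multinomials Require Import mpoly.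
From mathcomp Require Import boolp classical_sets reals topology normedtype.
From mathcomp Require Import convex.

Set Implicit Arguments.
Unset Strict Implicit.
Unset Printing Implicit Defensive.

Import Order.TTheory GRing.Theory Num.Theory.
Import numFieldNormedType.Exports.

Local Open Scope classical_set_scope.
Local Open Scope ring_scope.

Section Convexity.
Variables (R : realType) (n : nat).
Implicit Type S : set 'rV[R]_n.

Definition conv_hull S : set 'rV[R]_n :=
  smallest (fun A : set 'rV[R]_n => convex_set A) S.

Definition boundary S : set 'rV[R]_n := closure S `\` S°.

Definition convbd S : set 'rV[R]_n := S `&` boundary (conv_hull S).

Definition nonempty_interior_near_convbd S : Prop :=
  convbd S `<=` closure S°.

End Convexity.

Section Polynomials.
Variables (R : realType) (n : nat).
Implicit Types (p : {mpoly R[n]}) (x : 'rV[R]_n).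

(* The zero polynomial has msize 0, hence degree at most d for every d. *)
Definition deg_le (d : nat) p : bool := (msize p <= d.+1)%N.

Definition peval p x : R := p.@[x 0].

Definition zeros p : set 'rV[R]_n := [set x | peval p x = 0].

Definition gradient p x : 'rV[R]_n := \row_i peval p^`M(i) x.

Definition hessian p x : 'M[R]_n := \matrix_(i, j) peval p^`M(i)^`M(j) x.

Definition strictly_quasiconcave_at p x : Prop :=
  forall v : 'rV[R]_n, v != 0 ->
    (gradient p x *m v^T) 0 0 = 0 -> (v *m hessian p x *m v^T) 0 0 < 0.

Definition strictly_quasiconcave_on p (A : set 'rV[R]_n) : Prop :=
  forall x, A x -> strictly_quasiconcave_at p x.

(* A linear form on the space of polynomials of degree at most d is encoded as
   a total function, whose values in degree greater than d are unconstrained. *)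
Definition linear_upto (d : nat) (L : {mpoly R[n]} -> R) : Prop :=
  forall (a : R) p q, deg_le d p -> deg_le d q ->
    L (a *: p + q) = a * L p + L q.

End Polynomials.

Section QuadraticModule.
Variables (R : realType) (n m : nat) (g : m.-tuple {mpoly R[n]}).

Definition semialg : set 'rV[R]_n :=
  [set x | forall i : 'I_m, 0 <= peval (tnth g i) x].

(* The tuple (g_0, g_1, ..., g_m) with g_0 = 1. *)
Definition with_one : m.+1.-tuple {mpoly R[n]} := [tuple of 1 :: g].

Definition trunc_qmodule (d : nat) : set {mpoly R[n]} :=
  [set f | exists2 p : 'I_m.+1 -> seq {mpoly R[n]},
     forall (i : 'I_m.+1) q, q \in p i -> deg_le d (q ^+ 2 * tnth with_one i) &
     f = \sum_(i < m.+1) \sum_(q <- p i) q ^+ 2 * tnth with_one i].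

Definition qmodule : set {mpoly R[n]} := \bigcup_d trunc_qmodule d.

Definition archimedean_qmodule : Prop :=
  forall p : {mpoly R[n]}, exists N : nat,
    [/\ (0 < N)%N, qmodule (N%:R + p) & qmodule (N%:R - p)].

(* Meant for d > 0, so that the variables have degree at most d. *)
Definition lasserre (d : nat) : set 'rV[R]_n :=
  [set x | exists L : {mpoly R[n]} -> R,
     [/\ linear_upto d L,
         forall f, trunc_qmodule d f -> 0 <= L f,
         L 1 = 1 &
         x = \row_i L 'X_i]].

End QuadraticModule.

(* Main.v *)
Require Import Defs.
From mathcomp Require Import all_boot all_order all_algebra.
From mathcomp.multinomials Require Import mpoly.
From mathcomp Require Import boolp classical_sets reals topology normedtype.
From mathcomp Require Import interval_inference convex derive.
From mathcomp Require Import ring lra.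

Set Implicit Arguments.
Unset Strict Implicit.
Unset Printing Implicit Defensive.

Import Order.TTheory GRing.Theory Num.Theory.
Import numFieldNormedType.Exports.

Local Open Scope classical_set_scope.
Local Open Scope ring_scope.

(** Evaluations at points of [S = semialg g] are admissible linear forms and the
    relaxations are convex, so the hull of [S] is contained in all of them. For
    the converse, the hull is compact by Caratheodory's theorem, so a point [y]
    outside of it is separated by an affine form [f] that is positive on [S] and
    negative at [y]. If [f] has a certificate of degree at most [d] in the
    quadratic module, then a linear form of degree [d] cannot represent [y].
    The theorem thus amounts to one degree [d] for all normalized affine forms
    positive on [S] ([global_degree_bound]). By compactness it suffices to find a
    degree for all such forms near a given form [f0] that is nonnegative on [S]
    ([local_degree_bound]).

    Putinar's theorem ([archimedean_positivstellensatz]) provides certificates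
    for single positive polynomials. To control degrees, one works with families
    of polynomials whose coefficients are bounded functions of a parameter
    ([bfamily]), and with certificates of a common degree ([btrunc]). A family
    with a positive lower bound on [S] has such certificates
    ([uniform_positivstellensatz]), but the forms near [f0] have no common
    positive lower bound when [f0] has zeros on [S].

    At a zero [u0] of [f0] on [S], which lies on the convex boundary, the active
    constraints are strictly quasiconcave. Multiplying [g_i] by a suitable square
    makes it strictly concave near [u0] ([quasiconcave_concavify]), and since [u0]
    is a limit of interior points there is a Slater point ([slater_point]). Hence
    the zeros of [f0] on [S] are isolated, and a nearby form [f] has Lagrange
    multipliers at some point [u] close to [u0]. They come from a quadratic penalty
    ([penalty_multipliers]), and the Slater point bounds them. Subtracting from [f]
    the weighted concave constraints leaves a nonnegative constant and a positive
    definite quadratic remainder at [u], that is, a sum of squares plus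
    [|X - u|^2 q] with [q] positive near [u] ([concave_certificate],
    [model_certificate]).

    These local certificates are glued by dividing out the zeros one at a time
    ([nondegenerate_zeros_positivstellensatz]). If [f] is [m + |X - u|^2 q] with
    [m] certified, and [sigma + |X - u|^2 tau = 1] with a square [sigma] that is
    concentrated near [u], then
    [f = sigma m + |X - u|^2 (sigma q + tau f)], and [sigma q + tau f] is positive
    near [u] while it still has nondegenerate zeros at the other points. After the
    last zero the remaining family has a positive lower bound on [S]. *)

(** * Positivstellensatz for Archimedean quadratic modules *)

Section Positivstellensatz.
Variables (R : realType) (n : nat).
Local Notation A := {mpoly R[n]}.
Implicit Types (Q : set A) (a b f : A) (x : 'rV[R]_n).

Definition quadratic_module Q : Prop :=
  [/\ Q 1, forall a b, Q a -> Q b -> Q (a + b)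
    & forall a b, Q b -> Q (a ^+ 2 * b)].

Definition absorbing Q : Prop := forall a, exists N : nat, Q (N%:R + a).

Definition sum_squares (s : A) : Prop :=
  exists l : seq A, s = \sum_(a <- l) a ^+ 2.

Section Basics.
Variable Q : set A.
Hypothesis qmQ : quadratic_module Q.

Lemma qm_cst (c : R) : 0 <= c -> Q c%:MP.
Proof.
have [Q1 _ QM] := qmQ => c0.
suff -> : c%:MP = (Num.sqrt c)%:MP ^+ 2 * 1 :> A by exact: QM.
by rewrite mulr1 -rmorphXn /= sqr_sqrtr.
Qed.

Lemma qm_scale (c : R) a : 0 <= c -> Q a -> Q (c%:MP * a).
Proof.
have [_ _ QM] := qmQ => c0 Qa.
suff -> : c%:MP = (Num.sqrt c)%:MP ^+ 2 :> A by exact: QM.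
by rewrite -rmorphXn /= sqr_sqrtr.
Qed.

Lemma qm_sos_mul s a : sum_squares s -> Q a -> Q (s * a).
Proof.
have [_ QD QM] := qmQ => -[l ->] Qa; rewrite mulr_suml.
elim: l => [|b l IH]; first by rewrite big_nil -[0]mpolyC0; exact: qm_cst.
by rewrite big_cons; apply: (QD) => //; exact: QM.
Qed.

Lemma qm_sos s : sum_squares s -> Q s.
Proof. by move=> ss; rewrite -[s]mulr1; apply: qm_sos_mul => //; case: qmQ. Qed.

Lemma qm_widen (c d : R) a : c <= d -> Q (c%:MP + a) -> Q (d%:MP + a).
Proof.
have [_ QD _] := qmQ => cd Qa.
have -> : d%:MP + a = (d - c)%:MP + (c%:MP + a) by ring.
by apply: (QD) => //; apply: qm_cst; rewrite subr_ge0.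
Qed.

Hypothesis absQ : absorbing Q.

(** Starting from some bound [- r <= f], the displayed identity lowers [r] by
    the fixed amount [1 / k ^ 2], so that finitely many steps reach [f]. *)
Lemma qm_cancel_sos s f : sum_squares s -> Q (s * f - 1) -> Q f.
Proof.
move=> sos Qsf; have [Q1 QD QM] := qmQ.
have [N1 QN1] := absQ (- s); have [N2 QN2] := absQ (- (s ^+ 2 * f)).
have [r0 Qr0] := absQ f.
pose k : R := N1%:R + N2%:R + 1.
have k0 : 0 < k by rewrite /k ltr_wpDl// addr_ge0.
have kN1 : N1%:R <= 2 * k by rewrite /k; have := ler0n R N1; have := ler0n R N2; lra.
have kN2 : N2%:R <= 2 * k - 1 by rewrite /k; have := ler0n R N1; have := ler0n R N2; lra.
have Qs : Q (s * ((2 * k)%:MP - s)).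
  have QK : Q ((2 * k)%:MP - s).
    by apply: (qm_widen kN1); rewrite rmorph_nat.
  have -> : s * ((2 * k)%:MP - s)
     = ((2 * k)^-1)%:MP * (((2 * k)%:MP - s) ^+ 2 * s + s ^+ 2 * ((2 * k)%:MP - s)).
    have E : ((2 * k)^-1)%:MP * (2 * k)%:MP = 1 :> A.
      by rewrite -rmorphM /= mulVf ?rmorph1// gt_eqF// mulr_gt0.
    transitivity (((2 * k)^-1)%:MP * (2 * k)%:MP * (s * ((2 * k)%:MP - s))).
      by rewrite E mul1r.
    by ring.
  by apply: qm_scale; [rewrite invr_ge0 ltW// mulr_gt0 | apply: (QD); apply: (QM) => //; exact: qm_sos].
have Qs2 : Q ((2 * k - 1)%:MP - s ^+ 2 * f).
  by apply: (qm_widen kN2); rewrite rmorph_nat.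
have step r : 0 <= r -> Q (r%:MP + f) -> Q ((r - (k ^+ 2)^-1)%:MP + f).
  move=> r0' Qrf.
  have -> : (r - (k ^+ 2)^-1)%:MP + f = ((k ^+ 2)^-1)%:MP *
     ((k%:MP - s) ^+ 2 * (r%:MP + f) + (2 * k)%:MP * (s * f - 1)
      + r%:MP * (s * ((2 * k)%:MP - s)) + ((2 * k - 1)%:MP - s ^+ 2 * f)).
    have E : ((k ^+ 2)^-1)%:MP * (k ^+ 2)%:MP = 1 :> A.
      by rewrite -rmorphM /= mulVf ?rmorph1// gt_eqF// exprn_gt0.
    transitivity (((k ^+ 2)^-1)%:MP * (k ^+ 2)%:MP * (r%:MP + f) - ((k ^+ 2)^-1)%:MP).
      by rewrite E; ring.
    by ring.
  apply: qm_scale; first by rewrite invr_ge0 exprn_ge0// ltW.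
  apply: (QD) => //; apply: (QD); last exact: qm_scale.
  by apply: (QD); [exact: QM | apply: qm_scale => //; rewrite mulr_ge0// ltW].
have main : forall (j : nat) r, r <= j%:R * (k ^+ 2)^-1 -> Q (r%:MP + f) -> Q f.
  elim=> [|j IH] r rj Qr.
    by rewrite -[f]add0r -[0]mpolyC0; apply: (qm_widen _ Qr); rewrite mul0r in rj.
  have [r_le0|/ltW r_ge0] := leP r 0.
    by rewrite -[f]add0r -[0]mpolyC0; apply: (qm_widen _ Qr).
  apply: (IH _ _ (step _ r_ge0 Qr)).
  by rewrite lerBlDr -natr1 mulrDl mul1r in rj *.
have [j jP] : exists j : nat, r0%:R * k ^+ 2 <= j%:R.
  exists (Num.bound (r0%:R * k ^+ 2)); apply/ltW/archi_boundP.
  by rewrite mulr_ge0// sqr_ge0.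
apply: (main j r0%:R); last by rewrite rmorph_nat.
by rewrite ler_pdivlMr// exprn_gt0.
Qed.

End Basics.

Section MaximalModule.
Variables (Q : set A).
Hypotheses (qmQ : quadratic_module Q) (absQ : absorbing Q).
Hypothesis properQ : ~ Q (- 1).
Hypothesis totalQ : forall a, Q a \/ Q (- a).

(** For the order defined by [Q], the polynomial [a] equals [v] up to every
    positive error. This is the morphism to the reals attached to [Q], kept as a
    relation so that its algebraic rules do not involve suprema. *)
Definition value a (v : R) : Prop :=
  forall e : R, 0 < e -> Q ((e - v)%:MP + a) /\ Q ((e + v)%:MP - a).

Lemma qm_neg_cst (c : R) : Q c%:MP -> 0 <= c.
Proof.
move=> Qc; rewrite leNgt; apply/negP => c0; apply: properQ.
have -> : -1 = (- c^-1)%:MP * c%:MP :> A.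
  by rewrite -rmorphM mulNr mulVf ?lt_eqF//= rmorphN rmorph1.
by apply: (qm_scale qmQ) => //; rewrite oppr_ge0 invr_le0 ltW.
Qed.

Lemma value_exists a : exists v, value a v.
Proof.
have [_ QD _] := qmQ.
pose E := [set r : R | Q (a - r%:MP)].
have [N QN] := absQ a; have [N' QN'] := absQ (- a).
have E0 : E !=set0 by exists (- N%:R); rewrite /E /= rmorphN rmorph_nat opprK addrC.
have ubE : ubound E N'%:R.
  move=> r /= Er; have := QD _ _ Er QN'.
  have -> : a - r%:MP + (N'%:R - a) = (N'%:R - r)%:MP.
    by rewrite rmorphB rmorph_nat /=; ring.
  by move/qm_neg_cst; rewrite subr_ge0.
have supE : has_sup E by split => //; exists N'%:R.
exists (sup E) => e e0; split.
  have [r Er rlt] := sup_adherent e0 supE.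
  have : Q ((- r)%:MP + a) by rewrite rmorphN addrC.
  by apply: qm_widen => //; lra.
have [H|] := totalQ (a - (e + sup E)%:MP).
  have : e + sup E <= sup E by apply: sup_upper_bound.
  by rewrite gerDr leNgt e0.
by rewrite opprB.
Qed.

Lemma value_cst c : value c%:MP c.
Proof.
move=> e e0; split.
  have -> : (e - c)%:MP + c%:MP = e%:MP :> A by ring.
  exact: (qm_cst qmQ (ltW e0)).
have -> : (e + c)%:MP - c%:MP = e%:MP :> A by ring.
exact: (qm_cst qmQ (ltW e0)).
Qed.

Lemma valueD a b v w : value a v -> value b w -> value (a + b) (v + w).
Proof.
have [_ QD _] := qmQ.
move=> av bw e e0; have e20 : 0 < e / 2 by rewrite divr_gt0.
have [H1 H2] := av _ e20; have [H3 H4] := bw _ e20; split.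
  have -> : (e - (v + w))%:MP + (a + b)
     = ((e / 2 - v)%:MP + a) + ((e / 2 - w)%:MP + b).
    have -> : e - (v + w) = (e / 2 - v) + (e / 2 - w) by field.
    by ring.
  exact: QD.
have -> : (e + (v + w))%:MP - (a + b)
   = ((e / 2 + v)%:MP - a) + ((e / 2 + w)%:MP - b).
  have -> : e + (v + w) = (e / 2 + v) + (e / 2 + w) by field.
  by ring.
exact: QD.
Qed.

Lemma valueN a v : value a v -> value (- a) (- v).
Proof. by move=> av e e0; have [H1 H2] := av _ e0; rewrite !opprK. Qed.

Lemma valueZ c a v : value a v -> value (c%:MP * a) (c * v).
Proof.
wlog c0 : c / 0 < c => [H av|].
  have [c0|c0|->] := ltgtP c 0; last by rewrite mpolyC0 !mul0r -mpolyC0; exact: value_cst.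
    have -> : c%:MP * a = - ((- c)%:MP * a) by ring.
    have -> : c * v = - (- c * v) by ring.
    by apply: valueN; apply: H => //; rewrite oppr_gt0.
  exact: H.
move=> av e e0; have [H1 H2] := av _ (divr_gt0 e0 c0).
have E : c * (e / c) = e by field; rewrite gt_eqF.
have cge := ltW c0.
split.
  have -> : (e - c * v)%:MP + c%:MP * a = c%:MP * ((e / c - v)%:MP + a).
    by rewrite -{1}E; ring.
  exact: qm_scale.
have -> : (e + c * v)%:MP - c%:MP * a = c%:MP * ((e / c + v)%:MP - a).
  by rewrite -{1}E; ring.
exact: qm_scale.
Qed.

(** From [- d <= a <= d] one gets [a ^+ 2 <= d ^+ 2] inside [Q], since
    [2 d (d ^+ 2 - a ^+ 2)] is the combination of [d - a] and [d + a] with the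
    square weights [(d + a) ^+ 2] and [(d - a) ^+ 2]. *)
Lemma value_sqr0 a : value a 0 -> value (a ^+ 2) 0.
Proof.
have [Q1 QD QM] := qmQ.
move=> av e e0; rewrite subr0 addr0.
have Qa2 : Q (a ^+ 2) by rewrite -[_ ^+ 2]mulr1; exact: QM.
split; first by apply: (QD) => //; exact: (qm_cst qmQ (ltW e0)).
pose d := Num.sqrt e; have d0 : 0 < d by rewrite sqrtr_gt0.
have [] := av d d0; rewrite subr0 addr0 => H1 H2.
have -> : e%:MP - a ^+ 2 = ((2 * d)^-1)%:MP *
    ((d%:MP - a) ^+ 2 * (d%:MP + a) + (d%:MP + a) ^+ 2 * (d%:MP - a)).
  have -> : e = d ^+ 2 by rewrite sqr_sqrtr// ltW.
  have E : ((2 * d)^-1)%:MP * (2 * d)%:MP = 1 :> A.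
    by rewrite -rmorphM /= mulVf ?rmorph1// gt_eqF// mulr_gt0.
  transitivity (((2 * d)^-1)%:MP * (2 * d)%:MP * ((d ^+ 2)%:MP - a ^+ 2)).
    by rewrite E mul1r.
  by ring.
apply: (qm_scale qmQ); first by rewrite invr_ge0 ltW// mulr_gt0.
by apply: (QD); apply: (QM).
Qed.

Lemma value_sqr a v : value a v -> value (a ^+ 2) (v ^+ 2).
Proof.
move=> av.
have a0 : value (a - v%:MP) 0.
  by rewrite -[0](subrr v); apply: valueD => //; apply: valueN; exact: value_cst.
have := valueD (value_sqr0 a0) (valueD (valueZ (2 * v) av) (value_cst (- v ^+ 2))).
have -> : (a - v%:MP) ^+ 2 + ((2 * v)%:MP * a + (- v ^+ 2)%:MP) = a ^+ 2 by ring.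
by have -> : 0 + (2 * v * v - v ^+ 2) = v ^+ 2 by ring.
Qed.

Lemma valueM a b v w : value a v -> value b w -> value (a * b) (v * w).
Proof.
move=> av bw.
have := valueZ 2^-1 (valueD (value_sqr (valueD av bw))
  (valueN (valueD (value_sqr av) (value_sqr bw)))).
have -> : (2^-1)%:MP * ((a + b) ^+ 2 - (a ^+ 2 + b ^+ 2)) = a * b.
  have E : (2^-1)%:MP * 2%:R%:MP = 1 :> A.
    by rewrite -rmorphM /= mulVf ?rmorph1// pnatr_eq0.
  transitivity ((2^-1)%:MP * 2%:R%:MP * (a * b)); last by rewrite E mul1r.
  by ring.
by have -> : 2^-1 * ((v + w) ^+ 2 - (v ^+ 2 + w ^+ 2)) = v * w by field.
Qed.

(** As [value] respects the ring operations, it is evaluation at the point whose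
    coordinates are the values of the variables. *)
Lemma value_point : exists x : 'rV[R]_n, forall a, value a (peval a x).
Proof.
pose x : 'rV[R]_n := \row_i xget 0 [set v | value 'X_i v].
exists x => a; rewrite /peval.
have X i : value 'X_i (x 0 i).
  by rewrite mxE; have [v vP] := value_exists 'X_i; exact: xgetI vP.
elim/mpolyind: a => [|c m p _ _ IH].
  by rewrite meval0 -mpolyC0; exact: value_cst.
rewrite mevalD mevalZ; apply: valueD => //.
rewrite -mul_mpolyC; apply: valueZ; rewrite mevalX mpolyXE_id.
elim/big_ind2 : _ => [||i _]; first by rewrite -mpolyC1; exact: value_cst.
  by move=> ? ? ? ?; exact: valueM.
elim: (m i) => [|k IHk]; first by rewrite !expr0 -mpolyC1; exact: value_cst.
by rewrite !exprS; exact: valueM.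
Qed.

Lemma value_ge0 a v : Q a -> value a v -> 0 <= v.
Proof.
have [_ QD _] := qmQ => Qa av; rewrite leNgt; apply/negP => v0.
have e0 : 0 < - v / 2 by rewrite divr_gt0// oppr_gt0.
have := QD _ _ Qa (proj2 (av _ e0)); rewrite addrCA subrr addr0.
by move/qm_neg_cst; lra.
Qed.

End MaximalModule.

(** A polynomial outside of [Q] leaves [Q] proper when its negative is
    adjoined; a maximal proper module above it is totally ordering, hence
    consists of the polynomials nonnegative at a single point. *)
Theorem archimedean_separation Q f :
  quadratic_module Q -> absorbing Q -> ~ Q f ->
  exists x : 'rV[R]_n, (forall a, Q a -> 0 <= peval a x) /\ peval f x <= 0.
Proof.
move=> qmQ absQ nQf; have [Q1 QD QM] := qmQ.
pose adj (P : set A) b := [set p : A | exists q s, [/\ P q, sum_squares s & p = q + s * b]].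
have adj_qm P b : quadratic_module P -> quadratic_module (adj P b).
  move=> qmP; have [P1 PD PM] := qmP; split.
  - by exists 1, 0; split => //; [exists [::]; rewrite big_nil | rewrite mul0r addr0].
  - move=> _ _ [q [_ [Pq [l ->] ->]]] [q' [_ [Pq' [l' ->] ->]]].
    exists (q + q'), (\sum_(a <- l ++ l') a ^+ 2); split; [exact: PD | by exists (l ++ l')|].
    by rewrite big_cat /=; ring.
  - move=> c _ [q [_ [Pq [l ->] ->]]].
    exists (c ^+ 2 * q), (\sum_(a <- [seq c * a | a <- l]) a ^+ 2); split; [exact: PM | by eexists |].
    rewrite big_map mulrDr mulrA; congr (_ + _ * _); rewrite mulr_sumr.
    by apply: eq_bigr => a _; rewrite exprMn.
have adj_sub P b : P `<=` adj P b.
  by move=> p Pp; exists p, 0; split => //; [exists [::]; rewrite big_nil | rewrite mul0r addr0].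
have adj_mem P b : P 0 -> adj P b b.
  move=> P0; exists 0, 1; split => //; last by rewrite mul1r add0r.
  by exists [:: 1]; rewrite big_seq1 expr1n.
have qm0 P : quadratic_module P -> P 0 by move=> qmP; rewrite -[0]mpolyC0; exact: qm_cst.
have adj_proper P b : quadratic_module P -> absorbing P -> ~ P (- b) -> ~ adj P b (- 1).
  move=> qmP absP nb [q [s [Pq ss E]]]; apply: nb.
  apply: (qm_cancel_sos qmP absP ss); suff -> : s * - b - 1 = q by [].
  by rewrite E; ring.
pose good (P : set A) := [/\ quadratic_module P, ~ P (- 1) & adj Q (- f) `<=` P].
pose G (P : set A) := P !=set0 -> good P.
have goodQ : good (adj Q (- f)).
  by split => //; [exact: adj_qm | apply: adj_proper => //; rewrite opprK].
have [|P [GP Pmax]] := @Zorn_bigcup A G.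
  move=> F FG Ftot [p0 [P0 FP0 P0p]].
  have gP0 : good P0 by apply: (FG _ FP0); exists p0.
  have g X y : F X -> X y -> good X by move=> FX Xy; apply: (FG _ FX); exists y.
  split.
  - split.
    + by exists P0 => //; case: gP0 => -[].
    + move=> a b [X FX Xa] [Y FY Yb].
      have [XY|YX] := Ftot _ _ FX FY.
        by exists Y => //; have [[_ YD _] _ _] := g _ _ FY Yb; apply: YD => //; exact: XY.
      by exists X => //; have [[_ XD _] _ _] := g _ _ FX Xa; apply: XD => //; exact: YX.
    + move=> a b [X FX Xb]; exists X => //.
      by have [[_ _ XM] _ _] := g _ _ FX Xb; exact: XM.
  - by move=> [X FX X1]; have [_ + _] := g _ _ FX X1; exact.
  - by move=> y Qy; exists P0 => //; have [_ _] := gP0; exact.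
have P0 : P !=set0.
  apply: contrapT => P0; have {}P0 : P = set0.
    by apply/eqP; apply: contrapT => /negP/set0P.
  apply: (Pmax (adj Q (- f))); last by move=> _.
  rewrite P0; split => // /(_ 1); apply.
  by apply: adj_sub.
have [qmP properP subP] := GP P0.
have QP : Q `<=` P by move=> y Qy; apply/subP/adj_sub.
have absP : absorbing P by move=> a; have [N QN] := absQ a; exists N; exact: QP.
have totalP a : P a \/ P (- a).
  have [|Pa] := pselect (P (- a)); first by right.
  left; apply: contrapT => nPa.
  apply: (Pmax (adj P a)).
    split; first exact: adj_sub.
    by move=> sub; apply: nPa; apply: sub; apply: adj_mem; exact: qm0.
  move=> _; split; [exact: adj_qm | exact: adj_proper | ].
  by move=> y Qy; apply/adj_sub/subP.
have [x xP] := value_point qmP absP properP totalP.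
exists x; split => [a Qa|].
  by apply: (value_ge0 qmP properP (QP _ Qa)); exact: xP.
rewrite -oppr_ge0 /peval -mevalN.
apply: (@value_ge0 _ qmP properP (- f)); last exact: xP.
by apply/subP/adj_mem; exact: qm0.
Qed.

End Positivstellensatz.

(** * Truncated quadratic modules and bounded families of polynomials *)

Section MpolyInduction.
Variables (R : realType) (n : nat).
Local Notation A := {mpoly R[n]}.

Lemma mpoly_algebra_ind (P : A -> Prop) :
  (forall c : R, P c%:MP) -> (forall i, P 'X_i) ->
  (forall p q, P p -> P q -> P (p + q)) ->
  (forall p q, P p -> P q -> P (p * q)) -> forall p, P p.
Proof.
move=> PC PX PD PM; elim/mpolyind => [|c m p _ _ IH]; first by rewrite -mpolyC0.
apply: (PD) => //; rewrite -mul_mpolyC; apply: (PM) => //.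
rewrite mpolyXE_id; elim/big_ind : _ => [||i _]; [by rewrite -mpolyC1|exact: PM|].
by elim: (m i) => [|k IHk]; rewrite ?expr0 ?exprS -?mpolyC1 //; exact: PM.
Qed.

Lemma pevalD (p q : A) x : peval (p + q) x = peval p x + peval q x.
Proof. exact: mevalD. Qed.
Lemma pevalB (p q : A) x : peval (p - q) x = peval p x - peval q x.
Proof. exact: mevalB. Qed.
Lemma pevalN (p : A) x : peval (- p) x = - peval p x.
Proof. exact: mevalN. Qed.
Lemma pevalM (p q : A) x : peval (p * q) x = peval p x * peval q x.
Proof. exact: mevalM. Qed.
Lemma pevalC (c : R) x : peval (c%:MP : A) x = c.
Proof. exact: mevalC. Qed.
Lemma peval1 x : peval (1 : A) x = 1.
Proof. exact: meval1. Qed.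
Lemma peval0 x : peval (0 : A) x = 0.
Proof. exact: meval0. Qed.
Lemma pevalX i x : peval ('X_i : A) x = x 0 i.
Proof. exact: mevalXU. Qed.
Lemma pevalXn (p : A) k x : peval (p ^+ k) x = peval p x ^+ k.
Proof. exact: rmorphXn. Qed.
Lemma peval_sum I (r : seq I) (P : pred I) (F : I -> A) x :
  peval (\sum_(i <- r | P i) F i) x = \sum_(i <- r | P i) peval (F i) x.
Proof. exact: rmorph_sum. Qed.
Lemma peval_prod I (r : seq I) (P : pred I) (F : I -> A) x :
  peval (\prod_(i <- r | P i) F i) x = \prod_(i <- r | P i) peval (F i) x.
Proof. exact: rmorph_prod. Qed.

Definition pevalE := (pevalD, pevalB, pevalN, pevalM, pevalC, peval1, peval0,
  pevalX, pevalXn, peval_sum, peval_prod).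

Lemma msizeM_leD (p q : A) : (msize (p * q) <= msize p + msize q)%N.
Proof.
have [->|p0] := eqVneq p 0; first by rewrite mul0r msize0.
have [->|q0] := eqVneq q 0; first by rewrite mulr0 msize0.
by rewrite msizeM// leq_pred.
Qed.

Definition in_box (K : R) (x : 'rV[R]_n) := forall i, `|x 0 i| <= K.

Lemma poly_bounded_on_box (K : R) (p : A) :
  exists C, forall x, in_box K x -> `|peval p x| <= C.
Proof.
elim/mpoly_algebra_ind: p => [c|i|p q [C HC] [D HD]|p q [C HC] [D HD]].
- by exists `|c| => x _; rewrite pevalC.
- by exists K => x xK; rewrite pevalX.
- exists (C + D) => x xK; rewrite pevalD; apply: le_trans (ler_normD _ _) _.
  by rewrite lerD ?HC ?HD.
- by exists (C * D) => x xK; rewrite pevalM normrM ler_pM ?HC ?HD.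
Qed.

Lemma poly_lipschitz_on_box (K : R) (p : A) :
  exists C, forall x y, in_box K x -> in_box K y ->
    `|peval p x - peval p y| <= C * \sum_i `|x 0 i - y 0 i|.
Proof.
elim/mpoly_algebra_ind: p => [c|i|p q [C HC] [D HD]|p q [C HC] [D HD]].
- by exists 0 => x y _ _; rewrite !pevalC subrr normr0 mul0r.
- exists 1 => x y _ _; rewrite !pevalX mul1r (bigD1 i)//= lerDl.
  by apply: sumr_ge0.
- exists (C + D) => x y xK yK; rewrite !pevalD opprD addrACA mulrDl.
  by apply: le_trans (ler_normD _ _) _; rewrite lerD ?HC ?HD.
- have [P HP] := poly_bounded_on_box K p; have [Q HQ] := poly_bounded_on_box K q.
  exists (C * Q + P * D) => x y xK yK; rewrite !pevalM.
  have -> : peval p x * peval q x - peval p y * peval q y =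
    (peval p x - peval p y) * peval q x + peval p y * (peval q x - peval q y) by ring.
  apply: le_trans (ler_normD _ _) _; rewrite !normrM mulrDl.
  by apply: lerD; [rewrite -mulrAC|rewrite -mulrA]; apply: ler_pM; rewrite ?HC ?HD ?HP ?HQ.
Qed.

End MpolyInduction.

Section Families.
Variables (R : realType) (n : nat) (T : Type).
Local Notation A := {mpoly R[n]}.

(** The finite sums [t |-> \sum_i c_i t * P_i] with fixed polynomials [P_i] and
    scalar coefficient functions [c_i] in the class [C]. Bounded coefficients
    give families for which statements hold with constants independent of [t],
    by induction on the number of terms; continuous coefficients give families
    that depend continuously on a base point. *)
Inductive family (C : set (T -> R)) : (T -> A) -> Prop :=
| family0 : family C (fun=> 0)
| family_cons c P p : C c -> family C p -> family C (fun t => (c t)%:MP * P + p t).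

Lemma familyD C p q : family C p -> family C q -> family C (fun t => p t + q t).
Proof.
move=> + fq; elim=> [|c P {}p Cc _ IH].
  by rewrite (_ : (fun t => _) = q)//; apply/funext => t; rewrite add0r.
rewrite (_ : (fun t => _) = (fun t => (c t)%:MP * P + (p t + q t))); last first.
  by apply/funext => t; rewrite addrA.
exact: family_cons.
Qed.

Lemma family_sum C I (r : seq I) (F : I -> T -> A) :
  (forall i, family C (F i)) -> family C (fun t => \sum_(i <- r) F i t).
Proof.
move=> FC; elim: r => [|i r IH].
  rewrite (_ : (fun t => _) = (fun=> 0)); first exact: family0.
  by apply/funext => t; rewrite big_nil.
rewrite (_ : (fun t => _) = (fun t => F i t + \sum_(j <- r) F j t)); first exact: familyD.
by apply/funext => t; rewrite big_cons.
Qed.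

Lemma family_sum_cond C I (r : seq I) (P : pred I) (F : I -> T -> A) :
  (forall i, P i -> family C (F i)) -> family C (fun t => \sum_(i <- r | P i) F i t).
Proof.
move=> FC; rewrite (_ : (fun t => _) = fun t => \sum_(i <- r) if P i then F i t else 0).
  apply: family_sum => i; have [Pi|_] := boolP (P i); [exact: FC | exact: family0].
by apply/funext => t; rewrite big_mkcond.
Qed.

Section Algebra.
Variable C : set (T -> R).
Hypothesis C_cst : forall c : R, C (fun=> c).
Hypothesis C_mul : forall c d, C c -> C d -> C (fun t => c t * d t).

Lemma family_coef c : C c -> family C (fun t => (c t)%:MP).
Proof.
move=> Cc; rewrite (_ : (fun t => _) = (fun t => (c t)%:MP * 1 + 0)).
  by apply: family_cons => //; exact: family0.
by apply/funext => t; rewrite mulr1 addr0.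
Qed.

Lemma family_cst P : family C (fun=> P).
Proof.
rewrite (_ : (fun t => _) = (fun t => 1%:MP * P + 0)).
  by apply: (@family_cons _ (fun=> 1)) => //; exact: family0.
by apply/funext => t; rewrite mpolyC1 mul1r addr0.
Qed.

Lemma familyM p q : family C p -> family C q -> family C (fun t => p t * q t).
Proof.
move=> + fq; elim=> [|c P {}p Cc _ IH].
  rewrite (_ : (fun t => _) = (fun=> 0)); first exact: family0.
  by apply/funext => t; rewrite mul0r.
rewrite (_ : (fun t => _) = (fun t => (c t)%:MP * P * q t + p t * q t)); last first.
  by apply/funext => t; rewrite mulrDl.
apply: familyD => // {IH}; elim: fq => [|d Q {}q Cd _ IHq].
  rewrite (_ : (fun t => _) = (fun=> 0)); first exact: family0.
  by apply/funext => t; rewrite mulr0.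
rewrite (_ : (fun t => _) =
    (fun t => (c t * d t)%:MP * (P * Q) + (c t)%:MP * P * q t)).
  by apply: family_cons => //; exact: C_mul.
by apply/funext => t; ring.
Qed.

Lemma familyN p : family C p -> family C (fun t => - p t).
Proof.
move=> fp; rewrite (_ : (fun t => _) = (fun t => (-1) * p t)).
  by apply: familyM => //; exact: family_cst.
by apply/funext => t; rewrite mulN1r.
Qed.

Lemma familyB p q : family C p -> family C q -> family C (fun t => p t - q t).
Proof. by move=> fp fq; apply: familyD => //; exact: familyN. Qed.

Lemma familyX p k : family C p -> family C (fun t => p t ^+ k).
Proof.
move=> fp; elim: k => [|k IH].
  by rewrite (_ : (fun t => _) = (fun=> 1)); [exact: family_cst|apply/funext => t; rewrite expr0].
rewrite (_ : (fun t => _) = (fun t => p t * p t ^+ k)); first exact: familyM.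
by apply/funext => t; rewrite exprS.
Qed.

End Algebra.

Lemma family_msize C p : family C p -> exists k, forall t, (msize (p t) <= k)%N.
Proof.
elim=> [|c P {}p _ _ [k pk]]; first by exists 0 => t; rewrite msize0.
exists (maxn (msize P) k) => t; apply: leq_trans (msizeD_le _ _) _.
rewrite geq_max; apply/andP; split; last by apply: leq_trans (pk t) _; rewrite leq_maxr.
by rewrite mul_mpolyC; apply: leq_trans (msizeZ_le _ _) _; rewrite leq_maxl.
Qed.

Definition bounded_coef : set (T -> R) := [set c | exists B, forall t, `|c t| <= B].

Definition bfamily := family bounded_coef.

Lemma bounded_coef_cst (c : R) : bounded_coef (fun=> c).
Proof. by exists `|c|. Qed.

Lemma bounded_coefM c d :
  bounded_coef c -> bounded_coef d -> bounded_coef (fun t => c t * d t).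
Proof. by move=> [B HB] [D HD]; exists (B * D) => t; rewrite normrM ler_pM. Qed.

Lemma bfamily_coef c : bounded_coef c -> bfamily (fun t => (c t)%:MP).
Proof. exact: family_coef. Qed.
Lemma bfamily_cst P : bfamily (fun=> P).
Proof. exact: (family_cst bounded_coef_cst). Qed.
Lemma bfamilyD p q : bfamily p -> bfamily q -> bfamily (fun t => p t + q t).
Proof. exact: familyD. Qed.
Lemma bfamilyM p q : bfamily p -> bfamily q -> bfamily (fun t => p t * q t).
Proof. exact: (familyM bounded_coefM). Qed.
Lemma bfamilyN p : bfamily p -> bfamily (fun t => - p t).
Proof. exact: (familyN bounded_coef_cst bounded_coefM). Qed.
Lemma bfamilyB p q : bfamily p -> bfamily q -> bfamily (fun t => p t - q t).
Proof. exact: (familyB bounded_coef_cst bounded_coefM). Qed.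
Lemma bfamilyX p k : bfamily p -> bfamily (fun t => p t ^+ k).
Proof. exact: (familyX bounded_coef_cst bounded_coefM). Qed.
Lemma bfamily_sum I (r : seq I) (F : I -> T -> A) :
  (forall i, bfamily (F i)) -> bfamily (fun t => \sum_(i <- r) F i t).
Proof. exact: family_sum. Qed.

Lemma bfamily_bounded (K : R) p : bfamily p ->
  exists B, forall t x, in_box K x -> `|peval (p t) x| <= B.
Proof.
elim=> [|c P {}p [B HB] _ [D HD]]; first by exists 0 => t x _; rewrite peval0 normr0.
have [E HE] := poly_bounded_on_box K P.
exists (B * E + D) => t x xK; rewrite pevalD pevalM pevalC.
by apply: le_trans (ler_normD _ _) _; rewrite normrM lerD ?HD// ler_pM ?HE.
Qed.

Lemma bfamily_lipschitz (K : R) p : bfamily p ->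
  exists C, forall t x y, in_box K x -> in_box K y ->
    `|peval (p t) x - peval (p t) y| <= C * \sum_i `|x 0 i - y 0 i|.
Proof.
elim=> [|c P {}p [B HB] _ [D HD]].
  by exists 0 => t x y _ _; rewrite !peval0 subrr normr0 mul0r.
have [E HE] := poly_lipschitz_on_box K P.
exists (B * E + D) => t x y xK yK; rewrite !pevalD !pevalM !pevalC.
rewrite opprD addrACA -mulrBr mulrDl.
apply: le_trans (ler_normD _ _) _; rewrite lerD ?HD//.
by rewrite normrM -mulrA ler_pM ?HE.
Qed.

End Families.

Section Truncation.
Variables (R : realType) (n m : nat) (g : m.-tuple {mpoly R[n]}).
Local Notation A := {mpoly R[n]}.
Local Notation M := (trunc_qmodule g).

Lemma trunc_widen d e f : (d <= e)%N -> M d f -> M e f.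
Proof.
move=> de [p Hp ->]; exists p => // i q qp.
by apply: leq_trans (Hp i q qp) _; rewrite ltnS.
Qed.

Lemma truncD d f h : M d f -> M d h -> M d (f + h).
Proof.
move=> [p Hp ->] [q Hq ->]; exists (fun i => p i ++ q i) => [i a|].
  by rewrite mem_cat => /orP[/Hp|/Hq].
by rewrite -big_split; apply: eq_bigr => i _; rewrite big_cat.
Qed.

Lemma trunc_sqrM k d a f : (msize (a ^+ 2) <= k)%N -> M d f -> M (d + k) (a ^+ 2 * f).
Proof.
move=> ak [p Hp ->]; exists (fun i => [seq a * b | b <- p i]) => [i _ /mapP[b bp ->]|].
  rewrite exprMn -mulrA; apply: leq_trans (msizeM_leD _ _) _.
  by rewrite addnC -addSn; apply: leq_add => //; exact: Hp.
rewrite mulr_sumr; apply: eq_bigr => i _; rewrite big_map mulr_sumr.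
by apply: eq_bigr => b _; rewrite exprMn mulrA.
Qed.

Lemma trunc0 d : M d 0.
Proof.
exists (fun=> [::]) => //; rewrite big1// => i _; exact: big_nil.
Qed.

Lemma trunc_gen (i : 'I_m.+1) : exists d, M d (tnth (with_one g) i).
Proof.
exists (msize (tnth (with_one g) i)).
exists (fun j => if j == i then [:: 1] else [::]) => [j q|].
  by case: eqP => // ->; rewrite inE => /eqP ->; rewrite expr1n mul1r /deg_le leqnSn.
rewrite (bigD1 i)//= eqxx big_seq1 expr1n mul1r big1 ?addr0// => j /negPf ->.
by rewrite big_nil.
Qed.

Lemma trunc_g (i : 'I_m) : exists d, M d (tnth g i).
Proof. by have [d Md] := trunc_gen (lift ord0 i); exists d; rewrite tnthS in Md. Qed.

Lemma trunc_1 : exists d, M d 1.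
Proof. by have [d Md] := trunc_gen ord0; exists d; rewrite tnth0 in Md. Qed.

Lemma trunc_scale d c f : 0 <= c -> M d f -> M d (c%:MP * f).
Proof.
move=> c0 Mf; have -> : c%:MP = (Num.sqrt c)%:MP ^+ 2 :> A.
  by rewrite -rmorphXn /= sqr_sqrtr.
move: Mf => [p Hp ->].
exists (fun i => [seq (Num.sqrt c)%:MP * b | b <- p i]) => [i _ /mapP[b bp ->]|].
  rewrite exprMn -mulrA -rmorphXn /= mul_mpolyC.
  by apply: leq_trans (msizeZ_le _ _) _; exact: Hp.
rewrite mulr_sumr; apply: eq_bigr => i _; rewrite big_map mulr_sumr.
by apply: eq_bigr => b _; rewrite exprMn mulrA.
Qed.

Lemma trunc_ge0 d f x : M d f -> semialg g x -> 0 <= peval f x.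
Proof.
move=> [p _ ->] Sx; rewrite pevalE; apply: sumr_ge0 => i _.
rewrite pevalE; apply: sumr_ge0 => q _; rewrite pevalE pevalE mulr_ge0 ?sqr_ge0//.
case: (unliftP ord0 i) => [j ->|->]; first by rewrite tnthS; exact: Sx.
by rewrite tnth0 peval1.
Qed.

Lemma qmodule_quadratic_module : quadratic_module (qmodule g).
Proof.
split.
- by have [d Md] := trunc_1; exists d.
- move=> a b [d _ Ma] [e _ Mb]; exists (maxn d e) => //.
  by apply: truncD; [apply: trunc_widen Ma|apply: trunc_widen Mb]; rewrite (leq_maxl,leq_maxr).
- by move=> a b [d _ Mb]; exists (d + msize (a ^+ 2))%N => //; exact: trunc_sqrM.
Qed.

Hypothesis g_arch : archimedean_qmodule g.

Lemma qmodule_absorbing : absorbing (qmodule g).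
Proof. by move=> a; have [N [_ H _]] := g_arch a; exists N. Qed.

(** Putinar's theorem: the point separating [f] from the quadratic module would
    lie in [semialg g], where [f] is positive. *)
Theorem archimedean_positivstellensatz f :
  (forall x, semialg g x -> 0 < peval f x) -> exists d, M d f.
Proof.
move=> fpos; have [[d _ Md]|nMf] := pselect (qmodule g f); first by exists d.
have [x [xM fx]] := archimedean_separation qmodule_quadratic_module qmodule_absorbing nMf.
have Sx : semialg g x.
  by move=> i; apply: xM; have [d Md] := trunc_g i; exists d.
by have := fpos x Sx; rewrite ltNge fx.
Qed.

Lemma archimedean_bound p : exists N : R, exists d,
  [/\ 0 < N, M d (N%:MP + p), M d (N%:MP - p) &
      forall x, semialg g x -> `|peval p x| <= N].
Proof.
have [N [N0 [d _ Md] [e _ Me]]] := g_arch p.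
have Md' : M (maxn d e) (N%:R%:MP + p).
  by rewrite rmorph_nat; apply: trunc_widen Md; rewrite leq_maxl.
have Me' : M (maxn d e) (N%:R%:MP - p).
  by rewrite rmorph_nat; apply: trunc_widen Me; rewrite leq_maxr.
exists N%:R, (maxn d e); split => //; first by rewrite ltr0n.
move=> x Sx; have := trunc_ge0 Md' Sx; have := trunc_ge0 Me' Sx.
by rewrite !pevalE ler_norml; lra.
Qed.

Lemma semialg_box : exists K : R, 0 < K /\ semialg g `<=` in_box K.
Proof.
have /choice[N HN] : forall i : 'I_n, exists N : R, forall x, semialg g x -> `|x 0 i| <= N.
  move=> i; have [N [d [_ _ _ H]]] := archimedean_bound 'X_i.
  by exists N => x Sx; rewrite -(pevalX i x) H.
exists (1 + \sum_i `|N i|); split; first by rewrite ltr_pwDl// sumr_ge0.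
move=> x Sx i; apply: le_trans (HN i x Sx) _; apply: le_trans (ler_norm _) _.
by rewrite (bigD1 i)//= addrCA lerDl addr_ge0// sumr_ge0.
Qed.

Section BoundedFamilies.
Variable T : Type.

(** Membership in the quadratic module with a degree bound common to all [t]. *)
Definition btrunc (p : T -> A) : Prop := exists d, forall t, M d (p t).

Lemma btruncD p q : btrunc p -> btrunc q -> btrunc (fun t => p t + q t).
Proof.
move=> [d Hd] [e He]; exists (maxn d e) => t.
by apply: truncD; [apply: trunc_widen (Hd t)|apply: trunc_widen (He t)]; rewrite (leq_maxl,leq_maxr).
Qed.

Lemma btrunc_sqrM C a p : family C a -> btrunc p -> btrunc (fun t => a t ^+ 2 * p t).
Proof.
move=> /family_msize[k ak] [d Hd]; exists (d + (k + k))%N => t.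
apply: trunc_sqrM => //; rewrite expr2; apply: leq_trans (msizeM_leD _ _) _.
exact: leq_add.
Qed.

Lemma btrunc1 : btrunc (fun=> 1).
Proof. by have [d H] := trunc_1; exists d. Qed.

Lemma btrunc_sqr C a : family C a -> btrunc (fun t => a t ^+ 2).
Proof.
move=> fa; rewrite (_ : (fun t => _) = (fun t => a t ^+ 2 * 1)).
  by apply: (btrunc_sqrM fa); exact: btrunc1.
by apply/funext => t; rewrite mulr1.
Qed.

Lemma btrunc_scale (c : T -> R) p :
  (forall t, 0 <= c t) -> btrunc p -> btrunc (fun t => (c t)%:MP * p t).
Proof. by move=> c0 [d H]; exists d => t; exact: trunc_scale. Qed.

Lemma btrunc_sum I (r : seq I) (F : I -> T -> A) :
  (forall i, btrunc (F i)) -> btrunc (fun t => \sum_(i <- r) F i t).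
Proof.
move=> FC; elim: r => [|i r IH]; first by exists 0 => t; rewrite big_nil; exact: trunc0.
rewrite (_ : (fun t => _) = (fun t => F i t + \sum_(j <- r) F j t)); first exact: btruncD.
by apply/funext => t; rewrite big_cons.
Qed.

Lemma btrunc_sum_cond I (r : seq I) (P : pred I) (F : I -> T -> A) :
  (forall i, P i -> btrunc (F i)) -> btrunc (fun t => \sum_(i <- r | P i) F i t).
Proof.
move=> FC; rewrite (_ : (fun t => _) = fun t => \sum_(i <- r) if P i then F i t else 0).
  apply: btrunc_sum => i; have [Pi|_] := boolP (P i); first exact: FC.
  by exists 0 => t; exact: trunc0.
by apply/funext => t; rewrite big_mkcond.
Qed.

(** Induction on the number of coefficient functions: the first one, [c], is
    rounded to finitely many values [v], and [(c t - v) * P] is absorbed by a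
    small constant because [N +- P] lies in the quadratic module. *)
Lemma uniform_positivstellensatz_aux (p : T -> A) : bfamily p ->
  forall P0 (c0 : R), 0 < c0 -> exists d, forall t,
    (forall x, semialg g x -> c0 <= peval (P0 + p t) x) -> M d (P0 + p t).
Proof.
elim=> [|c P {}p [C HC] _ IH] P0 c0 c00.
  have [H|H] := pselect (forall x, semialg g x -> c0 <= peval P0 x).
    have [|d Md] := @archimedean_positivstellensatz P0.
      by move=> x Sx; exact: lt_le_trans c00 (H x Sx).
    by exists d => t _; rewrite addr0.
  by exists 0 => t; rewrite addr0 => /H.
have [N [dN [N0 MN1 MN2 HN]]] := archimedean_bound P.
pose e := c0 / (4 * N).
have e0 : 0 < e by rewrite divr_gt0// mulr_gt0.
have eN : e * N = c0 / 4 by rewrite /e; field; rewrite gt_eqF.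
have C0 t : 0 <= c t + C by have := HC t; rewrite ler_norml; lra.
have c2 : 0 < c0 / 2 by rewrite divr_gt0.
pose v (j : nat) := - C + j%:R * e.
have [K HK] : exists K : nat, 2 * C / e < K%:R.
  have [C_ge0|C_lt0] := leP 0 C.
    exists (Num.bound (2 * C / e)); apply: archi_boundP.
    by rewrite mulr_ge0 ?invr_ge0 ?(ltW e0)// mulr_ge0.
  by exists 0; rewrite pmulr_llt0 ?invr_gt0//; lra.
have [d Hd] : exists d, forall j, (j <= K)%N -> forall t,
    (forall x, semialg g x -> c0 / 2 <= peval (P0 + (v j)%:MP * P - (c0 / 4)%:MP + p t) x) ->
    M d (P0 + (v j)%:MP * P - (c0 / 4)%:MP + p t).
  elim: (K) => [|k [d Hd]].
    have [d Hd] := IH (P0 + (v 0)%:MP * P - (c0 / 4)%:MP) _ c2.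
    by exists d => j; rewrite leqn0 => /eqP ->.
  have [d' Hd'] := IH (P0 + (v k.+1)%:MP * P - (c0 / 4)%:MP) _ c2.
  exists (maxn d d') => j; rewrite leq_eqVlt => /orP[/eqP->|jk] t Ht.
    by apply: trunc_widen (Hd' _ Ht); rewrite leq_maxr.
  by apply: trunc_widen (Hd j jk _ Ht); rewrite leq_maxl.
exists (maxn d dN) => t Ht.
pose j := Num.truncn ((c t + C) / e).
have j0 : 0 <= (c t + C) / e by rewrite divr_ge0// ltW.
have /andP[j1 j2] := truncn_itv j0; rewrite -/j in j1 j2.
rewrite ler_pdivlMr// in j1; rewrite ltr_pdivrMr// -natr1 mulrDl mul1r in j2.
have jK : (j <= K)%N.
  rewrite -(ler_nat R); apply: le_trans (ltW HK); rewrite ler_pdivlMr//.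
  by have := HC t; rewrite ler_norml; lra.
pose D := c t - v j.
have D0 : 0 <= D by rewrite /D /v; lra.
have De : D <= e by rewrite /D /v; lra.
have -> : P0 + ((c t)%:MP * P + p t) =
   P0 + (v j)%:MP * P - (c0 / 4)%:MP + p t + (((e + D) / 2)%:MP * (N%:MP + P)
     + ((e - D) / 2)%:MP * (N%:MP - P)).
  have -> : (c0 / 4)%:MP = (e * N)%:MP :> A by rewrite eN.
  have -> : (e + D) / 2 = e - (e - D) / 2 by field.
  have -> : c t = v j + (D - (e - D) / 2) + (e - D) / 2 by rewrite /D; ring.
  have E : (e - D) / 2 + (e - D) / 2 = e - D by field.
  have E' : D = e - ((e - D) / 2 + (e - D) / 2) by rewrite E; ring.
  rewrite {1}E'; ring.
apply: truncD.
  apply: (trunc_widen (leq_maxl _ _)); apply: Hd => // x Sx.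
  have := Ht x Sx; rewrite !pevalE.
  have : `|D * peval P x| <= c0 / 4.
    by rewrite -eN normrM ger0_norm// ler_pM// HN.
  have -> : c t * peval P x = v j * peval P x + D * peval P x by rewrite /D; ring.
  by rewrite ler_norml; lra.
by apply: (trunc_widen (leq_maxr _ _)); apply: truncD; apply: trunc_scale => //; lra.
Qed.

Theorem uniform_positivstellensatz (p : T -> A) (c0 : R) : bfamily p -> 0 < c0 ->
  (forall t x, semialg g x -> c0 <= peval (p t) x) -> btrunc p.
Proof.
move=> fp c00 H; have [d Hd] := uniform_positivstellensatz_aux fp 0 c00.
by exists d => t; rewrite -[p t]add0r; apply: Hd => x; rewrite add0r; exact: H.
Qed.

End BoundedFamilies.
End Truncation.

(** * Positivity certificates in the presence of nondegenerate zeros *)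

Lemma bernoulli_le1 (R : realFieldType) (x : R) k :
  0 <= x -> x <= 1 -> (1 - x) ^+ k * (1 + k%:R * x) <= 1.
Proof.
move=> x0 x1; elim: k => [|k IH]; first by rewrite expr0 mul0r addr0 mul1r.
apply: le_trans IH; rewrite exprSr -mulrA ler_wpM2l ?exprn_ge0 ?subr_ge0//.
rewrite -natr1; set K := k%:R : R.
have -> : (1 - x) * (1 + (K + 1) * x) = 1 + K * x - (K + 1) * x ^+ 2 by ring.
by rewrite lerBlDr lerDl mulr_ge0 ?sqr_ge0// addr_ge0 ?ler0n.
Qed.

Lemma expr_small (R : realType) (x e : R) :
  0 < x -> x <= 1 -> 0 < e -> exists k, (1 - x) ^+ k <= e.
Proof.
move=> x0 x1 e0; exists (Num.bound (e * x)^-1).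
set k := Num.bound _.
have kP : (e * x)^-1 < k%:R by apply: archi_boundP; rewrite invr_ge0 ltW// mulr_gt0.
have D0 : 0 < 1 + k%:R * x by rewrite ltr_pwDl// mulr_ge0 ?ler0n// ltW.
have := bernoulli_le1 k (ltW x0) x1; rewrite -ler_pdivlMr// div1r => H.
apply: le_trans H _; rewrite -[leRHS]invrK lef_pV2 ?posrE ?invr_gt0//.
apply: ltW; apply: lt_trans (_ : k%:R * x < _); last by rewrite ltrDr ltr01.
by rewrite -ltr_pdivrMr// -invfM.
Qed.

Lemma lagrange_identity (K : comPzRingType) (I : finType) (y z : I -> K) :
  2 * ((\sum_i y i ^+ 2) * (\sum_i z i ^+ 2) - (\sum_i y i * z i) ^+ 2) =
  \sum_i \sum_j (y i * z j - y j * z i) ^+ 2.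
Proof.
have -> : \sum_i \sum_j (y i * z j - y j * z i) ^+ 2 =
  \sum_i \sum_j (y i ^+ 2 * z j ^+ 2) + \sum_i \sum_j (z i ^+ 2 * y j ^+ 2)
  - 2 * \sum_i \sum_j (y i * z i) * (y j * z j).
  rewrite !mulr_sumr -!big_split -sumrB /=; apply: eq_bigr => i _.
  rewrite !mulr_sumr -!big_split -sumrB /=; apply: eq_bigr => j _.
  by ring.
rewrite -!big_distrlr /= [(\sum_i z i ^+ 2) * _]mulrC expr2.
by set a := \sum_i _; set b := \sum_i _; set d := \sum_i _; ring.
Qed.

(** The pointwise estimate behind the division by [s]: [sg] is a bump that is 1
    where [s = 0] and dominated by the remaining zeros [w] away from there. *)
Lemma bump_estimate (R : realFieldType) (s w W sg tau f q delta c r2 eps Q : R) :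
  0 <= s -> 0 <= w -> w <= W -> 0 < W -> 0 < delta -> 0 < c ->
  sg + s * tau = 1 -> 0 <= sg -> sg <= 1 -> (s = 0 -> 0 <= tau) ->
  delta * (w * s) <= f -> (s <= r2 -> c / 2 <= q) -> `|q| <= Q ->
  (r2 < s -> sg <= eps * w /\ sg <= 1 / 2) -> Q * eps <= delta / 4 ->
  Num.min (c / (2 * W)) (delta / 4) * w <= sg * q + tau * f.
Proof.
move=> s0 w0 wW W0 d0 c0 E sg0 sg1 tau0 fge qge qQ sgs Qe.
set b := Num.min _ _.
have b1 : b <= c / (2 * W) by rewrite ge_min lexx.
have b2 : b <= delta / 4 by rewrite ge_min lexx orbT.
have bw : b * w <= c / 2.
  apply: le_trans (_ : c / (2 * W) * W <= _); last first.
    by have -> : c / (2 * W) * W = c / 2 by field; rewrite gt_eqF.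
  by apply: le_trans (ler_wpM2r w0 b1) _; rewrite ler_wpM2l// divr_ge0 ?ltW// mulr_gt0.
have b2w : b * w <= delta / 4 * w by rewrite ler_wpM2r.
have dw : 0 <= delta * w by rewrite mulr_ge0// ltW.
have [s_eq0|s_neq0] := eqVneq s 0.
  have sgE : sg = 1 by move: E; rewrite s_eq0 mul0r addr0.
  have r2s : s <= r2.
    by rewrite leNgt; apply/negP => /sgs[_]; rewrite sgE; lra.
  have f0 : 0 <= f by move: fge; rewrite s_eq0 !mulr0.
  by have := mulr_ge0 (tau0 s_eq0) f0; have := qge r2s; rewrite sgE mul1r; lra.
have s_gt0 : 0 < s by rewrite lt_def s_neq0.
have tauE : tau = (1 - sg) / s.
  by apply: (mulfI s_neq0); rewrite -E; field.
have tau_ge0 : 0 <= tau by rewrite tauE divr_ge0 ?subr_ge0.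
have tf : (1 - sg) * (delta * w) <= tau * f.
  have -> : (1 - sg) * (delta * w) = tau * (delta * (w * s)) by rewrite tauE; field.
  by rewrite ler_wpM2l.
have [sr|rs] := leP s r2.
  have sgq : sg * (b * w) <= sg * q by rewrite ler_wpM2l//; have := qge sr; lra.
  have : (1 - sg) * (b * w) <= (1 - sg) * (delta * w).
    by rewrite ler_wpM2l ?subr_ge0//; lra.
  lra.
have [sgw sgh] := sgs rs.
have Q0 : 0 <= Q by apply: le_trans qQ.
have sgq : - (delta / 4 * w) <= sg * q.
  suff : `|sg * q| <= delta / 4 * w by rewrite ler_norml => /andP[].
  rewrite normrM ger0_norm//; apply: le_trans (_ : eps * w * Q <= _).
    exact: ler_pM.
  have -> : eps * w * Q = Q * eps * w by ring.
  by rewrite ler_wpM2r.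
have : 1 / 2 * (delta * w) <= (1 - sg) * (delta * w).
  by rewrite ler_wpM2r//; lra.
lra.
Qed.

Definition dist2 (R : realType) n (x y : 'rV[R]_n) : R := \sum_i (x 0 i - y 0 i) ^+ 2.

Lemma dist2_ge0 (R : realType) n (x y : 'rV[R]_n) : 0 <= dist2 x y.
Proof. by apply: sumr_ge0 => i _; exact: sqr_ge0. Qed.

Lemma dist2_coord (R : realType) n (x y : 'rV[R]_n) i : (x 0 i - y 0 i) ^+ 2 <= dist2 x y.
Proof. by rewrite /dist2 (bigD1 i)//= lerDl sumr_ge0// => j _; exact: sqr_ge0. Qed.

Lemma dist2_box (R : realType) n (K : R) (x y : 'rV[R]_n) :
  in_box K x -> in_box K y -> dist2 x y <= n%:R * (2 * K) ^+ 2.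
Proof.
move=> xK yK; rewrite /dist2; apply: le_trans (_ : \sum_(i < n) (2 * K) ^+ 2 <= _).
  apply: ler_sum => i _.
  have := xK i; have := yK i; rewrite !ler_norml => /andP[? ?] /andP[? ?].
  have ? : 0 <= 2 * K - (x 0 i - y 0 i) by lra.
  have ? : 0 <= 2 * K + (x 0 i - y 0 i) by lra.
  by rewrite -subr_ge0 subr_sqr mulr_ge0.
by rewrite sumr_const card_ord [leRHS]mulr_natl.
Qed.

Section MovingZeros.
Variables (R : realType) (n m : nat) (g : m.-tuple {mpoly R[n]}) (T : Type).
Hypothesis g_arch : archimedean_qmodule g.
Local Notation A := {mpoly R[n]}.
Local Notation btrunc := (@btrunc R n m g T).
Implicit Types (u v : T -> 'rV[R]_n) (p q f e z : T -> A).

Definition bounded_point u := exists K : R, forall t, in_box K (u t).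

Definition shift_var u (i : 'I_n) (t : T) : A := 'X_i - (u t 0 i)%:MP.

Definition sq_dist u (t : T) : A := \sum_i shift_var u i t ^+ 2.

Lemma shift_varE u i t x : peval (shift_var u i t) x = x 0 i - u t 0 i.
Proof. by rewrite /shift_var !pevalE. Qed.

Lemma sq_distE u t x : peval (sq_dist u t) x = dist2 x (u t).
Proof. by rewrite /sq_dist pevalE; apply: eq_bigr => i _; rewrite pevalXn shift_varE. Qed.

Lemma bounded_point_coef u i : bounded_point u -> bounded_coef (fun t => u t 0 i).
Proof. by move=> [K HK]; exists K => t; exact: HK. Qed.

Lemma bfamily_shift_var u i : bounded_point u -> bfamily (shift_var u i).
Proof.
move=> bu; apply: bfamilyB; first exact: bfamily_cst.
by apply: bfamily_coef; exact: bounded_point_coef.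
Qed.

Lemma bfamily_sq_dist u : bounded_point u -> bfamily (sq_dist u).
Proof. by move=> bu; apply: bfamily_sum => i; apply: bfamilyX; exact: bfamily_shift_var. Qed.

Lemma btrunc_sq_distM u p :
  bounded_point u -> btrunc p -> btrunc (fun t => sq_dist u t * p t).
Proof.
move=> bu bp; rewrite (_ : (fun t => _) = (fun t => \sum_i shift_var u i t ^+ 2 * p t)).
  by apply: btrunc_sum => i; apply: btrunc_sqrM => //; exact: bfamily_shift_var.
by apply/funext => t; rewrite mulr_suml.
Qed.

(** Up to a certificate, [f] is [sq_dist u] times a family that is positive at the
    moving point [u]: this is what a zero with positive definite Hessian gives.
    The value of [f] at [u] may also be positive, the constant being then part of
    the certificate, so that nearby minima need not be exact zeros. *)
Definition nondegenerate_at u f := exists q (c : R),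
  [/\ bfamily q, 0 < c, forall t, c <= peval (q t) (u t) &
      btrunc (fun t => f t - sq_dist u t * q t)].

Lemma btrunc_cauchy_schwarz v e (z : 'I_n -> T -> A) :
  bounded_point v -> (forall i, bfamily (z i)) ->
  (forall t, e t = \sum_i shift_var v i t * z i t) ->
  btrunc (fun t => sq_dist v t * \sum_i z i t ^+ 2 - e t ^+ 2).
Proof.
move=> bv bz Ee.
rewrite (_ : (fun t => _) = (fun t => (2^-1)%:MP *
    \sum_i \sum_j (shift_var v i t * z j t - shift_var v j t * z i t) ^+ 2)).
  apply: btrunc_scale => [_|]; first by rewrite invr_ge0.
  apply: btrunc_sum => i; apply: btrunc_sum => j; apply: (@btrunc_sqr _ _ _ _ _ (@bounded_coef R T)).
  by apply: bfamilyB; apply: bfamilyM => //; exact: bfamily_shift_var.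
apply/funext => t; rewrite -lagrange_identity -Ee mulrA.
have -> : 2 = (2 : R)%:MP :> A by rewrite rmorph_nat.
by rewrite -rmorphM mulVf ?pnatr_eq0//= rmorph1 mul1r.
Qed.

(** Terms vanishing to fourth order do not affect nondegeneracy: by
    Cauchy-Schwarz [e ^+ 2] is dominated by a multiple of [sq_dist v]. *)
Lemma fourth_order_negligible v e (z : 'I_n -> T -> A) h :
  bounded_point v -> (forall i, bfamily (z i)) ->
  (forall t, e t = \sum_i shift_var v i t * z i t) -> bfamily h ->
  exists r, [/\ bfamily r, forall t, peval (r t) (v t) = 0 &
    btrunc (fun t => e t ^+ 4 * h t - sq_dist v t * r t)].
Proof.
move=> bv bz Ee bh.
have be : bfamily e.
  rewrite (_ : e = fun t => \sum_i shift_var v i t * z i t); last exact/funext.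
  by apply: bfamily_sum => i; apply: bfamilyM => //; exact: bfamily_shift_var.
have bz2 : bfamily (fun t => \sum_i z i t ^+ 2) by apply: bfamily_sum => i; exact: bfamilyX.
have [K [K0 SK]] := semialg_box g_arch.
have [B HB] := bfamily_bounded K bh.
pose N := `|B| + 1.
have N0 : 0 <= N by rewrite addr_ge0.
exists (fun t => (- N)%:MP * (e t ^+ 2 * \sum_i z i t ^+ 2)); split.
- by apply: bfamilyM; [exact: bfamily_cst | apply: bfamilyM => //; exact: bfamilyX].
- move=> t; have e0 : peval (e t) (v t) = 0.
    by rewrite Ee pevalE big1// => i _; rewrite pevalM shift_varE subrr mul0r.
  by rewrite pevalM [peval (_ ^+ 2 * _) _]pevalM pevalXn e0 expr0n /= mul0r mulr0.
rewrite (_ : (fun t => _) = (fun t => (e t ^+ 2) ^+ 2 * (h t + N%:MP) +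
   N%:MP * (e t ^+ 2 * (sq_dist v t * \sum_i z i t ^+ 2 - e t ^+ 2)))); last first.
  by apply/funext => t; ring.
apply: btruncD.
  apply: (@btrunc_sqrM _ _ _ _ _ (@bounded_coef R T)); first exact: bfamilyX.
  apply: (@uniform_positivstellensatz _ _ _ _ g_arch _ _ 1) => //.
    by apply: bfamilyD => //; exact: bfamily_cst.
  move=> t x Sx; rewrite pevalD pevalC /N.
  have := HB t x (SK x Sx); rewrite ler_norml => /andP[+ _].
  by have := ler_norm B; lra.
apply: (@btrunc_scale _ _ _ _ _ (fun=> N)) => //; apply: (btrunc_sqrM be).
exact: btrunc_cauchy_schwarz.
Qed.

Section Peel.
Variables (u : T -> 'rV[R]_n) (k : nat) (U : 'I_k -> T -> 'rV[R]_n).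
Hypotheses (bu : bounded_point u) (bU : forall i, bounded_point (U i)).
Variable rho : R.
Hypotheses (rho0 : 0 < rho) (sep : forall i t, rho <= dist2 (U i t) (u t)).

Local Notation s := (sq_dist u).

(** Families congruent to 1 modulo [s]; the sign of the quotient at [u] makes the
    quotient [tau] of [1 - Z ^+ 2] by [s] nonnegative there, where it cannot be
    read off from [s * tau]. *)
Definition unital (Z : T -> A) := exists z,
  [/\ bfamily z, forall t, Z t = 1 - s t * z t &
      forall t x, dist2 x (u t) = 0 -> 0 <= peval (z t) x].

Lemma unital1 : unital (fun=> 1).
Proof.
exists (fun=> 0); split => [|t|t x _]; last by rewrite peval0.
  exact: family0.
by rewrite mulr0 subr0.
Qed.

Lemma unitalM Y Z : unital Y -> unital Z -> unital (fun t => Y t * Z t).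
Proof.
move=> [y [by_ Ey y0]] [z [bz Ez z0]].
exists (fun t => y t + z t - s t * (y t * z t)); split.
- by apply: bfamilyB; [exact: bfamilyD | apply: bfamilyM; [exact: bfamily_sq_dist | exact: bfamilyM]].
- by move=> t; rewrite Ey Ez; ring.
- by move=> t x d0; rewrite !(sq_distE, pevalE) d0 mul0r subr0 addr_ge0 ?y0 ?z0.
Qed.

Lemma unitalX Z j : unital Z -> unital (fun t => Z t ^+ j).
Proof.
move=> uZ; elim: j => [|j IH].
  by rewrite (_ : (fun t => _) = (fun=> 1)); [exact: unital1|apply/funext => t; rewrite expr0].
rewrite (_ : (fun t => _) = (fun t => Z t * Z t ^+ j)); first exact: unitalM.
by apply/funext => t; rewrite exprS.
Qed.

Lemma unital_prod I (r : seq I) (Z : I -> T -> A) :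
  (forall i, unital (Z i)) -> unital (fun t => \prod_(i <- r) Z i t).
Proof.
move=> uZ; elim: r => [|i r IH].
  by rewrite (_ : (fun t => _) = (fun=> 1)); [exact: unital1|apply/funext => t; rewrite big_nil].
rewrite (_ : (fun t => _) = (fun t => Z i t * \prod_(j <- r) Z j t)); first exact: unitalM.
by apply/funext => t; rewrite big_cons.
Qed.

Lemma unital_linear (c : T -> R) : bounded_coef c -> (forall t, 0 <= c t) ->
  unital (fun t => 1 - (c t)%:MP * s t).
Proof.
move=> bc c0; exists (fun t => (c t)%:MP); split => [|t|t x _].
- exact: bfamily_coef.
- by rewrite mulrC.
- by rewrite pevalC.
Qed.

Lemma unital_bfamily Z : unital Z -> bfamily Z.
Proof.
move=> [z [bz /funext -> _]]; apply: bfamilyB; first exact: bfamily_cst.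
by apply: bfamilyM => //; exact: bfamily_sq_dist.
Qed.

Definition center_dist i (t : T) := dist2 (U i t) (u t).

Lemma center_dist_gt0 i t : 0 < center_dist i t. Proof. exact: lt_le_trans rho0 (sep i t). Qed.

Lemma center_dist_inv_bounded i : bounded_coef (fun t => (center_dist i t)^-1).
Proof.
exists rho^-1 => t; rewrite ger0_norm ?invr_ge0 ?dist2_ge0//.
by rewrite lef_pV2 ?posrE ?center_dist_gt0//; exact: sep.
Qed.

(** The affine function of [sq_dist u] with value 1 at [u] and 0 at [U i]. *)
Definition sphere i (t : T) : A := 1 - ((center_dist i t)^-1)%:MP * s t.

Lemma unital_sphere i : unital (sphere i).
Proof.
apply: (unital_linear (center_dist_inv_bounded i)) => t.
by rewrite invr_ge0 dist2_ge0.
Qed.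

(** Vanishing at [U i], the family [sphere i] is a combination of the coordinates
    of [X - U i]; it is so because [sq_dist u - D] is a difference of squares in
    each coordinate. *)
Lemma sphere_factor i : exists z : 'I_n -> T -> A,
  (forall j, bfamily (z j)) /\
  forall t, sphere i t = \sum_j shift_var (U i) j t * z j t.
Proof.
exists (fun j t => - ((center_dist i t)^-1)%:MP * (shift_var u j t + (U i t 0 j - u t 0 j)%:MP)); split.
  move=> j; apply: bfamilyM; first by apply: bfamilyN; apply: bfamily_coef; exact: center_dist_inv_bounded.
  apply: bfamilyD; first exact: bfamily_shift_var.
  rewrite (_ : (fun t => _) = (fun t => (U i t 0 j)%:MP - (u t 0 j)%:MP)).
    by apply: bfamilyB; apply: bfamily_coef; exact: bounded_point_coef.
  by apply/funext => t; rewrite rmorphB.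
move=> t.
have E : (center_dist i t)%:MP = \sum_j (((U i t 0 j)%:MP - (u t 0 j)%:MP) ^+ 2) :> A.
  by rewrite /center_dist /dist2 rmorph_sum /=; apply: eq_bigr => j _; rewrite rmorphXn rmorphB.
have E1 : 1 = ((center_dist i t)^-1)%:MP * (center_dist i t)%:MP :> A.
  by rewrite -rmorphM /= mulVf ?rmorph1// gt_eqF// center_dist_gt0.
rewrite /sphere {1}E1 E -mulrBr /sq_dist -sumrB mulr_sumr.
by apply: eq_bigr => j _; rewrite /shift_var rmorphB /=; ring.
Qed.

Lemma sphere_at i t : peval (sphere i t) (U i t) = 0.
Proof.
by rewrite /sphere !(sq_distE, pevalE) mulVf ?subrr// gt_eqF// center_dist_gt0.
Qed.

Variables (f q : T -> A) (delta c : R).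
Hypotheses (bf : bfamily f) (bq : bfamily q) (delta0 : 0 < delta) (c0 : 0 < c).
Hypothesis f_ge : forall t x, semialg g x ->
  delta * (\prod_i dist2 x (U i t) * dist2 x (u t)) <= peval (f t) x.
Hypothesis q_ge : forall t, c <= peval (q t) (u t).
Hypothesis fq : btrunc (fun t => f t - s t * q t).

(** Given the bump [Z], with [sigma := Z ^+ 2] and [1 - sigma = s * tau], the
    family [f = sigma * f + s * tau * f] is congruent to [s * peeled]. *)
Lemma peel_reduction Z z : bfamily Z -> (forall t, Z t = 1 - s t * z t) ->
  btrunc (fun t => Z t ^+ 2 * q t + (2 * z t - s t * z t ^+ 2) * f t) -> btrunc f.
Proof.
move=> bZ EZ H.
rewrite (_ : f = fun t => Z t ^+ 2 * (f t - s t * q t) +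
    s t * (Z t ^+ 2 * q t + (2 * z t - s t * z t ^+ 2) * f t)).
  by apply: btruncD; [exact: (btrunc_sqrM bZ) | exact: btrunc_sq_distM].
by apply/funext => t; rewrite EZ; ring.
Qed.

(** At another zero, multiplying the certificate of [f] by [tau] is not allowed in
    a quadratic module. But [s * tau = 1 - sigma] gives
    [tau = s * tau ^+ 2 + tau * sigma], where the first term is a sum of squares
    and the second one vanishes to fourth order at that zero. *)
Lemma peel_nondegenerate i Z z G : bfamily z -> (forall t, Z t = 1 - s t * z t) ->
  bfamily G -> (forall t, Z t = sphere i t ^+ 2 * G t) -> nondegenerate_at (U i) f ->
  nondegenerate_at (U i) (fun t => Z t ^+ 2 * q t + (2 * z t - s t * z t ^+ 2) * f t).
Proof.
move=> bz EZ bG EG [q' [c' [bq' c'0 q'_ge fq']]].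
pose tau t := 2 * z t - s t * z t ^+ 2.
have bs := bfamily_sq_dist bu.
have btau : bfamily tau.
  apply: bfamilyB; apply: bfamilyM => //; first exact: bfamily_cst.
  exact: bfamilyX.
have stau t : s t * tau t = 1 - Z t ^+ 2 by rewrite /tau EZ; ring.
have [w [bw Ew]] := sphere_factor i.
have bh : bfamily (fun t => G t ^+ 2 * (tau t * f t + q t)).
  by apply: bfamilyM; [exact: bfamilyX | apply: bfamilyD => //; exact: bfamilyM].
have [r [br r0 Hr]] := fourth_order_negligible (bU i) bw Ew bh.
have [K HK] := bu; have [K' HK'] := bU i.
pose Kb := `|K| + `|K'|.
have HKb t : in_box Kb (u t).
  by move=> j; apply: le_trans (HK t j) _; rewrite (le_trans (ler_norm K))// lerDl.
have HKb' t : in_box Kb (U i t).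
  by move=> j; apply: le_trans (HK' t j) _; rewrite (le_trans (ler_norm K'))// lerDr.
pose Dmax := n%:R * (2 * Kb) ^+ 2 + 1.
have Dmax0 : 0 < Dmax by rewrite ltr_wpDl// mulr_ge0 ?sqr_ge0.
have DD t : center_dist i t <= Dmax.
  by apply: le_trans (dist2_box (HKb' t) (HKb t)) _; rewrite lerDl.
exists (fun t => s t * (tau t ^+ 2 * q' t) + r t), (c' / Dmax); split.
- apply: bfamilyD => //; apply: bfamilyM => //; apply: bfamilyM => //; exact: bfamilyX.
- by rewrite divr_gt0.
- move=> t; rewrite pevalD r0 addr0 pevalM sq_distE pevalM pevalXn -/(center_dist i t).
  have Dt : center_dist i t * peval (tau t) (U i t) = 1.
    rewrite /center_dist -sq_distE -pevalM stau pevalB peval1 pevalXn EG pevalM pevalXn sphere_at.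
    by rewrite expr0n /= mul0r expr0n subr0.
  have -> : peval (tau t) (U i t) = (center_dist i t)^-1.
    by apply: (mulfI (negbT (gt_eqF (center_dist_gt0 i t)))); rewrite Dt mulfV// gt_eqF// center_dist_gt0.
  have -> : center_dist i t * ((center_dist i t)^-1 ^+ 2 * peval (q' t) (U i t)) = peval (q' t) (U i t) / center_dist i t.
    by field; rewrite gt_eqF// center_dist_gt0.
  apply: ler_pM => //; first exact: ltW.
    by rewrite invr_ge0 ltW.
  by rewrite lef_pV2 ?posrE ?center_dist_gt0.
- rewrite (_ : (fun t => _) = (fun t => s t * (tau t ^+ 2 * (f t - sq_dist (U i) t * q' t)) +
    (sphere i t ^+ 4 * (G t ^+ 2 * (tau t * f t + q t)) - sq_dist (U i) t * r t))).
    by apply: btruncD => //; apply: btrunc_sq_distM => //; exact: (btrunc_sqrM btau).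
  apply/funext => t; rewrite -/(tau t).
  have -> : sphere i t ^+ 4 * (G t ^+ 2 * (tau t * f t + q t)) = Z t ^+ 2 * (tau t * f t + q t).
    by rewrite EG; ring.
  have E : tau t * f t = (s t * tau t + Z t ^+ 2) * tau t * f t.
    by rewrite stau subrK mul1r.
  by rewrite [X in _ + X - _ = _]E; ring.
Qed.

Lemma dist2_bounded_on_semialg v : bounded_point v ->
  exists B : R, 1 <= B /\ forall t x, semialg g x -> dist2 x (v t) <= B.
Proof.
move=> [K HK]; have [K' [K'0 SK]] := semialg_box g_arch.
pose Kb := `|K| + K'.
exists (n%:R * (2 * Kb) ^+ 2 + 1); split.
  by rewrite lerDr mulr_ge0 ?sqr_ge0.
move=> t x Sx; apply: le_trans (_ : n%:R * (2 * Kb) ^+ 2 <= _); last by rewrite lerDl.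
apply: dist2_box => j; rewrite /Kb.
  by apply: le_trans (SK x Sx j) _; rewrite lerDr.
by apply: le_trans (HK t j) _; apply: le_trans (ler_norm K) _; rewrite lerDl ltW.
Qed.

Lemma sphere_sqr_le i : exists C : R, 0 < C /\
  forall t x, semialg g x -> peval (sphere i t) x ^+ 2 <= C * dist2 x (U i t).
Proof.
have [z [bz Ez]] := sphere_factor i.
have [d Hd] := btrunc_cauchy_schwarz (bU i) bz Ez.
have bz2 : bfamily (fun t => \sum_j z j t ^+ 2) by apply: bfamily_sum => j; exact: bfamilyX.
have [K [K0 SK]] := semialg_box g_arch.
have [B HB] := bfamily_bounded K bz2.
exists (`|B| + 1); split; first by rewrite ltr_wpDl.
move=> t x Sx; have := trunc_ge0 (Hd t) Sx.
rewrite pevalB pevalM sq_distE pevalXn subr_ge0 => H; apply: le_trans H _.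
rewrite mulrC ler_wpM2r ?dist2_ge0//; apply: le_trans (ler_norm _) _.
by apply: le_trans (HB t x (SK x Sx)) _; rewrite (le_trans (ler_norm B))// lerDl.
Qed.

(** The bump is [Z = (1 - s / B) ^+ N * \prod_i h i ^+ 2], where the factor [h i]
    vanishes at [U i] and is bounded by 1 on [S] thanks to the power [k1] of
    [1 - s / B] by Bernoulli's inequality; [N] is then taken large enough for
    [Z] to be negligible outside of a small ball around [u]. *)
Lemma peel_positive : exists Z z (b : R),
  [/\ bfamily z, forall t, Z t = 1 - s t * z t, 0 < b,
      forall t x, semialg g x -> b * \prod_i dist2 x (U i t) <=
        peval (Z t ^+ 2 * q t + (2 * z t - s t * z t ^+ 2) * f t) x &
      forall i, exists2 G, bfamily G & forall t, Z t = sphere i t ^+ 2 * G t].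
Proof.
have [B [B1 HB]] := dist2_bounded_on_semialg bu.
have B0 : 0 < B := lt_le_trans ltr01 B1.
have [K [HKu [K0 SK]]] : exists K : R, (forall t, in_box K (u t)) /\
    0 < K /\ semialg g `<=` in_box K.
  have [K [K0 SK]] := semialg_box g_arch; have [K' HK'] := bu.
  exists (K + `|K'|); split; last split.
  - move=> t j; apply: le_trans (HK' t j) _; apply: le_trans (ler_norm K') _.
    by rewrite lerDr ltW.
  - by rewrite ltr_pwDl.
  - by move=> x Sx j; apply: le_trans (SK x Sx j) _; rewrite lerDl.
have [L HL] := bfamily_lipschitz K bq.
have [Q0 HQ] := bfamily_bounded K bq.
pose Q := `|Q0| + 1.
have Qp : 0 < Q by rewrite ltr_wpDl.
have /choice[C HC] := sphere_sqr_le.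
have /choice[Bi HBi] : forall i, exists B : R, 1 <= B /\
    forall t x, semialg g x -> dist2 x (U i t) <= B.
  by move=> i; exact: dist2_bounded_on_semialg.
pose W := \prod_i Bi i; pose Ck := \prod_i C i.
have W0 : 0 < W.
  by apply: prodr_gt0 => i _; have [Bi1 _] := HBi i; exact: lt_le_trans Bi1.
have Ck0 : 0 < Ck by apply: prodr_gt0 => i _; have [] := HC i.
(* [q >= c / 2] within distance [r] of [u], as [q] is Lipschitz there. *)
pose r := Num.min 1 (c / (2 * (`|L| * n%:R + 1))).
have Ln : 0 < `|L| * n%:R + 1 by rewrite ltr_wpDl// mulr_ge0.
have r0 : 0 < r by rewrite lt_min ltr01 divr_gt0// mulr_gt0.
have r1 : r <= 1 by rewrite ge_min lexx.
have Lr : `|L| * (n%:R * r) <= c / 2.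
  apply: le_trans (_ : (`|L| * n%:R + 1) * r <= _).
    by rewrite mulrA ler_wpM2r ?lerDl// ltW.
  apply: le_trans (_ : (`|L| * n%:R + 1) * (c / (2 * (`|L| * n%:R + 1))) <= _).
    by rewrite ler_wpM2l ?(ltW Ln)// ge_min lexx orbT.
  by rewrite le_eqVlt; apply/orP; left; apply/eqP; field; rewrite gt_eqF.
have r2_gt0 : 0 < r ^+ 2 by rewrite exprn_gt0.
have [N HN] : exists N, (1 - r ^+ 2 / B) ^+ N <= Num.min (1 / 2) (delta / (4 * Q * Ck)).
  apply: expr_small.
  - by rewrite divr_gt0.
  - rewrite ler_pdivrMr// mul1r; apply: le_trans B1.
    by rewrite exprn_ile1// ltW.
  - by rewrite lt_min !divr_gt0// mulr_gt0// mulr_gt0.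
pose k1 := Num.bound (B / rho).
have k1P : B / rho <= k1%:R.
  by apply/ltW/archi_boundP; rewrite divr_ge0// ltW.
pose Y t : A := 1 - (B^-1)%:MP * s t.
have uY : unital Y.
  apply: (@unital_linear (fun=> B^-1)) => [|t]; first exact: bounded_coef_cst.
  by rewrite invr_ge0 ltW.
pose h i t := Y t ^+ k1 * sphere i t.
pose Z t := Y t ^+ N * \prod_i h i t ^+ 2.
have uh i : unital (h i) by apply: unitalM; [exact: unitalX | exact: unital_sphere].
have uZ : unital Z.
  by apply: unitalM; [exact: unitalX | apply: unital_prod => i; exact: unitalX].
have [z [bz EZ z0]] := uZ.
exists Z, z, (Num.min (c / (2 * W)) (delta / 4)); split => //.
- by rewrite lt_min !divr_gt0// mulr_gt0.
- move=> t x Sx; rewrite pevalD (pevalM (Z t ^+ 2)) (pevalM _ (f t)) pevalXn.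
   set sg := peval (Z t) x ^+ 2; set tau := peval (_ - _) x.
  set sx := dist2 x (u t).
  have sx0 : 0 <= sx := dist2_ge0 _ _.
  have sxB : sx <= B := HB t x Sx.
  have YE : peval (Y t) x = 1 - sx / B by rewrite /Y !(sq_distE, pevalE) mulrC.
  have sB0 : 0 <= sx / B by rewrite divr_ge0// ltW.
  have sB1 : sx / B <= 1 by rewrite ler_pdivrMr// mul1r.
  set y := 1 - sx / B in YE.
  have y0 : 0 <= y by rewrite subr_ge0.
  have y1 : y <= 1 by rewrite gerBl.
  have hE i : peval (h i t) x = y ^+ k1 * peval (sphere i t) x.
    by rewrite /h pevalM pevalXn YE.
  have sphE i : peval (sphere i t) x = 1 - sx / center_dist i t.
    by rewrite /sphere !(sq_distE, pevalE) mulrC.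
  have h1 i : peval (h i t) x ^+ 2 <= 1.
    rewrite -real_normK ?num_real// -[leRHS](expr1n _ 2) ler_sqr ?nnegrE//.
    rewrite hE sphE normrM ger0_norm ?exprn_ge0//.
    apply: le_trans (bernoulli_le1 k1 sB0 sB1); rewrite -/y ler_wpM2l ?exprn_ge0//.
    apply: le_trans (ler_normB _ _) _; rewrite normr1 lerD2l.
    rewrite ger0_norm ?divr_ge0 ?dist2_ge0//.
    apply: le_trans (_ : sx / rho <= _).
      by rewrite ler_wpM2l// lef_pV2 ?posrE ?center_dist_gt0//; exact: sep.
    have -> : sx / rho = B / rho * (sx / B) by field; rewrite !gt_eqF.
    by rewrite ler_wpM2r.
  have h2 i : peval (h i t) x ^+ 2 <= C i * dist2 x (U i t).
    have [_ HCi] := HC i; apply: le_trans (HCi t x Sx).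
    rewrite hE exprMn ler_piMl ?sqr_ge0// -exprM.
    by rewrite exprn_ile1.
  pose w := \prod_i dist2 x (U i t).
  have w0 : 0 <= w by apply: prodr_ge0 => i _; exact: dist2_ge0.
  have wW : w <= W.
    by apply: ler_prod => i _; rewrite dist2_ge0/=; have [_] := HBi i; exact.
  pose H := \prod_i peval (h i t) x ^+ 2.
  have H0 : 0 <= H by apply: prodr_ge0 => i _; exact: sqr_ge0.
  have H1 : H <= 1.
    by apply: prodr_ile1 => i _; rewrite sqr_ge0 h1.
  have Hw : H <= Ck * w.
    by rewrite /Ck /w -big_split /=; apply: ler_prod => i _; rewrite sqr_ge0 h2.
  have ZE : peval (Z t) x = y ^+ N * H.
    rewrite /Z pevalM pevalXn YE peval_prod; congr (_ * _).
    by apply: eq_bigr => i _; rewrite pevalXn.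
  have yN0 : 0 <= y ^+ N by rewrite exprn_ge0.
  have yN1 : y ^+ N <= 1 by rewrite exprn_ile1.
  have yH0 : 0 <= y ^+ N * H by rewrite mulr_ge0.
  have yH1 : y ^+ N * H <= 1 by rewrite -[leRHS]mulr1 ler_pM.
  have sgE : sg = (y ^+ N * H) ^+ 2 by rewrite /sg ZE.
  have sg_le : sg <= y ^+ N * H by rewrite sgE expr2 ler_piMr.
  have Estau : s t * (2 * z t - s t * z t ^+ 2) = 1 - Z t ^+ 2 by rewrite EZ; ring.
  have sgtau : sg + sx * tau = 1.
    by rewrite /tau /sx -sq_distE -pevalM Estau pevalB peval1 pevalXn addrC subrK.
  apply: (@bump_estimate _ sx w W sg tau _ _ delta c (r ^+ 2)
    (Num.min (1 / 2) (delta / (4 * Q * Ck)) * Ck) Q) => //.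
  - exact: sqr_ge0.
  - exact: le_trans yH1.
  - move=> sx_eq0; rewrite /tau pevalB [peval (s t * _) x]pevalM sq_distE -/sx sx_eq0.
    rewrite mul0r subr0 pevalM mulr_ge0 ?z0//.
    by rewrite -(rmorph_nat (@mpolyC n R)) pevalC.
  - exact: f_ge.
  - move=> sxr; have Hc j : `|x 0 j - u t 0 j| <= r.
      rewrite -ler_sqr ?nnegrE ?(ltW r0)// real_normK ?num_real//.
      exact: le_trans (dist2_coord _ _ _) sxr.
    have Hsum : \sum_j `|x 0 j - u t 0 j| <= n%:R * r.
      apply: le_trans (_ : \sum_(j < n) r <= _); first exact: ler_sum.
      by rewrite sumr_const card_ord [leRHS]mulr_natl.
    have := HL t x (u t) (SK x Sx) (HKu t).
    have : L * \sum_j `|x 0 j - u t 0 j| <= c / 2.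
      apply: le_trans Lr; apply: le_trans (_ : `|L| * \sum_j `|x 0 j - u t 0 j| <= _).
        by rewrite ler_wpM2r ?ler_norm// sumr_ge0.
      by rewrite ler_wpM2l.
    by move=> H2; rewrite ler_norml => /andP[H3 _]; have := q_ge t; lra.
  - by apply: le_trans (HQ t x (SK x Sx)) _; rewrite (le_trans (ler_norm Q0))// lerDl.
  - move=> rs; have yr : y ^+ N <= Num.min (1 / 2) (delta / (4 * Q * Ck)).
      apply: le_trans HN; apply: lerXn2r; rewrite ?nnegrE//.
        by rewrite subr_ge0 ler_pdivrMr// mul1r (le_trans (ltW rs)).
      by rewrite lerB// ler_wpM2r ?invr_ge0 ?(ltW B0) ?(ltW rs).
    split.
      by apply: le_trans sg_le _; rewrite -[leRHS]mulrA; apply: ler_pM.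
    apply: le_trans sg_le _; apply: le_trans (_ : y ^+ N * 1 <= _); first by rewrite ler_wpM2l.
    by rewrite mulr1; apply: le_trans yr _; rewrite ge_min lexx.
  - apply: le_trans (_ : Q * (delta / (4 * Q * Ck) * Ck) <= _).
      by rewrite ler_wpM2l ?(ltW Qp)// ler_wpM2r ?(ltW Ck0)// ge_min lexx orbT.
    by rewrite le_eqVlt; apply/orP; left; apply/eqP; field; rewrite !gt_eqF.
- move=> i; exists (fun t => Y t ^+ N * (Y t ^+ k1) ^+ 2 * \prod_(j | j != i) h j t ^+ 2).
    have bY : bfamily Y by exact: unital_bfamily.
    apply: bfamilyM; first by apply: bfamilyM; apply: bfamilyX => //; exact: bfamilyX.
    rewrite (_ : (fun t => _) = (fun t => \prod_j (if j != i then h j t ^+ 2 else 1))).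
      apply: unital_bfamily; apply: unital_prod => j.
      by case: (j != i); [exact: unitalX | exact: unital1].
    by apply/funext => t; rewrite big_mkcond.
  by move=> t; rewrite /Z (bigD1 i)//= /h; ring.
Qed.

End Peel.

(** Each zero is divided out in turn, at the price of a smaller constant [delta]
    and of new families [q] at the other zeros; what remains in the end is
    bounded below by a positive constant on [S]. *)
Theorem nondegenerate_zeros_positivstellensatz k (U : nat -> T -> 'rV[R]_n)
    (f : T -> A) (delta rho : R) :
  bfamily f -> 0 < delta -> 0 < rho ->
  (forall i, (i < k)%N -> bounded_point (U i)) ->
  (forall i j, (i < j < k)%N -> forall t, rho <= dist2 (U i t) (U j t)) ->
  (forall t x, semialg g x -> delta * \prod_(i < k) dist2 x (U i t) <= peval (f t) x) ->
  (forall i, (i < k)%N -> nondegenerate_at (U i) f) -> btrunc f.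
Proof.
move=> + + rho0; elim: k f delta => [|k IH] f delta bf delta0 bU sepU f_ge fU.
  apply: (uniform_positivstellensatz g_arch bf delta0) => t x Sx.
  by have := f_ge t x Sx; rewrite big_ord0 mulr1.
have bUk := bU k (ltnSn k).
have bU' (i : 'I_k) : bounded_point (U i) by apply: bU; rewrite ltnS ltnW.
have sep' (i : 'I_k) t : rho <= dist2 (U i t) (U k t) by apply: sepU; rewrite ltn_ord /=.
have [q [c [bq c0 q_ge fq]]] := fU k (ltnSn k).
have f_ge' t x : semialg g x ->
    delta * (\prod_(i < k) dist2 x (U i t) * dist2 x (U k t)) <= peval (f t) x.
  by move=> Sx; have := f_ge t x Sx; rewrite big_ord_recr.
have [Z [z [b [bz EZ b0 b_ge HG]]]] :=
  peel_positive bUk bU' rho0 sep' bq delta0 c0 f_ge' q_ge.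
have bZ : bfamily Z.
  rewrite (_ : Z = fun t => 1 - sq_dist (U k) t * z t); last exact/funext.
  apply: bfamilyB; first exact: bfamily_cst.
  by apply: bfamilyM => //; exact: bfamily_sq_dist.
apply: (peel_reduction bUk fq bZ EZ); apply: (IH _ b) => //.
- have bs := bfamily_sq_dist bUk.
  apply: bfamilyD; apply: bfamilyM => //; first exact: bfamilyX.
  apply: bfamilyB; apply: bfamilyM => //; first exact: bfamily_cst.
  exact: bfamilyX.
- by move=> i ik; apply: bU; rewrite ltnS ltnW.
- by move=> i j /andP[ij jk]; apply: sepU; rewrite ij ltnS ltnW.
- move=> i ik; have [G bG EG] := HG (Ordinal ik).
  apply: (peel_nondegenerate bUk bU' rho0 sep' bf bq bz EZ bG EG).
  by apply: fU; rewrite ltnS ltnW.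
Qed.

End MovingZeros.

(** * Second order expansions and local concavity *)

Section Taylor.
Variables (R : realType) (n : nat).
Local Notation A := {mpoly R[n]}.
Local Notation V := 'rV[R]_n.

Definition continuous_coef : set (V -> R) := [set c | continuous c].

Definition cfamily := @family R n V continuous_coef.

Lemma continuous_coef_cst (c : R) : continuous_coef (fun=> c).
Proof. exact: cst_continuous. Qed.

Lemma continuous_coefM c d :
  continuous_coef c -> continuous_coef d -> continuous_coef (fun t => c t * d t).
Proof.
by move=> cc cd x; apply: continuousM; [exact: (cc x) | exact: (cd x)].
Qed.

Lemma continuous_peval (p : A) : continuous (peval p).
Proof.
elim/mpoly_algebra_ind: p => [c|i|p q cp cq|p q cp cq].
- by rewrite (_ : peval _ = fun=> c); [exact: cst_continuous|apply/funext => x; rewrite pevalC].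
- rewrite (_ : peval _ = fun x => x 0 i); first exact: coord_continuous.
  by apply/funext => x; rewrite pevalX.
- rewrite (_ : peval _ = fun x => peval p x + peval q x).
    by move=> x; apply: continuousD; [exact: cp | exact: cq].
  by apply/funext => x; rewrite pevalD.
- rewrite (_ : peval _ = fun x => peval p x * peval q x).
    by move=> x; apply: continuousM; [exact: cp | exact: cq].
  by apply/funext => x; rewrite pevalM.
Qed.

Lemma cfamily_coef c : continuous_coef c -> cfamily (fun t => (c t)%:MP).
Proof. exact: family_coef. Qed.
Lemma cfamily_cst P : cfamily (fun=> P).
Proof. exact: (family_cst continuous_coef_cst). Qed.
Lemma cfamilyD p q : cfamily p -> cfamily q -> cfamily (fun t => p t + q t).
Proof. exact: familyD. Qed.
Lemma cfamilyM p q : cfamily p -> cfamily q -> cfamily (fun t => p t * q t).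
Proof. exact: (familyM continuous_coefM). Qed.
Lemma cfamilyN p : cfamily p -> cfamily (fun t => - p t).
Proof. exact: (familyN continuous_coef_cst continuous_coefM). Qed.
Lemma cfamilyB p q : cfamily p -> cfamily q -> cfamily (fun t => p t - q t).
Proof. exact: (familyB continuous_coef_cst continuous_coefM). Qed.
Lemma cfamilyX p k : cfamily p -> cfamily (fun t => p t ^+ k).
Proof. exact: (familyX continuous_coef_cst continuous_coefM). Qed.
Lemma cfamily_sum I (r : seq I) (F : I -> V -> A) :
  (forall i, cfamily (F i)) -> cfamily (fun t => \sum_(i <- r) F i t).
Proof. exact: family_sum. Qed.

Lemma cfamily_joint_continuous (p : V -> A) : cfamily p ->
  continuous (fun z : V * V => peval (p z.1) z.2).
Proof.
elim=> [|c P {}p cc _ IH].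
  rewrite (_ : (fun z => _) = fun=> 0); first exact: cst_continuous.
  by apply/funext => z; rewrite peval0.
rewrite (_ : (fun z => _) = fun z => c z.1 * peval P z.2 + peval (p z.1) z.2); last first.
  by apply/funext => z; rewrite pevalD pevalM pevalC.
have cc1 : continuous (fun z : V * V => c z.1).
  by move=> z; apply: (@continuous_comp _ _ _ fst c z); [exact: cvg_fst | exact: (cc z.1)].
have cP : continuous (fun z : V * V => peval P z.2).
  by move=> z; apply: (@continuous_comp _ _ _ snd (peval P) z);
    [exact: cvg_snd | exact: continuous_peval].
by move=> z; exact: (continuousD (continuousM (cc1 z) (cP z)) (IH z)).
Qed.

Local Notation y u j := (shift_var (fun t : V => t) j u).

Lemma cfamily_shift_var j : cfamily (fun u => y u j).
Proof.
apply: cfamilyB; first exact: cfamily_cst.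
apply: cfamily_coef; exact: coord_continuous.
Qed.

Lemma mderiv_var i j : ('X_i : A)^`M(j) = (i == j)%:R%:MP.
Proof.
rewrite mderivX mnm1E; case: eqP => [->|_]; last by rewrite scale0r mpolyC0.
by rewrite scale1r -{1}[U_(j)%MM]add0m addmK mpolyX0 mpolyC1.
Qed.

(** The expansion [p = p(u) + p'(u)(X - u) + (remainder)] as an identity of
    polynomials in [X], with remainder coefficients depending continuously on
    [u], whose symmetric part at [X = u] is half the Hessian. *)
Lemma taylor_expansion (p : A) : exists t : 'I_n -> 'I_n -> V -> A,
  [/\ forall j k, cfamily (t j k),
      forall u, p = (peval p u)%:MP + \sum_j (peval p^`M(j) u)%:MP * y u j
                + \sum_j \sum_k y u j * y u k * t j k u &
      forall u j k, peval (t j k u) u + peval (t k j u) u = peval p^`M(j)^`M(k) u].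
Proof.
elim/mpoly_algebra_ind: p => [c|i|p q [tp [ctp Ep Hp]] [tq [ctq Eq Hq]]|
    p q [tp [ctp Ep Hp]] [tq [ctq Eq Hq]]].
- exists (fun _ _ _ => 0); split => [j k|u|u j k].
  + exact: family0.
  + rewrite pevalC !big1 ?addr0// => j _; first by rewrite big1// => k _; rewrite mulr0.
    by rewrite mderivC peval0 mpolyC0 mul0r.
  + by rewrite !(mderivC, mderiv0) !peval0 addr0.
- exists (fun _ _ _ => 0); split => [j k|u|u j k].
  + exact: family0.
  + rewrite pevalX [X in _ + X]big1 ?addr0; last by move=> j _; rewrite big1// => k _; rewrite mulr0.
    rewrite (bigD1 i)//= big1 => [|j /negPf ji]; last first.
      by rewrite mderiv_var pevalC eq_sym ji mpolyC0 mul0r.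
    by rewrite mderiv_var pevalC eqxx mpolyC1 mul1r addr0 /shift_var addrC subrK.
  + by rewrite mderiv_var mderivC !peval0 addr0.
- exists (fun j k u => tp j k u + tq j k u); split => [j k|u|u j k].
  + exact: cfamilyD.
  + rewrite {1}(Ep u) {1}(Eq u) pevalD rmorphD /=.
    have -> : \sum_j (peval (p + q)^`M(j) u)%:MP * y u j =
      \sum_j (peval p^`M(j) u)%:MP * y u j + \sum_j (peval q^`M(j) u)%:MP * y u j.
      by rewrite -big_split; apply: eq_bigr => j _; rewrite mderivD pevalD rmorphD mulrDl.
    have -> : \sum_j \sum_k y u j * y u k * (tp j k u + tq j k u) =
      \sum_j \sum_k y u j * y u k * tp j k u + \sum_j \sum_k y u j * y u k * tq j k u.
      rewrite -big_split; apply: eq_bigr => j _; rewrite -big_split; apply: eq_bigr => k _.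
      exact: mulrDr.
    by rewrite addrACA; congr (_ + _); rewrite addrACA.
  + by rewrite !mderivD !pevalD -Hp -Hq addrACA.
- pose p1 u := \sum_j (peval p^`M(j) u)%:MP * y u j.
  pose q1 u := \sum_j (peval q^`M(j) u)%:MP * y u j.
  pose p2 u := \sum_j \sum_k y u j * y u k * tp j k u.
  pose q2 u := \sum_j \sum_k y u j * y u k * tq j k u.
  exists (fun j k u => (peval p u)%:MP * tq j k u + tp j k u * q
    + (peval p^`M(j) u)%:MP * (peval q^`M(k) u)%:MP + tq j k u * p1 u).
  split => [j k|u|u j k].
  + have c_ (a : A) : cfamily (fun u => (peval a u)%:MP).
      by apply: cfamily_coef; exact: continuous_peval.
    apply: cfamilyD; last first.
      apply: cfamilyM => //; apply: cfamily_sum => l; apply: cfamilyM; first exact: c_.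
      exact: cfamily_shift_var.
    apply: cfamilyD; last by apply: cfamilyM; exact: c_.
    apply: cfamilyD; first by apply: cfamilyM => //; exact: c_.
    by apply: cfamilyM => //; exact: cfamily_cst.
  + have EP : p = (peval p u)%:MP + p1 u + p2 u by exact: Ep.
    have EQ : q = (peval q u)%:MP + q1 u + q2 u by exact: Eq.
    have -> : \sum_j (peval (p * q)^`M(j) u)%:MP * y u j =
      (peval p u)%:MP * q1 u + p1 u * (peval q u)%:MP.
      rewrite mulr_sumr mulr_suml -big_split; apply: eq_bigr => j _.
      by rewrite mderivM pevalD !pevalM rmorphD !rmorphM /=; ring.
    have rem r : \sum_j \sum_k y u j * y u k * ((peval p u)%:MP * tq j k u + tp j k u * q
      + (peval p^`M(j) u)%:MP * (peval q^`M(k) u)%:MP + tq j k u * r) =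
      (peval p u)%:MP * q2 u + p2 u * q + p1 u * q1 u + q2 u * r.
      have -> : p1 u * q1 u = \sum_j \sum_k
          (peval p^`M(j) u)%:MP * y u j * ((peval q^`M(k) u)%:MP * y u k).
        by rewrite /p1 /q1 big_distrlr.
      rewrite /p2 /q2 !mulr_sumr !mulr_suml -!big_split /=; apply: eq_bigr => j _.
      rewrite !mulr_sumr !mulr_suml -!big_split /=; apply: eq_bigr => k _.
      by ring.
    rewrite rem.
    by rewrite pevalM rmorphM /= {1}EP {1 4}EQ; ring.
  + have p10 : peval (p1 u) u = 0.
      by rewrite peval_sum big1// => l _; rewrite pevalM shift_varE subrr mulr0.
    rewrite !mderivM !mderivD !mderivM !pevalD !pevalM !pevalC p10 -Hp -Hq.
    by ring.
Qed.

End Taylor.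

Lemma mx_quadE (R : comPzRingType) n (M : 'M[R]_n) (v : 'rV[R]_n) :
  (v *m M *m v^T) 0 0 = \sum_i \sum_j v 0 i * v 0 j * M i j.
Proof.
rewrite mxE exchange_big; apply: eq_bigr => j _; rewrite !mxE mulr_suml.
by apply: eq_bigr => i _; rewrite mulrAC.
Qed.

(** A positive definite quadratic form is a sum of squares of linear forms: the
    Cholesky decomposition, by completing the square in the first variable. *)
Lemma cholesky (R : rcfType) n (B : 'M[R]_n) : B^T = B ->
  (forall v : 'rV_n, v != 0 -> 0 < (v *m B *m v^T) 0 0) ->
  exists W : 'M[R]_n, B = W^T *m W.
Proof.
elim: n B => [|n IH] B symB posB; first by exists 0; apply/matrixP => -[].
move: B symB posB; rewrite -[n.+1]/(1 + n)%N => B symB posB.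
pose a := B 0 0; pose b : 'rV_n := ursubmx B; pose C : 'M_n := drsubmx B.
have EB : B = block_mx a%:M b b^T C.
  rewrite -[LHS]submxK; congr block_mx.
  - by rewrite [ulsubmx B]mx11_scalar; congr (_%:M); rewrite !mxE; congr (B _ _); apply: val_inj.
  - by rewrite /b trmx_ursub symB.
have quad (x : 'M_1) (v : 'rV_n) : row_mx x v *m B *m (row_mx x v)^T =
    a *: (x *m x^T) + v *m b^T *m x^T + x *m b *m v^T + v *m C *m v^T.
  rewrite EB mul_row_block tr_row_mx mul_row_col !mulmxDl mul_mx_scalar -scalemxAl.
  by rewrite -!addrA; congr (_ + _); rewrite addrA.
have a0 : 0 < a.
  have := posB (row_mx 1%:M 0); rewrite quad !mul0mx !trmx1 !mulmx1 mul1mx !trmx0 !mulmx0 !addr0.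
  rewrite !mxE mulr1; apply; apply/eqP => /(congr1 lsubmx); rewrite row_mxKl lsubmx_const.
  by move/matrixP/(_ 0 0)/eqP; rewrite !mxE oner_eq0.
have sa0 : Num.sqrt a != 0 by rewrite gt_eqF// sqrtr_gt0.
have saa : Num.sqrt a * Num.sqrt a = a by rewrite -expr2 sqr_sqrtr// ltW.
pose D := C - a^-1 *: (b^T *m b).
have [|v v0|W HW] := IH D.
- rewrite /D linearB /= linearZ /= trmx_mul trmxK; congr (_ - _).
  by rewrite /C trmx_drsub symB.
- have := posB (row_mx (- a^-1 *: (v *m b^T)) v); rewrite quad.
  have E : (v *m b^T) = (v *m b^T)^T by apply/matrixP => i j; rewrite !ord1 [in RHS]mxE.
  have Evb : b *m v^T = v *m b^T by rewrite [RHS]E trmx_mul trmxK.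
  have -> : a *: (- a^-1 *: (v *m b^T) *m (- a^-1 *: (v *m b^T))^T) +
     v *m b^T *m (- a^-1 *: (v *m b^T))^T + - a^-1 *: (v *m b^T) *m b *m v^T +
     v *m C *m v^T = v *m D *m v^T.
    rewrite !linearZ /= -E -!scalemxAl.
    rewrite /D mulmxBr mulmxBl -scalemxAr -scalemxAl (mulmxA v b^T b).
    set z := v *m b^T *m (v *m b^T).
    have -> : v *m b^T *m b *m v^T = z by rewrite -mulmxA Evb.
    rewrite !scalerA.
    have -> : - a^-1 * a * - a^-1 = a^-1 by field; rewrite gt_eqF.
    by rewrite scaleNr subrr add0r addrC.
  apply; apply: contra v0 => /eqP/(congr1 rsubmx).
  by rewrite row_mxKr => ->; apply/eqP/matrixP => i j; rewrite !mxE.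
exists (block_mx (Num.sqrt a)%:M ((Num.sqrt a)^-1 *: b) 0 W).
rewrite EB tr_block_mx mulmx_block !trmx0 !mul0mx !mulmx0 !addr0 tr_scalar_mx.
rewrite !mul_scalar_mx scalerA mulfV// scale1r mul_mx_scalar linearZ /= scalerA mulfV// scale1r.
rewrite -scalemxAl -scalemxAr scalerA -invfM saa scale_scalar_mx saa.
congr block_mx; rewrite ?addr0 //.
by rewrite -HW /D addrC subrK.
Qed.

(** Pointwise, either [pen] vanishes and [F] is positive, or a large multiple of
    [pen] dominates; both persist nearby, so compactness gives one multiple. *)
Lemma penalty_eventually_positive (R : realType) (X : topologicalType) (K : set X)
    (F pen : X -> R) : compact K -> continuous F -> continuous pen ->
  (forall x, 0 <= pen x) -> (forall x, K x -> pen x = 0 -> 0 < F x) ->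
  exists N : nat, forall x, K x -> N.+1%:R^-1 < F x + N%:R * pen x.
Proof.
move=> cK cF cpen pen0 KF.
pose P (N : nat) x := N.+1%:R^-1 < F x + N%:R * pen x.
suff [N _ /(_ N (leqnn N)) HN] : \forall N \near \oo, K `<=` P N by exists N.
apply: (proj1 (compact_near_coveringP _) cK nat \oo P) => x Kx.
have [px|px] := eqVneq (pen x) 0.
  have Fx := KF x Kx px; have e0 : 0 < F x / 2 by rewrite divr_gt0.
  exists ([set w | F x / 2 < F w], [set N | N.+1%:R^-1 < F x / 2]).
    split => /=; last exact: (near_infty_natSinv_lt (PosNum e0)).
    by have := @cF x => /cvgr_gt; apply; lra.
  move=> [w N] /= [/= Fw HN]; apply: lt_le_trans (_ : F w <= _).
    exact: lt_trans HN Fw.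
  by rewrite lerDl mulr_ge0.
have px0 : 0 < pen x by rewrite lt_def px pen0.
exists ([set w | F x - 1 < F w] `&` [set w | pen x / 2 < pen w],
  [set N | (3 - F x) / (pen x / 2) <= N%:R]).
  split => /=; last exact: nbhs_infty_ger.
  apply: filterI.
    by have := @cF x => /cvgr_gt; apply; lra.
  by have := @cpen x => /cvgr_gt; apply; lra.
move=> [w N] /= [/= [Fw pw] /=]; rewrite ler_pdivrMr ?divr_gt0// => HN.
have N1 : N.+1%:R^-1 <= 1 :> R by rewrite invf_le1// ler1n.
have : N%:R * (pen x / 2) <= N%:R * pen w by rewrite ler_wpM2l// ltW.
rewrite /P; move: (N.+1%:R^-1) N1 (N%:R * pen w) HN => c c1 d.
by lra.
Qed.

Section EuclideanTopology.
Variables (R : realType) (n : nat).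
Local Notation V := 'rV[R]_n.
Implicit Types (x u v : V).

Lemma continuous_dist2 u : continuous (fun x => dist2 x u).
Proof.
rewrite (_ : (fun x => _) = peval (sq_dist (fun=> u) tt)); first exact: continuous_peval.
by apply/funext => x; rewrite sq_distE.
Qed.

Lemma closed_box_compact (F : set V) (K : R) : closed F -> F `<=` in_box K -> compact F.
Proof.
move=> cF FK.
have cB : compact [set v : V | forall i, v ord0 i \in `[(- K), K]].
  by apply: (@rV_compact _ _ (fun=> `[(- K), K]%classic)) => _; exact: segment_compact.
apply: (subclosed_compact cF cB) => x /FK xK i.
by rewrite in_itv /= -ler_norml; exact: xK.
Qed.

Lemma closed_preimage_le (f : V -> R) (c : R) : continuous f -> closed [set x | f x <= c].
Proof.
move=> cf; have := proj1 (continuous_closedP f) cf [set y | y <= c].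
by apply; exact: closed_le.
Qed.

Lemma closed_preimage_ge (f : V -> R) (c : R) : continuous f -> closed [set x | c <= f x].
Proof.
move=> cf; have := proj1 (continuous_closedP f) cf [set y | c <= y].
by apply; exact: closed_ge.
Qed.

Lemma near_dist2 u (e : R) : 0 < e -> \forall x \near u, dist2 x u < e.
Proof.
move=> e0; have := @continuous_dist2 u u => /cvgr_lt; apply.
by rewrite /dist2 big1// => i _; rewrite subrr expr0n.
Qed.

Lemma nbhs_dist2 u (P : set V) : nbhs u P ->
  exists2 e : R, 0 < e & forall x, dist2 x u <= e -> P x.
Proof.
move=> /nbhs_ballP[e /= e0 eP]; exists ((e / 2) ^+ 2) => [|x xe].
  by rewrite exprn_gt0// divr_gt0.
apply: eP; split => // i j; rewrite ord1 /ball /= distrC.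
apply: le_lt_trans (_ : e / 2 < _); last by rewrite ltr_pdivrMr// ltr_pMr// ltr1n.
rewrite -ler_sqr ?nnegrE ?divr_ge0 ?(ltW e0)// real_normK ?num_real//.
exact: le_trans (dist2_coord x u j) xe.
Qed.

Lemma nbhs_dist2_prod u (P : set (V * V)) : nbhs (u, u) P ->
  exists2 e : R, 0 < e & forall x y, dist2 x u <= e -> dist2 y u <= e -> P (x, y).
Proof.
move=> [[/= U W] [/nbhs_dist2[e e0 eU] /nbhs_dist2[d d0 dW]] UW].
exists (Num.min e d) => [|x y]; first by rewrite lt_min e0.
by rewrite !le_min => /andP[xe _] /andP[_ yd]; apply: UW; split; [exact: eU | exact: dW].
Qed.

Lemma dist2_coord_le x u (r : R) i : 0 <= r -> dist2 x u <= r ^+ 2 -> `|x 0 i - u 0 i| <= r.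
Proof.
move=> r0 xr; rewrite -ler_sqr ?nnegrE// real_normK ?num_real//.
exact: le_trans (dist2_coord x u i) xr.
Qed.

Lemma dist2_0 v : dist2 v 0 = \sum_i v 0 i ^+ 2.
Proof. by apply: eq_bigr => i _; rewrite mxE subr0. Qed.

Lemma dist2_eq0 x u : dist2 x u = 0 -> x = u.
Proof.
move=> /eqP; rewrite psumr_eq0 => [/allP H|i _]; last exact: sqr_ge0.
apply/rowP => i; apply/eqP; rewrite -subr_eq0 -sqrf_eq0.
by have := H i (mem_index_enum i).
Qed.

Lemma dist2_gt0 x u : x != u -> 0 < dist2 x u.
Proof.
move=> xu; rewrite lt_def dist2_ge0 andbT; apply: contra_neq xu; exact: dist2_eq0.
Qed.

Lemma dist2xx x : dist2 x x = 0.
Proof. by rewrite /dist2 big1// => i _; rewrite subrr expr0n. Qed.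

Lemma dist2_ball_box u (r : R) :
  exists K : R, 0 < K /\ forall x, dist2 x u <= r -> in_box K x.
Proof.
exists (Num.sqrt r + \sum_i `|u 0 i| + 1); split.
  by rewrite ltr_wpDl// addr_ge0 ?sqrtr_ge0// sumr_ge0.
move=> x xr i; have r0 : 0 <= r := le_trans (dist2_ge0 _ _) xr.
rewrite -[x 0 i](subrK (u 0 i)); apply: le_trans (ler_normD _ _) _.
rewrite -addrA; apply: lerD; first by apply: dist2_coord_le; rewrite ?sqrtr_ge0// sqr_sqrtr.
by rewrite (bigD1 i)//= -addrA lerDl addr_ge0// sumr_ge0.
Qed.

Lemma dist2_ball_compact u (r : R) : compact [set x | dist2 x u <= r].
Proof.
have [K [_ HK]] := dist2_ball_box u r.
by apply: (closed_box_compact _ HK); apply: closed_preimage_le; exact: continuous_dist2.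
Qed.

Lemma sphere_compact : compact [set v : V | dist2 v 0 = 1].
Proof.
apply: (@closed_box_compact _ 1).
  rewrite (_ : [set v | _] = [set v | dist2 v 0 <= 1] `&` [set v | 1 <= dist2 v 0]).
    apply: closedI; [apply: closed_preimage_le|apply: closed_preimage_ge]; exact: continuous_dist2.
  apply/seteqP; split => v /=; first by move=> ->; rewrite lexx.
  by move=> [a b]; apply/eqP; rewrite eq_le a b.
move=> v /= v1 i; have := @dist2_coord_le v 0 1 i ler01.
by rewrite v1 expr1n lexx mxE subr0; apply.
Qed.

(** Finsler's lemma: negativity on the hyperplane [l v = 0] propagates to the
    whole space after subtracting a large multiple of [(l v) ^+ 2]. *)
Lemma finsler (H : 'M[R]_n) (l : V) :
  (forall v : V, v != 0 -> (l *m v^T) 0 0 = 0 -> (v *m H *m v^T) 0 0 < 0) ->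
  exists N mu : R, [/\ 0 <= N, 0 < mu & forall v : V,
    (v *m H *m v^T) 0 0 - N * (l *m v^T) 0 0 ^+ 2 <= - (mu * dist2 v 0)].
Proof.
move=> negH.
pose Q (v : V) := (v *m H *m v^T) 0 0; pose L (v : V) := (l *m v^T) 0 0.
have QE v : Q v = \sum_i \sum_j v 0 j * H j i * v 0 i.
  by rewrite /Q mxE; apply: eq_bigr => i _; rewrite !mxE mulr_suml.
have LE v : L v = \sum_i l 0 i * v 0 i.
  by rewrite /L mxE; apply: eq_bigr => i _; rewrite mxE.
have cQ : continuous Q.
  rewrite (_ : Q = peval (\sum_i \sum_j 'X_j * (H j i)%:MP * 'X_i)); first exact: continuous_peval.
  apply/funext => v; rewrite QE peval_sum; apply: eq_bigr => i _.
  by rewrite peval_sum; apply: eq_bigr => j _; rewrite !pevalM !pevalX pevalC.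
have cL : continuous L.
  rewrite (_ : L = peval (\sum_i (l 0 i)%:MP * 'X_i)); first exact: continuous_peval.
  apply/funext => v; rewrite LE peval_sum; apply: eq_bigr => i _.
  by rewrite pevalM pevalX pevalC.
have [|||v v1 Lv|N HN] := @penalty_eventually_positive R V _
    (fun v => - Q v) (fun v => L v * L v) sphere_compact.
- by move=> v; apply: continuousN; exact: cQ.
- by move=> v; apply: continuousM; exact: cL.
- by move=> v; rewrite -expr2 sqr_ge0.
- rewrite oppr_gt0; apply: negH; last by move/eqP: Lv; rewrite mulf_eq0 orbb => /eqP.
  by apply/eqP => v0; move/eqP: v1; rewrite v0 dist2xx eq_sym oner_eq0.
exists N%:R, N.+1%:R^-1; split => // v.
  have {}HN w : dist2 w 0 = 1 -> Q w - N%:R * (L w * L w) < - N.+1%:R^-1.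
    by move=> /HN; rewrite ltrNr opprB addrC.
  have [->|v0] := eqVneq v 0.
    by rewrite dist2xx mul0mx trmx0 !mulmx0 !mxE expr0n /= !mulr0 subr0 oppr0.
  pose c := Num.sqrt (dist2 v 0).
  have c0 : 0 < c by rewrite sqrtr_gt0 dist2_gt0.
  have c2 : c ^+ 2 = dist2 v 0 by rewrite sqr_sqrtr// dist2_ge0.
  have [w vE w1] : exists2 w, v = c *: w & dist2 w 0 = 1.
    have vE : v = c *: (c^-1 *: v) by rewrite scalerA mulfV ?scale1r// gt_eqF.
    exists (c^-1 *: v) => //; move: vE; move: (c^-1 *: v) => w vE.
    apply: (mulfI (negbT (gt_eqF (exprn_gt0 2 c0)))); rewrite mulr1 [RHS]c2 [in RHS]vE.
    by rewrite !dist2_0 mulr_sumr; apply: eq_bigr => i _; rewrite [in RHS]mxE exprMn.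
  have trZ : (c *: w)^T = c *: w^T by rewrite linearZ.
  have := HN w w1; rewrite -/(Q v) -/(L v) -c2.
  have -> : Q v = c ^+ 2 * Q w.
    rewrite /Q {1 2}vE trZ -!scalemxAl -scalemxAr scalerA -expr2.
    by rewrite [LHS]mxE.
  have -> : L v = c * L w by rewrite /L {1}vE trZ -scalemxAr [LHS]mxE.
  move=> /ltW H1; have := ler_wpM2l (sqr_ge0 c) H1.
  have -> : c ^+ 2 * Q w - N%:R * (c * L w) ^+ 2 = c ^+ 2 * (Q w - N%:R * (L w * L w)).
    by ring.
  by rewrite mulrN [N.+1%:R^-1 * _]mulrC.
Qed.

End EuclideanTopology.

Section LocalConcavity.
Variables (R : realType) (n : nat).
Local Notation A := {mpoly R[n]}.
Local Notation V := 'rV[R]_n.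
Local Notation y u j := (shift_var (fun t : V => t) j u).
Local Notation s u := (sq_dist (fun t : V => t) u).

(** Sums of squares are the quadratic module of the empty family; unlike general
    certificates they are nonnegative everywhere, also at infeasible points. *)
Definition sos_trunc (d : nat) (f : A) := trunc_qmodule ([tuple] : 0.-tuple A) d f.

Lemma sos_trunc_ge0 d f x : sos_trunc d f -> 0 <= peval f x.
Proof. by move=> /trunc_ge0; apply => -[]. Qed.

Lemma sos_trunc_qmodule m (g : m.-tuple A) d f : sos_trunc d f -> trunc_qmodule g d f.
Proof.
move=> [p Hp ->]; exists (fun i => if i == ord0 then p ord0 else [::]) => [i q|].
  case: eqP => // -> qp; have := Hp ord0 q qp; by rewrite !tnth0.
rewrite big_ord1 [RHS]big_ord_recl eqxx !tnth0 [X in _ = _ + X]big1 ?addr0// => i _.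
exact: big_nil.
Qed.

Local Notation bsos := (@btrunc R n 0 ([tuple] : 0.-tuple A) V).

(** The constant part of the form, taken at [u0], is positive definite and is a
    sum of squares by Cholesky. The deviations [e j k] are handled by completing
    squares: [y_j y_k e + s (h / 2 + e ^+ 2 / (2 h))] is a sum of squares, because
    [s - y_j ^+ 2] is one. What is left of the positive definiteness, after paying
    for all pairs, is the factor [q]. *)
Lemma quadratic_certificate (t : 'I_n -> 'I_n -> V -> A) (mu : R) (u0 : V) :
  0 < mu -> (forall j k, cfamily (t j k)) ->
  (forall v : V, mu * dist2 v 0 <= \sum_j \sum_k v 0 j * v 0 k * peval (t j k u0) u0) ->
  exists q, [/\ cfamily q, 0 < peval (q u0) u0 &
    bsos (fun u => \sum_j \sum_k y u j * y u k * t j k u - s u * q u)].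
Proof.
move=> mu0 ct t_ge.
pose a j k := peval (t j k u0) u0.
pose B : 'M[R]_n := \matrix_(j, k) ((a j k + a k j) / 2 - mu / 2 * (j == k)%:R).
have quadB (K : comPzRingType) (f : {rmorphism R -> K}) (z : 'I_n -> K) :
   \sum_j \sum_k z j * z k * f (B j k) =
   \sum_j \sum_k z j * z k * f (a j k) - f (mu / 2) * \sum_j z j ^+ 2.
  have half : f 2^-1 + f 2^-1 = 1.
    by rewrite -rmorphD -[RHS](rmorph1 f); congr (f _); field.
  transitivity (\sum_j \sum_k z j * z k * f (a j k) * f 2^-1 +
     \sum_j \sum_k z j * z k * f (a k j) * f 2^-1 -
     \sum_j \sum_k z j * z k * f (mu / 2 * (j == k)%:R)).
    rewrite -big_split -sumrB /=; apply: eq_bigr => j _.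
    rewrite -big_split -sumrB /=; apply: eq_bigr => k _.
    by rewrite mxE rmorphB (rmorphM f (a j k + a k j)) (rmorphD f (a j k)); ring.
  congr (_ - _).
    rewrite [X in _ + X]exchange_big -big_split /=; apply: eq_bigr => j _.
    rewrite -big_split /=; apply: eq_bigr => k _.
    by rewrite [z k * z j]mulrC -mulrDr half mulr1.
  rewrite mulr_sumr; apply: eq_bigr => j _; rewrite (bigD1 j)//= big1 => [|k /negPf kj].
    by rewrite eqxx mulr1 addr0 mulrC expr2.
  by rewrite eq_sym kj mulr0 rmorph0 mulr0.
have [|v v0|W EW] := @cholesky _ n B.
- apply/matrixP => j k; rewrite !mxE eq_sym; congr (_ / _ - _); exact: addrC.
- rewrite mx_quadE (quadB _ idfun) /= -dist2_0; have := t_ge v.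
  rewrite -/(a _ _); have := dist2_gt0 v0 => d0.
  have : mu / 2 * dist2 v 0 < mu * dist2 v 0 by rewrite ltr_pM2r//; lra.
  by rewrite /a; lra.
pose e j k u := t j k u - (a j k)%:MP.
have ce j k : cfamily (e j k) by apply: cfamilyB => //; exact: cfamily_cst.
pose h := mu / (2 * ((n * n)%:R + 1)).
have nn0 : 0 < (n * n)%:R + 1 :> R by rewrite ltr_wpDl.
have h0 : 0 < h by rewrite divr_gt0// mulr_gt0.
pose w j k u : A := (h / 2)%:MP + (2 * h)^-1%:MP * e j k u ^+ 2.
have cw j k : cfamily (w j k).
  by apply: cfamilyD; [|apply: cfamilyM; last exact: cfamilyX]; exact: cfamily_cst.
exists (fun u => (mu / 2)%:MP - \sum_j \sum_k w j k u); split.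
- apply: cfamilyB; first exact: cfamily_cst.
  by apply: cfamily_sum => j; apply: cfamily_sum.
- rewrite pevalB pevalC peval_sum.
  have -> : \sum_j peval (\sum_k w j k u0) u0 = (n * n)%:R * (h / 2).
    transitivity (\sum_(j < n) \sum_(k < n) (h / 2)).
      apply: eq_bigr => j _; rewrite peval_sum; apply: eq_bigr => k _.
      rewrite /w /e pevalD pevalM !pevalC pevalXn pevalB pevalC -/(a j k) subrr.
      by rewrite expr0n mulr0 addr0.
    by rewrite !sumr_const card_ord -mulrnA mulr_natl.
  rewrite subr_gt0.
  have hE : h * ((n * n)%:R + 1) = mu / 2 by rewrite /h; field; rewrite gt_eqF.
  have Nh : 0 <= (n * n)%:R * h by rewrite mulr_ge0// ltW.
  rewrite -hE mulrA [h * _]mulrC mulrDl mul1r.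
  by move: ((n * n)%:R * h) Nh => z; lra.
have EWy u : \sum_j \sum_k y u j * y u k * (B j k)%:MP =
    \sum_l (\sum_j (W l j)%:MP * y u j) ^+ 2.
  transitivity (\sum_l \sum_j \sum_k (W l j)%:MP * y u j * ((W l k)%:MP * y u k)).
    rewrite [RHS]exchange_big; apply: eq_bigr => j _; rewrite [RHS]exchange_big; apply: eq_bigr => k _.
    rewrite EW mxE rmorph_sum mulr_sumr; apply: eq_bigr => l _.
    by rewrite mxE rmorphM /=; ring.
  by apply: eq_bigr => l _; rewrite expr2 big_distrlr.
rewrite (_ : (fun u => _) = fun u => \sum_l (\sum_j (W l j)%:MP * y u j) ^+ 2 +
   \sum_j \sum_k ((2 * h)^-1%:MP * (h%:MP * y u j + e j k u * y u k) ^+ 2 +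
    ((h / 2)%:MP * \sum_(l | l != j) y u l ^+ 2 +
     (2 * h)^-1%:MP * (e j k u ^+ 2 * \sum_(l | l != k) y u l ^+ 2)))).
  have sq_ne j : bsos (fun u => \sum_(l | l != j) y u l ^+ 2).
    rewrite (_ : (fun u => _) = (fun u => \sum_l (if l != j then y u l else 0) ^+ 2)).
      apply: btrunc_sum => l; apply: (@btrunc_sqr _ _ _ _ _ (@continuous_coef R n)).
      by case: (l != j); [exact: cfamily_shift_var | exact: family0].
    apply/funext => u; rewrite big_mkcond; apply: eq_bigr => l _.
    by case: (l != j); rewrite // expr0n.
  have hh : 0 <= (2 * h)^-1 by rewrite invr_ge0 mulr_ge0// ltW.
  apply: btruncD.
    apply: btrunc_sum => l; apply: (@btrunc_sqr _ _ _ _ _ (@continuous_coef R n)).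
    apply: cfamily_sum => j; apply: cfamilyM; first exact: cfamily_cst.
    exact: cfamily_shift_var.
  apply: btrunc_sum => j; apply: btrunc_sum => k; apply: btruncD.
    apply: (@btrunc_scale _ _ _ _ _ (fun=> _)) => //.
    apply: (@btrunc_sqr _ _ _ _ _ (@continuous_coef R n)).
    by apply: cfamilyD; apply: cfamilyM; (exact: cfamily_cst || exact: cfamily_shift_var || exact: ce).
  apply: btruncD; apply: (@btrunc_scale _ _ _ _ _ (fun=> _)) => //.
    by move=> _; rewrite divr_ge0// ltW.
  by apply: (btrunc_sqrM (ce j k)).
apply/funext => u; rewrite -EWy (quadB _ (@mpolyC n R)) -/(s u).
have sE j : \sum_(l | l != j) y u l ^+ 2 = s u - y u j ^+ 2.
  by rewrite /sq_dist [in RHS](bigD1 j)//= addrAC subrr add0r.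
have E2 : (2 * h)^-1%:MP * h%:MP = (2^-1)%:MP :> A.
  by rewrite -rmorphM; congr (_%:MP); field; rewrite gt_eqF.
have E3 : (h / 2)%:MP = (2 * h)^-1%:MP * h%:MP * h%:MP :> A.
  by rewrite -!rmorphM; congr (_%:MP); field; rewrite gt_eqF.
have E4 : 2 * ((2 * h)^-1%:MP * h%:MP) = 1 :> A.
  have -> : 2 = (2 : R)%:MP :> A by rewrite rmorph_nat.
  by rewrite -!rmorphM -[RHS]mpolyC1; congr (_%:MP); field; rewrite gt_eqF.
rewrite mulrBr mulr_sumr.
have -> : \sum_j s u * (\sum_k w j k u) = \sum_j \sum_k s u * w j k u.
  by apply: eq_bigr => j _; rewrite mulr_sumr.
have -> : \sum_j \sum_k y u j * y u k * t j k u =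
   \sum_j \sum_k y u j * y u k * (a j k)%:MP + \sum_j \sum_k y u j * y u k * e j k u.
  rewrite -big_split; apply: eq_bigr => j _; rewrite -big_split; apply: eq_bigr => k _ /=.
  by rewrite /e; ring.
have -> : \sum_j \sum_k ((2 * h)^-1%:MP * (h%:MP * y u j + e j k u * y u k) ^+ 2 +
    ((h / 2)%:MP * \sum_(l | l != j) y u l ^+ 2 +
     (2 * h)^-1%:MP * (e j k u ^+ 2 * \sum_(l | l != k) y u l ^+ 2))) =
  \sum_j \sum_k y u j * y u k * e j k u + \sum_j \sum_k s u * w j k u.
  rewrite -big_split; apply: eq_bigr => j _; rewrite -big_split; apply: eq_bigr => k _ /=.
  rewrite !sE /w E3.
  transitivity (2 * ((2 * h)^-1%:MP * h%:MP) * (y u j * y u k * e j k u) +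
     s u * ((2 * h)^-1%:MP * h%:MP * h%:MP + (2 * h)^-1%:MP * e j k u ^+ 2)); first by ring.
  by rewrite E4 mul1r.
by ring.
Qed.

(** The tangent inequality of a function that is strictly concave near [u0], as
    an identity with sums of squares valid around every base point [u]. *)
Lemma concave_certificate (G : A) (u0 : V) :
  (forall v : V, v != 0 -> (v *m hessian G u0 *m v^T) 0 0 < 0) ->
  exists q, [/\ cfamily q, 0 < peval (q u0) u0 &
    bsos (fun u => (peval G u)%:MP + \sum_j (peval G^`M(j) u)%:MP * y u j - G - s u * q u)].
Proof.
move=> Hneg; have [t [ct EG Ht]] := taylor_expansion G.
have [N [mu [N0 mu0 Hmu]]] := @finsler _ _ (hessian G u0) 0 (fun v v0 _ => Hneg v v0).
have [||v|q [cq q0 Hq]] := @quadratic_certificate (fun j k u => - t j k u) (mu / 2) u0.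
- by rewrite divr_gt0.
- by move=> j k; apply: cfamilyN.
- have := Hmu v; rewrite mul0mx [(0 : 'M_1) 0 0]mxE expr0n mulr0 subr0.
  have -> : (v *m hessian G u0 *m v^T) 0 0 =
      2 * \sum_j \sum_k v 0 j * v 0 k * peval (t j k u0) u0.
    rewrite mx_quadE; transitivity (\sum_j \sum_k v 0 j * v 0 k * (peval (t j k u0) u0 + peval (t k j u0) u0)).
      by apply: eq_bigr => j _; apply: eq_bigr => k _; rewrite Ht !mxE.
    rewrite (_ : \sum_j _ = \sum_j \sum_k v 0 j * v 0 k * peval (t j k u0) u0 +
       \sum_j \sum_k v 0 k * v 0 j * peval (t k j u0) u0).
      by rewrite [X in _ + X]exchange_big /=; ring.
    rewrite -big_split; apply: eq_bigr => j _; rewrite -big_split; apply: eq_bigr => k _ /=.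
    by ring.
  have -> : \sum_j \sum_k v 0 j * v 0 k * peval (- t j k u0) u0 =
     - \sum_j \sum_k v 0 j * v 0 k * peval (t j k u0) u0.
    rewrite -sumrN; apply: eq_bigr => j _; rewrite -sumrN; apply: eq_bigr => k _.
    by rewrite pevalN mulrN.
  by lra.
exists q; split => //; move: Hq; congr bsos; apply/funext => u.
have E := EG u; set c0 := (peval G u)%:MP in E *.
set l1 := \sum_j (peval G^`M(j) u)%:MP * y u j in E *.
set r2 := \sum_j \sum_k y u j * y u k * t j k u in E.
have -> : c0 + l1 - G = - r2 by rewrite {1}E; ring.
congr (_ - _); rewrite /r2 -sumrN; apply: eq_bigr => j _; rewrite -sumrN.
by apply: eq_bigr => k _; rewrite mulrN.
Qed.

End LocalConcavity.

(** * Lagrange multipliers by a quadratic penalty *)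

Lemma stationary_coef (R : realFieldType) (D C h0 : R) : 0 < h0 ->
  (forall h, `|h| <= h0 -> 0 <= h * D + C * h ^+ 2) -> D = 0.
Proof.
move=> h00 H; apply/eqP; apply: contraT => D0.
have C0 : 0 < `|C| + 1 by rewrite ltr_wpDl.
pose h := Num.min h0 (`|D| / (2 * (`|C| + 1))).
have hp : 0 < h by rewrite lt_min h00 divr_gt0 ?normr_gt0// mulr_gt0.
have hh0 : h <= h0 by rewrite ge_min lexx.
have hD : (`|C| + 1) * h <= `|D| / 2.
  apply: le_trans (_ : (`|C| + 1) * (`|D| / (2 * (`|C| + 1))) <= _).
    by rewrite ler_wpM2l ?(ltW C0)// ge_min lexx orbT.
  by rewrite le_eqVlt; apply/orP; left; apply/eqP; field; rewrite gt_eqF.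
have : h * (`|C| * h) < h * `|D|.
  rewrite ltr_pM2l//; apply: lt_le_trans (_ : (`|C| + 1) * h <= _).
    by rewrite ltr_pM2r// ltrDl.
  by apply: le_trans hD _; have := normr_ge0 D; lra.
have CC : C * h ^+ 2 <= h * (`|C| * h).
  have -> : h * (`|C| * h) = `|C| * h ^+ 2 by ring.
  by rewrite ler_wpM2r ?sqr_ge0// ler_norm.
have [Dn|Dp] := leP D 0.
  have := H h; rewrite gtr0_norm// => /(_ hh0).
  have -> : h * D = - (h * `|D|) by rewrite ler0_norm// mulrN opprK.
  by move: (h * `|D|) (h * (`|C| * h)) (C * h ^+ 2) CC => a b c; lra.
have := H (- h); rewrite normrN gtr0_norm// sqrrN => /(_ hh0).
have -> : - h * D = - (h * `|D|) by rewrite gtr0_norm// mulNr.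
by move: (h * `|D|) (h * (`|C| * h)) (C * h ^+ 2) CC => a b c; lra.
Qed.

(** The square of the negative part has a derivative with Lipschitz constant 2. *)
Lemma min0_sqr_tangent (R : realFieldType) (a b : R) :
  Num.min b 0 ^+ 2 <= Num.min a 0 ^+ 2 + 2 * Num.min a 0 * (b - a) + (b - a) ^+ 2.
Proof.
have := sqr_ge0 a; have := sqr_ge0 b; have := sqr_ge0 (b - a).
rewrite !expr2; have [b0|b0] := leP b 0; have [a0|a0] := leP a 0; nra.
Qed.

Section Penalty.
Variables (R : realType) (n m : nat).
Local Notation A := {mpoly R[n]}.
Local Notation V := 'rV[R]_n.

Lemma poly_second_order (p : A) (u : V) j : exists C : R, forall h, `|h| <= 1 ->
  `|peval p (u + h *: delta_mx 0 j) - peval p u - h * peval p^`M(j) u| <= C * h ^+ 2.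
Proof.
have [t [ct Ep _]] := taylor_expansion p.
have [K HK] : exists K : R, forall h, `|h| <= 1 -> in_box K (u + h *: delta_mx 0 j).
  exists (1 + \sum_i `|u 0 i|) => h h1 i; rewrite !mxE eqxx /=.
  apply: le_trans (ler_normD _ _) _; rewrite addrC lerD//.
    by rewrite normrM -[leRHS](mulr1 1) ler_pM// normr_nat; case: (i == j); rewrite /= ?lexx ?ler01.
  by rewrite (bigD1 i)//= lerDl sumr_ge0.
have [B HB] := poly_bounded_on_box K (t j j u).
exists B => h h1; set x := u + _.
have yE k : peval (shift_var (fun v : V => v) k u) x = h * (k == j)%:R.
  by rewrite shift_varE /x !mxE eqxx /= addrAC subrr add0r.
have -> : peval p x = peval p u +
    \sum_k peval ((peval p^`M(k) u)%:MP * shift_var (fun v : V => v) k u) x +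
    \sum_k peval (\sum_l shift_var (fun v : V => v) k u *
      shift_var (fun v : V => v) l u * t k l u) x.
  by rewrite [in LHS](Ep u) !pevalD pevalC; congr (_ + _ + _); exact: peval_sum.
have -> : \sum_k peval ((peval p^`M(k) u)%:MP * shift_var (fun v : V => v) k u) x
    = h * peval p^`M(j) u.
  rewrite (bigD1 j)//= big1 ?addr0 => [|k /negPf kj]; rewrite pevalM pevalC yE.
    by rewrite eqxx mulr1 mulrC.
  by rewrite kj !mulr0.
have -> : \sum_k peval (\sum_l shift_var (fun v : V => v) k u *
    shift_var (fun v : V => v) l u * t k l u) x = h ^+ 2 * peval (t j j u) x.
  rewrite (bigD1 j)//= [X in _ + X]big1 ?addr0 => [|k /negPf kj]; rewrite peval_sum.
    rewrite (bigD1 j)//= big1 ?addr0 => [|l /negPf lj]; rewrite !pevalM !yE.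
      by rewrite eqxx !mulr1 -expr2.
    by rewrite lj !mulr0 mul0r.
  by rewrite big1// => l _; rewrite !pevalM !yE kj !(mulr0, mul0r).
have -> : peval p u + h * peval p^`M(j) u + h ^+ 2 * peval (t j j u) x - peval p u
    - h * peval p^`M(j) u = h ^+ 2 * peval (t j j u) x by ring.
rewrite normrM normrX mulrC real_normK ?num_real// ler_wpM2r ?sqr_ge0//.
by apply: HB; exact: HK.
Qed.

Variables (act : pred 'I_m) (G : 'I_m -> A).

Definition penalty (x : V) : R := \sum_(i | act i) Num.min (peval (G i) x) 0 ^+ 2.

Lemma penalty_ge0 x : 0 <= penalty x.
Proof. by apply: sumr_ge0 => i _; exact: sqr_ge0. Qed.

Lemma penalty_eq0 x : penalty x = 0 -> forall i, act i -> 0 <= peval (G i) x.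
Proof.
move=> /eqP; rewrite psumr_eq0 => [/allP H i ai|i _]; last exact: sqr_ge0.
have [//|Gi] := leP 0 (peval (G i) x).
have := H i (mem_index_enum i); rewrite ai /= sqrf_eq0 min_l ?ltW// => /eqP E.
by rewrite E ltxx in Gi.
Qed.

Lemma penalty0 x : (forall i, act i -> 0 <= peval (G i) x) -> penalty x = 0.
Proof.
by move=> H; apply: big1 => i ai; rewrite min_r ?H// expr0n.
Qed.

Lemma continuous_penalty : continuous penalty.
Proof.
rewrite (_ : penalty = fun x => \sum_(i | act i)
    (Num.min (peval (G i) x) 0 * Num.min (peval (G i) x) 0)); last first.
  by apply/funext => x; apply: eq_bigr => i _; rewrite expr2.
have cm i : continuous (fun x => Num.min (peval (G i) x) 0).
  by move=> x; apply: continuous_min; [exact: continuous_peval | exact: cst_continuous].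
elim: (index_enum _) => [|i r IH].
  rewrite (_ : (fun x => _) = fun=> 0); first exact: cst_continuous.
  by apply/funext => x; rewrite big_nil.
case ai : (act i); last first.
  by under eq_fun do rewrite big_cons ai.
under eq_fun do rewrite big_cons ai.
by move=> x; exact: (continuousD (continuousM (cm i x) (cm i x)) (IH x)).
Qed.

(** For large [k] the penalized function [f + k * penalty] is positive on the
    ball and has an interior minimum, whose stationarity exhibits the
    multipliers [- 2 k min(G_i(u), 0)]. The point [u] may be infeasible, but
    each multiplier is supported where its constraint is violated. *)
Lemma penalty_multipliers (f : A) (u0 : V) (rho e eta : R) (k0 : nat) :
  0 < e -> e <= rho ->
  (forall x, dist2 x u0 <= rho -> (forall i, act i -> 0 <= peval (G i) x) -> 0 < peval f x) ->
  (forall i, act i -> 0 <= peval (G i) u0) ->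
  (forall x, dist2 x u0 <= rho -> e <= dist2 x u0 -> eta < peval f x + k0%:R * penalty x) ->
  peval f u0 <= eta ->
  exists (u : V) (lam : 'I_m -> R),
  [/\ dist2 u u0 < e, forall i, 0 <= lam i, forall i, act i -> lam i * peval (G i) u <= 0,
      0 <= peval f u - \sum_(i | act i) lam i * peval (G i) u &
      forall j, peval f^`M(j) u = \sum_(i | act i) lam i * peval (G i)^`M(j) u].
Proof.
move=> e0 erho fpos G0 fann fu0.
pose B := [set x | dist2 x u0 <= rho].
have cB : compact B by exact: dist2_ball_compact.
have [N HN] := penalty_eventually_positive cB (@continuous_peval _ _ f)
   continuous_penalty penalty_ge0 (fun x xB px => fpos x xB (penalty_eq0 px)).
pose k := maxn N k0.
pose Phi x := peval f x + k%:R * penalty x.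
have PhiN x : peval f x + N%:R * penalty x <= Phi x.
  by rewrite lerD2l ler_wpM2r ?penalty_ge0// ler_nat leq_maxl.
have Phik x : peval f x + k0%:R * penalty x <= Phi x.
  by rewrite lerD2l ler_wpM2r ?penalty_ge0// ler_nat leq_maxr.
have cPhi : continuous Phi.
  move=> x; have ck : continuous (fun _ : V => k%:R : R) by exact: cst_continuous.
  exact: (continuousD (@continuous_peval _ _ f x) (continuousM (ck x) (@continuous_penalty x))).
have Bu0 : B u0 by rewrite /B /= dist2xx (le_trans (ltW e0)).
have [|u uB umin] := compact_EVT_min _ cB (continuous_subspaceT cPhi); first by exists u0.
rewrite inE in uB.
have {}umin x : B x -> Phi u <= Phi x by move=> Bx; apply: umin; rewrite inE.
have ue : dist2 u u0 < e.
  rewrite ltNge; apply/negP => eu.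
  have := fann u uB eu; have := Phik u; have := umin u0 Bu0.
  by rewrite {2}/Phi penalty0// mulr0; lra.
pose lam i := - (2 * k%:R * Num.min (peval (G i) u) 0).
have lam0 i : 0 <= lam i.
  by rewrite /lam -mulrN mulr_ge0 ?oppr_ge0 ?mulr_ge0// ge_min lexx orbT.
have lamG i : lam i * peval (G i) u = - (2 * k%:R * Num.min (peval (G i) u) 0 ^+ 2).
  rewrite /lam; by case: leP => _; ring.
exists u, lam; split => // [i _||j].
- by rewrite lamG oppr_le0 mulr_ge0 ?sqr_ge0 ?mulr_ge0.
- have -> : peval f u - \sum_(i | act i) lam i * peval (G i) u = Phi u + k%:R * penalty u.
    rewrite /Phi -addrA; congr (_ + _); rewrite -sumrN /penalty !mulr_sumr -big_split.
    by apply: eq_bigr => i _; rewrite lamG opprK /=; ring.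
  rewrite addr_ge0 ?mulr_ge0 ?penalty_ge0//.
  have := HN u uB; have := PhiN u.
  have : 0 <= N.+1%:R^-1 :> R by rewrite invr_ge0.
  by move: (N.+1%:R^-1) => c; lra.
apply/eqP; rewrite -subr_eq0; apply/eqP.
have [Cf HCf] := poly_second_order f u j.
have /choice[C HC] : forall i, exists C : R, forall h, `|h| <= 1 ->
  `|peval (G i) (u + h *: delta_mx 0 j) - peval (G i) u - h * peval (G i)^`M(j) u| <= C * h ^+ 2.
  by move=> i; exact: poly_second_order.
have [h1 h10 Hh1] : exists2 h1 : R, 0 < h1 & forall h, `|h| <= h1 ->
    B (u + h *: delta_mx 0 j).
  have [d d0 Hd] : exists2 d : R, 0 < d & forall x, dist2 x u <= d -> dist2 x u0 < e.
    by apply: nbhs_dist2; have := @continuous_dist2 _ _ u0 u => /cvgr_lt; apply.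
  exists (Num.sqrt d) => [|h hd]; first by rewrite sqrtr_gt0.
  apply: le_trans erho; apply: ltW; apply: Hd.
  rewrite /dist2 (bigD1 j)//= big1 => [|i /negPf ij]; rewrite !mxE eqxx /=.
    rewrite eqxx mulr1 addrAC subrr add0r addr0 -[leRHS]sqr_sqrtr ?(ltW d0)//.
    by rewrite -[leLHS]real_normK ?num_real// ler_sqr ?nnegrE ?sqrtr_ge0.
  by rewrite ij mulr0 addr0 subrr expr0n.
(* [E i * h ^+ 2] bounds the second order part of the [i]-th penalty term along
   the [j]-th axis. *)
pose E i := 2 * k%:R * `|Num.min (peval (G i) u) 0| * C i
   + k%:R * (`|peval (G i)^`M(j) u| + `|C i|) ^+ 2.
apply: (@stationary_coef _ _ (Cf + \sum_(i | act i) E i) (Num.min 1 h1)).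
  by rewrite lt_min ltr01.
move=> h; rewrite le_min => /andP[hle1 hleh1].
have Hf := HCf h hle1; have := umin _ (Hh1 h hleh1); set x := u + _ in Hf *.
rewrite -subr_ge0 => Hmin; apply: le_trans Hmin _.
have Hi i : act i -> k%:R * (Num.min (peval (G i) x) 0 ^+ 2 - Num.min (peval (G i) u) 0 ^+ 2) <=
    - (h * (lam i * peval (G i)^`M(j) u)) + E i * h ^+ 2.
  move=> _; have := HC i h hle1; rewrite -/x.
  set b := peval (G i) x; set a := peval (G i) u; set d := peval _ u => Hd.
  have Hba : `|b - a| <= `|h| * (`|d| + `|C i|).
    have -> : b - a = (b - a - h * d) + h * d by ring.
    apply: le_trans (ler_normD _ _) _; rewrite normrM addrC mulrDr lerD2l.
    apply: le_trans Hd _; apply: le_trans (_ : `|C i| * h ^+ 2 <= _).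
      by rewrite ler_wpM2r ?sqr_ge0// ler_norm.
    rewrite mulrC ler_wpM2r// -real_normK ?num_real// expr2.
    by rewrite -[leRHS]mulr1 ler_wpM2l.
  have Hba2 : (b - a) ^+ 2 <= h ^+ 2 * (`|d| + `|C i|) ^+ 2.
    rewrite -exprMn -[leLHS]real_normK ?num_real//.
    apply: le_trans (_ : (`|h| * (`|d| + `|C i|)) ^+ 2 <= _).
      by rewrite ler_sqr ?nnegrE// mulr_ge0// addr_ge0.
    by rewrite !exprMn real_normK ?num_real.
  have T := min0_sqr_tangent a b.
  set mn := Num.min a 0 in T *.
  have Hm : 2 * mn * (b - a) <= 2 * mn * (h * d) + 2 * `|mn| * (C i * h ^+ 2).
    have -> : 2 * mn * (b - a) = 2 * mn * (h * d) + 2 * (mn * (b - a - h * d)) by ring.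
    rewrite lerD2l -mulrA ler_wpM2l//; apply: le_trans (ler_norm _) _.
    by rewrite normrM ler_wpM2l.
  have kE : - (h * (lam i * d)) + E i * h ^+ 2 =
     k%:R * (2 * mn * (h * d) + 2 * `|mn| * (C i * h ^+ 2) + h ^+ 2 * (`|d| + `|C i|) ^+ 2).
    by rewrite /lam /E -/a -/mn -/d; ring.
  by rewrite kE ler_wpM2l//; lra.
have -> : Phi x - Phi u = (peval f x - peval f u) + \sum_(i | act i)
   k%:R * (Num.min (peval (G i) x) 0 ^+ 2 - Num.min (peval (G i) u) 0 ^+ 2).
  rewrite /Phi /penalty opprD addrACA; congr (_ + _); rewrite -mulrBr -sumrB mulr_sumr.
  by apply: eq_bigr.
have -> : h * (peval f^`M(j) u - \sum_(i | act i) lam i * peval (G i)^`M(j) u) +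
   (Cf + \sum_(i | act i) E i) * h ^+ 2 = (h * peval f^`M(j) u + Cf * h ^+ 2) +
   \sum_(i | act i) (- (h * (lam i * peval (G i)^`M(j) u)) + E i * h ^+ 2).
  by rewrite [in RHS]big_split /= sumrN -mulr_sumr -mulr_suml; ring.
apply: lerD; last exact: ler_sum.
by move: Hf; rewrite ler_norml => /andP[_]; lra.
Qed.

End Penalty.

(** * Certificates for linear forms near a support point *)

Section SupportPoint.
Variables (R : realType) (n m : nat) (g : m.-tuple {mpoly R[n]}).
Local Notation A := {mpoly R[n]}.
Local Notation V := 'rV[R]_n.
Local Notation S := (semialg g).

Lemma finite_lower_bound (I : finType) (P : pred I) (v : I -> R) :
  (forall i, P i -> 0 < v i) -> exists c, 0 < c /\ forall i, P i -> c <= v i.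
Proof.
move=> v0; pose c := (1 + \sum_(i | P i) (v i)^-1)^-1.
have s0 : 0 <= \sum_(i | P i) (v i)^-1.
  by apply: sumr_ge0 => i Pi; rewrite invr_ge0 ltW// v0.
exists c; split; first by rewrite invr_gt0 ltr_pwDl.
move=> i Pi; rewrite -[leRHS]invrK lef_pV2 ?posrE ?invr_gt0 ?v0// ?ltr_pwDl//.
rewrite (bigD1 i)//= addrCA lerDl addr_ge0// sumr_ge0// => j /andP[Pj _].
by rewrite invr_ge0 ltW// v0.
Qed.

(** [g * (1 - kappa * g) ^+ 2] has the same sign as [g] near its zeros, where
    its Hessian is [Hess g - 4 kappa (grad g)(grad g)^T]; by Finsler's lemma
    this turns strict quasiconcavity into strict concavity. *)
Lemma quasiconcave_concavify (p : A) (u0 : V) :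
  peval p u0 = 0 -> strictly_quasiconcave_at p u0 ->
  exists kappa : R, forall v : V, v != 0 ->
    (v *m hessian (p * (1 - kappa%:MP * p) ^+ 2) u0 *m v^T) 0 0 < 0.
Proof.
move=> p0 qc.
have [N [mu [N0 mu0 H]]] := finsler qc.
exists (N / 4) => v v0.
have -> : (v *m hessian (p * (1 - (N / 4)%:MP * p) ^+ 2) u0 *m v^T) 0 0 =
    (v *m hessian p u0 *m v^T) 0 0 - N * (gradient p u0 *m v^T) 0 0 ^+ 2.
  have HE i j : hessian (p * (1 - (N / 4)%:MP * p) ^+ 2) u0 i j =
      hessian p u0 i j - N * (gradient p u0 0 i * gradient p u0 0 j).
    rewrite !mxE expr2 !(mderivM, mderivB, mderivD, mderivC, mderivN).
    rewrite !(pevalM, pevalB, pevalD, pevalC, pevalN, peval1, peval0) p0.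
    by field.
  have LE : (gradient p u0 *m v^T) 0 0 = \sum_i v 0 i * gradient p u0 0 i.
    by rewrite mxE; apply: eq_bigr => i _; rewrite !mxE mulrC.
  have L2 : (\sum_i v 0 i * gradient p u0 0 i) ^+ 2 = \sum_i \sum_j
      (v 0 i * gradient p u0 0 i) * (v 0 j * gradient p u0 0 j).
    by rewrite expr2 big_distrlr.
  rewrite !mx_quadE LE L2 mulr_sumr -sumrB.
  apply: eq_bigr => i _; rewrite mulr_sumr -sumrB; apply: eq_bigr => j _.
  by rewrite HE; ring.
have := H v; have : 0 < mu * dist2 v 0 by rewrite mulr_gt0// dist2_gt0.
by lra.
Qed.

Definition affine_form (a : V) (b : R) : A := b%:MP - \sum_j (a 0 j)%:MP * 'X_j.

Lemma affine_formE a b x : peval (affine_form a b) x = b - \sum_j a 0 j * x 0 j.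
Proof.
rewrite /affine_form pevalB pevalC peval_sum; congr (_ - _).
by apply: eq_bigr => j _; rewrite pevalM pevalC pevalX.
Qed.

Lemma affine_form_deriv a b j x : peval (affine_form a b)^`M(j) x = - a 0 j.
Proof.
rewrite /affine_form mderivB mderivC sub0r pevalN.
have -> : (\sum_k (a 0 k)%:MP * 'X_k : A)^`M(j) = \sum_k ((a 0 k)%:MP * 'X_k)^`M(j).
  by rewrite raddf_sum.
rewrite peval_sum.
rewrite (bigD1 j)//= big1 ?addr0 => [|k /negPf kj].
  by rewrite mderivM mderivC mul0r add0r mderiv_var eqxx pevalM !pevalC mulr1.
by rewrite mderivM mderivC mul0r add0r mderiv_var kj pevalM !pevalC mulr0.
Qed.

Lemma affine_form_taylor a b (u : V) :
  affine_form a b = (peval (affine_form a b) u)%:MP +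
    \sum_j (- a 0 j)%:MP * shift_var (fun v : V => v) j u.
Proof.
rewrite affine_formE rmorphB rmorph_sum /= /affine_form -addrA; congr (_ + _).
rewrite -!sumrN -big_split; apply: eq_bigr => j _ /=.
by rewrite /shift_var rmorphN rmorphM /=; ring.
Qed.

Lemma affine_perturb (K theta : R) (a a0 x : V) (b b0 : R) : in_box K x ->
  (forall j, `|a 0 j - a0 0 j| <= theta) -> `|b - b0| <= theta ->
  `|peval (affine_form a b) x - peval (affine_form a0 b0) x| <= theta * (1 + n%:R * K).
Proof.
move=> xK Ha Hb; rewrite !affine_formE.
have -> : b - \sum_j a 0 j * x 0 j - (b0 - \sum_j a0 0 j * x 0 j) =
   (b - b0) - \sum_j (a 0 j - a0 0 j) * x 0 j.
  have -> : \sum_j (a 0 j - a0 0 j) * x 0 j = \sum_j a 0 j * x 0 j - \sum_j a0 0 j * x 0 j.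
    by rewrite -sumrB; apply: eq_bigr => j _; rewrite mulrBl.
  by ring.
apply: le_trans (ler_normB _ _) _; rewrite mulrDr mulr1; apply: lerD => //.
apply: le_trans (ler_norm_sum _ _ _) _.
apply: le_trans (_ : \sum_(j < n) theta * K <= _).
  by apply: ler_sum => j _; rewrite normrM ler_pM.
by rewrite sumr_const card_ord mulrCA [leRHS]mulr_natl.
Qed.

Lemma dist2_line (u w : V) : dist2 (u + w) u = dist2 w 0.
Proof. by apply: eq_bigr => i _; rewrite !mxE addrAC subrr add0r subr0. Qed.

Lemma dist2_scale h (w : V) : dist2 (h *: w) 0 = h ^+ 2 * dist2 w 0.
Proof. by rewrite /dist2 mulr_sumr; apply: eq_bigr => i _; rewrite !mxE !subr0 exprMn. Qed.

Lemma cfamily_pullback (T : Type) (p : V -> A) (B : set V) (u : T -> V) :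
  cfamily p -> compact B -> (forall t, B (u t)) -> bfamily (fun t => p (u t)).
Proof.
move=> + cB uB; elim=> [|c P {}p cc _ IH]; first exact: family0.
apply: family_cons => //.
have := compact_bounded (continuous_compact (continuous_subspaceT (cc : continuous c)) cB).
move=> /ex_strict_bound_gt0[M M0 HM]; exists M => t.
by apply: ltW; apply: HM; exists (u t).
Qed.

Section Model.
Variables (u0 a0 : V) (b0 : R).
Hypothesis g_arch : archimedean_qmodule g.
Hypothesis Su0 : S u0.
Hypothesis u0_int : closure S° u0.
Hypothesis u0_qc : forall i, peval (tnth g i) u0 = 0 -> strictly_quasiconcave_at (tnth g i) u0.
Hypothesis a0_neq0 : a0 != 0.
Local Notation f0 := (affine_form a0 b0).
Hypothesis f0_ge0 : forall x, S x -> 0 <= peval f0 x.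
Hypothesis f0_u0 : peval f0 u0 = 0.

Local Notation y u j := (shift_var (fun t : V => t) j u).
Local Notation sq u := (sq_dist (fun t : V => t) u).

Let act : pred 'I_m := fun i => peval (tnth g i) u0 == 0.

(** Strictly concave substitutes [G i] for the active constraints, the curvature
    factors [q i] of their tangent inequalities, and a radius within which the
    substitutes describe [S] and the factors are bounded below. *)
Definition local_model (G : 'I_m -> A) (q : 'I_m -> V -> A) (rho c : R) : Prop :=
  [/\ 0 < rho, 0 < c,
   forall i, act i -> cfamily (q i) /\ exists d, trunc_qmodule g d (G i),
   forall i, act i -> btrunc ([tuple] : 0.-tuple A)
     (fun u => (peval (G i) u)%:MP + \sum_j (peval (G i)^`M(j) u)%:MP * y u j - G i - sq u * q i u) &
   (forall i u x, act i -> dist2 u u0 <= rho -> dist2 x u0 <= rho -> c <= peval (q i u) x) /\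
   (forall x, dist2 x u0 <= rho -> (forall i, act i -> 0 <= peval (G i) x) -> S x)].

Lemma local_model_exists : exists G q rho c, local_model G q rho c.
Proof.
have /choice[kappa Hk] : forall i, exists kappa : R, act i -> forall v : V, v != 0 ->
    (v *m hessian (tnth g i * (1 - kappa%:MP * tnth g i) ^+ 2) u0 *m v^T) 0 0 < 0.
  move=> i; have [ai|_] := boolP (act i); last by exists 0.
  have [k Hk] := quasiconcave_concavify (eqP ai) (u0_qc (eqP ai)).
  by exists k.
pose G i := tnth g i * (1 - (kappa i)%:MP * tnth g i) ^+ 2.
have /choice[q Hq] : forall i, exists q, act i -> [/\ cfamily q, 0 < peval (q u0) u0 &
    btrunc ([tuple] : 0.-tuple A) (fun u => (peval (G i) u)%:MP +
      \sum_j (peval (G i)^`M(j) u)%:MP * y u j - G i - sq u * q u)].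
  move=> i; have [ai|_] := boolP (act i); last by exists (fun=> 0).
  by have [q Hq] := concave_certificate (Hk i ai); exists q.
have [c [c0 Hc]] : exists c, 0 < c /\ forall i, act i -> c <= peval (q i u0) u0.
  by apply: finite_lower_bound => i ai; have [] := Hq i ai.
have c20 : 0 < c / 2 by rewrite divr_gt0.
have /choice[rq Hrq] : forall i, exists r : R, 0 < r /\ (act i -> forall u x,
    dist2 u u0 <= r -> dist2 x u0 <= r -> c / 2 <= peval (q i u) x).
  move=> i; have [ai|_] := boolP (act i); last by exists 1.
  have [cq _ _] := Hq i ai.
  have : \forall z \near (u0, u0), c / 2 < peval (q i z.1) z.2.
    have H := cfamily_joint_continuous cq.
    have := H (u0, u0) => /cvgr_gt; apply => /=.
    by have := Hc i ai; lra.
  move=> /nbhs_dist2_prod[e e0 He]; exists e; split => // _ u x ue xe.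
  exact: ltW (He u x ue xe).
have /choice[rg Hrg] : forall i, exists r : R, 0 < r /\ (forall x,
    dist2 x u0 <= r -> if act i then 0 < 1 - kappa i * peval (tnth g i) x else 0 < peval (tnth g i) x).
  move=> i; have [ai|nai] := boolP (act i).
    have : \forall x \near u0, 0 < 1 - kappa i * peval (tnth g i) x.
      have H : continuous (fun x => peval (1 - (kappa i)%:MP * tnth g i) x).
        exact: continuous_peval.
      have := H u0 => /cvgr_gt/(_ 0); rewrite pevalB peval1 pevalM (eqP ai) mulr0 subr0.
      move=> /(_ ltr01); apply: filterS => x; by rewrite pevalB peval1 pevalM pevalC.
    by move=> /nbhs_dist2[e e0 He]; exists e.
  have : \forall x \near u0, 0 < peval (tnth g i) x.
    have := @continuous_peval _ _ (tnth g i) u0 => /cvgr_gt; apply.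
    by rewrite lt_def nai Su0.
  by move=> /nbhs_dist2[e e0 He]; exists e.
have [r1 [r10 Hr1]] : exists c, 0 < c /\ forall i, predT i -> c <= rq i.
  by apply: finite_lower_bound => i _; have [] := Hrq i.
have [r2 [r20 Hr2]] : exists c, 0 < c /\ forall i, predT i -> c <= rg i.
  by apply: finite_lower_bound => i _; have [] := Hrg i.
exists G, q, (Num.min r1 r2), (c / 2); split => //.
- by rewrite lt_min r10.
- move=> i ai; have [cq _ _] := Hq i ai; split => //.
  have [d Hd] := trunc_g g i; rewrite /G mulrC.
  by eexists; apply: trunc_sqrM Hd; exact: leqnn.
- by move=> i ai; have [] := Hq i ai.
split=> [i u x ai|x].
  rewrite !le_min => /andP[u1 _] /andP[x1 _]; have [_ H] := Hrq i.
  by apply: (H ai); [apply: le_trans u1 _|apply: le_trans x1 _]; exact: Hr1.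
rewrite le_min => /andP[_ x2] HG i; have [_ H] := Hrg i.
have := H x (le_trans x2 (Hr2 i isT)); case: ifP => [ai k0|_ /ltW//].
have := HG i ai; rewrite /G pevalM pevalXn pevalB peval1 pevalM pevalC.
by rewrite pmulr_lge0// exprn_gt0.
Qed.

Variables (G : 'I_m -> A) (q : 'I_m -> V -> A) (rho c : R).
Hypothesis model : local_model G q rho c.

Lemma model_rho : 0 < rho. Proof. by have [] := model. Qed.
Lemma model_c : 0 < c. Proof. by have [] := model. Qed.
Lemma model_ge0 x i : S x -> act i -> 0 <= peval (G i) x.
Proof. by have [_ _ + _ _] := model => /[swap] Sx /[apply] -[_ [d /trunc_ge0]]; exact. Qed.
Lemma model_feasible x : dist2 x u0 <= rho -> (forall i, act i -> 0 <= peval (G i) x) -> S x.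
Proof. by have [_ _ _ _ [_ +]] := model; exact. Qed.

Lemma model_tangent i u x : act i -> dist2 u u0 <= rho -> dist2 x u0 <= rho ->
  peval (G i) x + c * dist2 x u <=
  peval (G i) u + \sum_j peval (G i)^`M(j) u * (x 0 j - u 0 j).
Proof.
move=> ai uB xB; have [_ _ _ /(_ i ai)[d Hd] [/(_ i u x ai uB xB) qc _]] := model.
have := sos_trunc_ge0 x (Hd u); rewrite !pevalB pevalD pevalC pevalM sq_distE peval_sum.
rewrite (eq_bigr (fun j => peval (G i)^`M(j) u * (x 0 j - u 0 j))); last first.
  by move=> j _; rewrite pevalM pevalC shift_varE.
have : c * dist2 x u <= dist2 x u * peval (q i u) x.
  by rewrite mulrC ler_wpM2l// dist2_ge0.
by lra.
Qed.

(** The sum of the tangent inequalities at [z] in two opposite directions. *)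
Lemma model_midpoint i z w : act i -> dist2 z u0 <= rho ->
  dist2 (z + w) u0 <= rho -> dist2 (z - w) u0 <= rho ->
  peval (G i) (z + w) + peval (G i) (z - w) + 2 * c * dist2 w 0 <= 2 * peval (G i) z.
Proof.
move=> ai zB pB mB; have := model_tangent ai zB pB; have := model_tangent ai zB mB.
rewrite !dist2_line.
have -> : dist2 (- w) 0 = dist2 w 0 by rewrite -scaleN1r dist2_scale sqrrN expr1n mul1r.
have -> : \sum_j peval (G i)^`M(j) z * ((z - w) 0 j - z 0 j) = - \sum_j peval (G i)^`M(j) z * w 0 j.
  by rewrite -sumrN; apply: eq_bigr => j _; rewrite !mxE; ring.
have -> : \sum_j peval (G i)^`M(j) z * ((z + w) 0 j - z 0 j) = \sum_j peval (G i)^`M(j) z * w 0 j.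
  by apply: eq_bigr => j _; rewrite !mxE; ring.
by move: (\sum_j _) (dist2 w 0) (peval _ (z + w)) (peval _ (z - w)) => *; nra.
Qed.

Lemma step_along (z : V) (P : set V) : nbhs z P ->
  exists h, 0 < h /\ P (z + h *: a0) /\ P (z - h *: a0).
Proof.
move=> /nbhs_dist2[e e0 He]; have d0 := dist2_gt0 a0_neq0.
exists (Num.sqrt (e / dist2 a0 0)); split; first by rewrite sqrtr_gt0 divr_gt0.
set h := Num.sqrt _.
have hE : h ^+ 2 * dist2 a0 0 = e by rewrite sqr_sqrtr ?divr_ge0 ?ltW// divfK// gt_eqF.
split; apply: He; first by rewrite dist2_line dist2_scale hE.
by rewrite dist2_line -scaleNr dist2_scale sqrrN hE.
Qed.

Lemma near_ball z : dist2 z u0 < rho -> \forall x \near z, dist2 x u0 <= rho.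
Proof.
move=> zr; have : \forall x \near z, dist2 x u0 < rho.
  by have := @continuous_dist2 _ _ u0 z => /cvgr_lt; apply.
by apply: filterS => x /ltW.
Qed.

(** An interior point of [S] close to [u0] satisfies all active constraints
    strictly: at an interior zero the strictly concave [G i] would have to be
    nonnegative on both sides. *)
Lemma slater_point : exists s0 gam, [/\ 0 < gam, dist2 s0 u0 <= rho &
  forall i, act i -> gam <= peval (G i) s0].
Proof.
have [s0 [Ss0 s0B]] := u0_int (near_dist2 u0 model_rho).
have SS : S s0 := interior_subset Ss0.
have [h [h0 [[Sp Bp] [Sm Bm]]]] := step_along (filterI Ss0 (near_ball s0B)).
have [gam [gam0 Hgam]] : exists c, 0 < c /\ forall i, act i -> c <= peval (G i) s0.
  apply: finite_lower_bound => i ai; rewrite lt_def (model_ge0 SS ai) andbT.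
  apply/eqP => Gi0; have := model_midpoint ai (ltW s0B) Bp Bm.
  have := model_ge0 Sp ai; have := model_ge0 Sm ai; rewrite Gi0 mulr0 dist2_scale.
  have : 0 < 2 * c * (h ^+ 2 * dist2 a0 0).
    by rewrite mulr_gt0 ?mulr_gt0 ?exprn_gt0 ?dist2_gt0 ?model_c.
  by lra.
by exists s0, gam; split => //; exact: ltW.
Qed.

(** Otherwise the midpoint of [x] and [u0] could be moved in direction [a0]
    within [S], making [f0] negative. *)
Lemma support_point_isolated x : S x -> dist2 x u0 <= rho -> x != u0 -> 0 < peval f0 x.
Proof.
move=> Sx xB xu; rewrite lt_def f0_ge0// andbT; apply/eqP => f0x.
pose w := 2^-1 *: (x - u0); pose z := u0 + w.
have xE : x = z + w.
  by rewrite /z /w -addrA -scalerDl -[LHS](subrK u0) addrC; congr (_ + _);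
     rewrite -[LHS]scale1r; congr (_ *: _); field.
have uE : u0 = z - w by rewrite /z addrK.
have dw : dist2 w 0 = 4^-1 * dist2 x u0.
  rewrite /w dist2_scale -[X in _ = _ * dist2 X _](subrK u0) [x - u0 + u0]addrC dist2_line.
  by congr (_ * _); field.
have w0 : 0 < dist2 w 0 by rewrite dw mulr_gt0// dist2_gt0.
have zB : dist2 z u0 < rho.
  by rewrite /z dist2_line dw; have := dist2_gt0 xu; have := model_rho; lra.
have uB : dist2 u0 u0 <= rho by rewrite dist2xx ltW// model_rho.
have Gz i : act i -> 0 < peval (G i) z.
  move=> ai; have := model_midpoint ai (ltW zB); move=> /(_ w).
  rewrite -xE -uE => /(_ xB uB); have := model_ge0 Sx ai; have := model_ge0 Su0 ai.
  have : 0 < 2 * c * dist2 w 0 by rewrite mulr_gt0// mulr_gt0// model_c.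
  by lra.
have /choice[e He] : forall i, exists e : R, 0 < e /\ (act i -> forall x, dist2 x z <= e -> 0 <= peval (G i) x).
  move=> i; have [ai|_] := boolP (act i); last by exists 1.
  have : \forall x \near z, 0 < peval (G i) x.
    by have := @continuous_peval _ _ (G i) z => /cvgr_gt; apply; exact: Gz.
  by move=> /nbhs_dist2[e e0 He]; exists e; split => // _ x1 /He/ltW.
have [r [r0 Hr]] : exists c, 0 < c /\ forall i, predT i -> c <= e i.
  by apply: finite_lower_bound => i _; have [] := He i.
have [h [h0 [[/ltW hr hB] _]]] := step_along (filterI (near_dist2 z r0) (near_ball zB)).
have : S (z + h *: a0).
  apply: model_feasible => // i ai; have [_ H] := He i.
  by apply: (H ai); exact: le_trans hr (Hr i isT).
move=> /f0_ge0; rewrite affine_formE.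
have -> : \sum_j a0 0 j * (z + h *: a0) 0 j =
   2^-1 * (\sum_j a0 0 j * x 0 j) + 2^-1 * (\sum_j a0 0 j * u0 0 j) + h * dist2 a0 0.
  rewrite dist2_0 !mulr_sumr -!big_split; apply: eq_bigr => j _ /=.
  by rewrite /z /w !mxE; field.
have hd : 0 < h * dist2 a0 0 by rewrite mulr_gt0// dist2_gt0.
move: f0x f0_u0; rewrite !affine_formE; lra.
Qed.

(** Around [u0], every linear form positive on [S] whose data are close to
    [(a0, b0)] has a certificate with a nondegenerate zero at a point [u t]
    close to [u0]: the multipliers [lam] write the gradient as a combination of
    those of the [G i], and the sum of the tangent inequalities of [G i] at
    [u t], weighted by [lam], is the certificate. *)
Lemma model_certificate : exists c1 : R, 0 < c1 /\ forall e : R, 0 < e ->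
  exists theta : R, 0 < theta /\
  forall (T : Type) (a : T -> V) (b : T -> R),
    (forall t j, `|a t 0 j - a0 0 j| <= theta) -> (forall t, `|b t - b0| <= theta) ->
    (forall t x, S x -> 0 < peval (affine_form (a t) (b t)) x) ->
  exists (u : T -> V) (p : T -> A), [/\ forall t, dist2 (u t) u0 <= e, bfamily p,
    forall t x, dist2 x u0 <= rho -> c1 <= peval (p t) x &
    btrunc g (fun t => affine_form (a t) (b t) - sq_dist u t * p t)].
Proof.
have rho0 := model_rho; have c0 := model_c.
have [s0 [gam [gam0 s0B Hgam]]] := slater_point.
have [K [K0 HK]] := dist2_ball_box u0 rho.
have [j0 aj0] : exists j, a0 0 j != 0.
  apply: contrapT => H; move: a0_neq0; apply/negP; rewrite negbK; apply/eqP/rowP => j.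
  by rewrite mxE; apply: contrapT => /eqP Hj; apply: H; exists j.
have aj0p : 0 < `|a0 0 j0| by rewrite normr_gt0.
have /choice[D HD] : forall i, exists D : R, forall x, in_box K x -> `|peval (G i)^`M(j0) x| <= D.
  by move=> i; exact: poly_bounded_on_box.
pose Dm := 1 + \sum_i `|D i|.
have Dm0 : 0 < Dm by rewrite ltr_pwDl// sumr_ge0.
have HDm i x : in_box K x -> `|peval (G i)^`M(j0) x| <= Dm.
  move=> xK; apply: le_trans (HD i x xK) _; apply: le_trans (ler_norm _) _.
  by rewrite /Dm (bigD1 i)//= addrCA lerDl addr_ge0// sumr_ge0.
(* The gradient of the form is bounded away from 0, and it is a combination of
   bounded gradients: this bounds the sum of the multipliers from below. *)
pose lmin := `|a0 0 j0| / 2 / Dm.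
have lmin0 : 0 < lmin by rewrite !divr_gt0.
exists (lmin * c); split; first by rewrite mulr_gt0.
move=> e e0; pose e' := Num.min e rho.
have e'0 : 0 < e' by rewrite lt_min e0.
have cann : compact [set x | e' <= dist2 x u0 /\ dist2 x u0 <= rho].
  rewrite (_ : [set x | _] = [set x | e' <= dist2 x u0] `&` [set x | dist2 x u0 <= rho])//.
  rewrite setIC; apply: compact_closedI; first exact: dist2_ball_compact.
  by apply: closed_preimage_ge; exact: continuous_dist2.
have [|N HN] := penalty_eventually_positive cann (@continuous_peval _ _ f0)
    (@continuous_penalty R n m act G) (@penalty_ge0 R n m act G).
  move=> x [ex xr] /penalty_eq0 Gx; apply: support_point_isolated => //.
    by apply: model_feasible.
  by apply/eqP => xu; move: ex; rewrite xu dist2xx leNgt e'0.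
set eta : R := N.+1%:R^-1 in HN.
have eta0 : 0 < eta by rewrite invr_gt0.
have nK0 : 0 < 1 + n%:R * K :> R by rewrite ltr_pwDl// mulr_ge0// ltW.
pose theta := Num.min (Num.min 1 (`|a0 0 j0| / 2)) (eta / 2 / (1 + n%:R * K)).
have th0 : 0 < theta by rewrite !lt_min ltr01 !divr_gt0.
have th1 : theta <= 1 by rewrite !ge_min lexx.
have th2 : theta <= `|a0 0 j0| / 2 by rewrite !ge_min lexx orbT.
have th3 : theta * (1 + n%:R * K) <= eta / 2.
  by rewrite -ler_pdivlMr// !ge_min lexx orbT.
exists theta; split => // T a b Ha Hb fpos.
have fclose t x : dist2 x u0 <= rho ->
    `|peval (affine_form (a t) (b t)) x - peval f0 x| <= eta / 2.
  by move=> /HK xK; apply: le_trans th3; exact: affine_perturb.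
have /choice[ul Hul] : forall t, exists ul : V * ('I_m -> R),
  [/\ dist2 ul.1 u0 < e', forall i, 0 <= ul.2 i,
      forall i, act i -> ul.2 i * peval (G i) ul.1 <= 0,
      0 <= peval (affine_form (a t) (b t)) ul.1 - \sum_(i | act i) ul.2 i * peval (G i) ul.1 &
      forall j, - a t 0 j = \sum_(i | act i) ul.2 i * peval (G i)^`M(j) ul.1].
  move=> t; have [|||||u [lam [ue l0 lG fu fd]]] := @penalty_multipliers R n m act G
     (affine_form (a t) (b t)) u0 rho e' (eta / 2) N e'0.
  - by rewrite ge_min lexx orbT.
  - by move=> x xB Gx; apply: fpos; exact: model_feasible.
  - by move=> i ai; exact: model_ge0.
  - move=> x xB ex; have := HN x (conj ex xB); have := fclose t x xB.
    rewrite ler_norml => /andP[+ _]; move: (N%:R * _) => w.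
    by lra.
  - have := fclose t u0; rewrite dist2xx f0_u0 subr0 => /(_ (ltW rho0)).
    by apply: le_trans; exact: ler_norm.
  by exists (u, lam); split => // j; rewrite -(affine_form_deriv (a t) (b t) j u); exact: fd.
pose u t := (ul t).1; pose lam t i := (ul t).2 i.
have ue t : dist2 (u t) u0 <= e' by have [/ltW] := Hul t.
have uB t : dist2 (u t) u0 <= rho by apply: le_trans (ue t) _; rewrite ge_min lexx orbT.
have lam0 t i : 0 <= lam t i by have [_ + _ _ _] := Hul t; exact.
have lamG t i : act i -> lam t i * peval (G i) (u t) <= 0 by have [_ _ + _ _] := Hul t; exact.
have fu t : 0 <= peval (affine_form (a t) (b t)) (u t) -
    \sum_(i | act i) lam t i * peval (G i) (u t) by have [] := Hul t.
have fd t j : - a t 0 j = \sum_(i | act i) lam t i * peval (G i)^`M(j) (u t).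
  by have [] := Hul t.
have lam_low t : lmin <= \sum_(i | act i) lam t i.
  rewrite ler_pdivrMr//; apply: le_trans (_ : `|a t 0 j0| <= _).
    have := Ha t j0; have := ler_normD (a0 0 j0 - a t 0 j0) (a t 0 j0).
    by rewrite subrK distrC; lra.
  rewrite -normrN fd; apply: le_trans (ler_norm_sum _ _ _) _; rewrite mulr_suml.
  apply: ler_sum => i _; rewrite normrM ger0_norm// ler_wpM2l//.
  by apply: HDm; exact: HK.
have [Am HAm] : exists Am : R, forall j, `|a0 0 j| + 1 <= Am.
  exists (\sum_j `|a0 0 j| + 1) => j; rewrite lerD2r (bigD1 j)//= lerDl.
  exact: sumr_ge0.
(* Evaluating the weighted tangent inequalities at the Slater point bounds the
   multipliers from above. *)
pose Lmax := n%:R * (Am * (2 * K)) / gam.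
have lam_up t i : act i -> lam t i <= Lmax.
  move=> ai; apply: le_trans (_ : \sum_(i | act i) lam t i <= _).
    by rewrite (bigD1 i)//= lerDl sumr_ge0.
  rewrite ler_pdivlMr// mulr_suml.
  apply: le_trans (_ : \sum_(i | act i) lam t i * \sum_j peval (G i)^`M(j) (u t) * (s0 0 j - u t 0 j) <= _).
    apply: ler_sum => k ak; have T1 := model_tangent ak (uB t) s0B.
    have := ler_wpM2l (lam0 t k) (Hgam k ak).
    have := ler_wpM2l (lam0 t k) T1; have := lamG t k ak.
    have := mulr_ge0 (lam0 t k) (mulr_ge0 (ltW c0) (dist2_ge0 s0 (u t))).
    by rewrite !mulrDr; lra.
  have -> : \sum_(k | act k) lam t k * \sum_j peval (G k)^`M(j) (u t) * (s0 0 j - u t 0 j)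
     = \sum_j (- a t 0 j) * (s0 0 j - u t 0 j).
    transitivity (\sum_(k | act k) \sum_j lam t k * peval (G k)^`M(j) (u t) * (s0 0 j - u t 0 j)).
      by apply: eq_bigr => k _; rewrite mulr_sumr; apply: eq_bigr => j _; rewrite mulrA.
    by rewrite exchange_big; apply: eq_bigr => j _; rewrite fd mulr_suml.
  apply: le_trans (_ : \sum_(j < n) Am * (2 * K) <= _); last first.
    by rewrite sumr_const card_ord [leRHS]mulr_natl.
  apply: ler_sum => j _; apply: le_trans (ler_norm _) _; rewrite normrM normrN.
  apply: ler_pM => //.
    apply: le_trans (HAm j); have := Ha t j; have := ler_normD (a t 0 j - a0 0 j) (a0 0 j).
    by rewrite subrK; lra.
  apply: le_trans (ler_normB _ _) _.
  by have := HK s0 s0B j; have := HK (u t) (uB t) j; lra.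
have blam i : act i -> bounded_coef (fun t => lam t i).
  by move=> ai; exists Lmax => t; rewrite ger0_norm// lam_up.
exists u, (fun t => \sum_(i | act i) (lam t i)%:MP * q i (u t)); split.
- by move=> t; apply: le_trans (ue t) _; rewrite ge_min lexx.
- apply: family_sum_cond => i ai; have [_ _ /(_ i ai)[cq _] _ _] := model.
  apply: bfamilyM; first by apply: bfamily_coef; exact: blam.
  exact: (cfamily_pullback cq (@dist2_ball_compact _ _ u0 rho) (u := u) uB).
- move=> t x xB; rewrite peval_sum.
  apply: le_trans (_ : (\sum_(i | act i) lam t i) * c <= _).
    by rewrite ler_wpM2r// ltW.
  rewrite mulr_suml; apply: ler_sum => i ai; rewrite pevalM pevalC ler_wpM2l//.
  by have [_ _ _ _ [H _]] := model; exact: H.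
- rewrite (_ : (fun t => _) = fun t =>
     (peval (affine_form (a t) (b t)) (u t) - \sum_(i | act i) lam t i * peval (G i) (u t))%:MP * 1 +
     (\sum_(i | act i) (lam t i)%:MP * G i + \sum_(i | act i) (lam t i)%:MP *
       ((peval (G i) (u t))%:MP + \sum_j (peval (G i)^`M(j) (u t))%:MP * y (u t) j - G i
          - sq (u t) * q i (u t)))).
    apply: btruncD; first by apply: btrunc_scale => //; exact: btrunc1.
    apply: btruncD; apply: btrunc_sum_cond => i ai; apply: btrunc_scale => //.
      by have [_ _ /(_ i ai)[_ [d Hd]] _ _] := model; exists d.
    have [_ _ _ /(_ i ai)[d Hd] _] := model; exists d => t.
    exact: (sos_trunc_qmodule g (Hd (u t))).
  apply/funext => t.
  have E1 : \sum_j (- a t 0 j)%:MP * y (u t) j =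
      \sum_(i | act i) (lam t i)%:MP * \sum_j (peval (G i)^`M(j) (u t))%:MP * y (u t) j.
    transitivity (\sum_j \sum_(i | act i) (lam t i)%:MP * ((peval (G i)^`M(j) (u t))%:MP * y (u t) j)).
      apply: eq_bigr => j _; rewrite fd rmorph_sum mulr_suml; apply: eq_bigr => i _.
      by rewrite rmorphM /=; ring.
    by rewrite exchange_big; apply: eq_bigr => i _; rewrite mulr_sumr.
  rewrite {1}(affine_form_taylor (a t) (b t) (u t)) E1 -[sq_dist u t]/(sq (u t)).
  move: (peval (affine_form _ _) (u t)) => v0.
  rewrite rmorphB rmorph_sum /= mulr1 mulr_sumr -!addrA; congr (_ + _).
  rewrite -!sumrN -!big_split /=; apply: eq_bigr => i _.
  by rewrite rmorphM /=; ring.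
Qed.

End Model.
End SupportPoint.

(** * Convex hulls of compact sets *)

Section ConvexHull.
Variables (R : realType) (n : nat).
Local Notation V := 'rV[R]_n.
Implicit Types (S C : set V).

Lemma convex_setP C : convex_set C <->
  (forall x y t, 0 <= t -> t <= 1 -> C x -> C y -> C (t *: x + (1 - t) *: y)).
Proof.
split=> [cC x y t t0 t1 Cx Cy|H x y l]; last first.
  by rewrite !inE => Cx Cy; apply: H.
by have := cC x y (Itv01 t0 t1); rewrite !inE; apply.
Qed.

Lemma convex_conv_hull S : convex_set (conv_hull S).
Proof.
apply/convex_setP => x y t t0 t1 Cx Cy B [cB SB].
by apply: (proj1 (convex_setP B) cB) => //; [apply: Cx|apply: Cy].
Qed.

Lemma sub_conv_hull S : S `<=` conv_hull S.
Proof. exact: sub_gen_smallest. Qed.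

Lemma conv_hull_sub S C : convex_set C -> S `<=` C -> conv_hull S `<=` C.
Proof. exact: smallest_sub. Qed.

Lemma convex_affine_ge (a : V) (b : R) : convex_set [set x | 0 <= peval (affine_form a b) x].
Proof.
apply/convex_setP => x y t t0 t1 /= fx fy.
have -> : peval (affine_form a b) (t *: x + (1 - t) *: y) =
    t * peval (affine_form a b) x + (1 - t) * peval (affine_form a b) y.
  rewrite !affine_formE.
  have -> : \sum_j a 0 j * (t *: x + (1 - t) *: y) 0 j =
     t * (\sum_j a 0 j * x 0 j) + (1 - t) * (\sum_j a 0 j * y 0 j).
    rewrite !mulr_sumr -big_split; apply: eq_bigr => j _ /=.
    by rewrite !mxE; ring.
  by ring.
by rewrite addr_ge0// mulr_ge0// subr_ge0.
Qed.

(** A linear form attaining its minimum over [S] at [u] is nonnegative on the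
    convex hull, hence [u] cannot be interior to it. *)
Lemma support_point_convbd S (a : V) (b : R) u : a != 0 ->
  (forall x, S x -> 0 <= peval (affine_form a b) x) -> S u ->
  peval (affine_form a b) u = 0 -> convbd S u.
Proof.
move=> a0 fS Su fu; split=> //; split.
  by apply: subset_closure; exact: sub_conv_hull.
move=> /(step_along a0)[h [h0 [+ _]]].
move=> /(conv_hull_sub (@convex_affine_ge a b) fS) /=.
have -> : peval (affine_form a b) (u + h *: a) = peval (affine_form a b) u - h * dist2 a 0.
  rewrite !affine_formE dist2_0 mulr_sumr -addrA -opprD -big_split; congr (_ - _).
  by apply: eq_bigr => j _; rewrite !mxE /=; ring.
by rewrite fu sub0r oppr_ge0 leNgt mulr_gt0// dist2_gt0.
Qed.

Definition combinations (k : nat) S : set V :=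
  [set y | exists (X : 'I_k -> V) (w : 'I_k -> R),
    [/\ forall i, S (X i), forall i, 0 <= w i, \sum_i w i = 1 & y = \sum_i w i *: X i]].

Lemma conv_hull_combinations S x : conv_hull S x -> exists k, combinations k S x.
Proof.
apply: (@conv_hull_sub S [set x | exists k, combinations k S x]); last first.
  move=> y Sy; exists 1, (fun=> y), (fun=> 1); split => //; first by rewrite big_ord1.
  by rewrite big_ord1 scale1r.
apply/convex_setP => _ _ t t0 t1 [k [X [w [SX w0 w1 ->]]]] [l [Y [v [SY v0 v1 ->]]]].
exists (k + l)%N, (fun i => match split i with inl j => X j | inr j => Y j end),
  (fun i => match split i with inl j => t * w j | inr j => (1 - t) * v j end).
have sl (j : 'I_k) : split (lshift l j) = inl j := unsplitK (inl j).
have sr (j : 'I_l) : split (rshift k j) = inr j := unsplitK (inr j).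
split => [i|i||].
- by case: (split i).
- by case: (split i) => j; rewrite mulr_ge0// subr_ge0.
- rewrite big_split_ord /=; under eq_bigr do rewrite sl.
  under [X in _ + X]eq_bigr do rewrite sr.
  by rewrite -!mulr_sumr w1 v1 !mulr1 addrC subrK.
- rewrite big_split_ord /= !scaler_sumr; congr (_ + _); apply: eq_bigr => j _.
    by rewrite sl scalerA.
  by rewrite sr scalerA.
Qed.

(** Caratheodory's reduction: more than [n + 1] points are affinely dependent,
    and moving along the dependency until a weight vanishes drops a point. *)
Lemma combinations_drop S k : (n.+1 < k.+1)%N -> combinations k.+1 S `<=` combinations k S.
Proof.
move=> nk _ [X [w [SX w0 w1 ->]]].
pose M : 'M[R]_(k.+1, n + 1) := \matrix_i row_mx (X i) (const_mx 1 : 'rV_1).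
have [c c0 cM] : exists2 c : 'rV[R]_k.+1, c != 0 & c *m M = 0.
  have /rowV0Pn[c /sub_kermxP cM c0] : kermx M != 0.
    rewrite -mxrank_eq0 mxrank_ker subn_eq0 -ltnNge.
    by apply: leq_ltn_trans (rank_leq_col M) _; rewrite addn1.
  by exists c.
have Mc : row_mx (\sum_i c 0 i *: X i) (const_mx (\sum_i c 0 i) : 'rV_1) = 0.
  rewrite -cM; apply/rowP => j; rewrite [RHS]mxE.
  case: (split_ordP j) => l ->; rewrite ?row_mxEl ?row_mxEr.
    rewrite summxE; apply: eq_bigr => i _; rewrite [LHS]mxE; congr (_ * _).
    by rewrite /M [RHS]mxE row_mxEl.
  rewrite [LHS]mxE; apply: eq_bigr => i _; rewrite -[LHS]mulr1; congr (_ * _).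
  by rewrite /M [RHS]mxE row_mxEr mxE.
have cX : \sum_i c 0 i *: X i = 0 by have := congr1 lsubmx Mc; rewrite row_mxKl lsubmx_const.
have c1 : \sum_i c 0 i = 0.
  by have := congr1 rsubmx Mc; rewrite row_mxKr => /rowP/(_ 0); rewrite !mxE.
have [i1 ci1] : exists i, 0 < c 0 i.
  apply: contrapT => H; have cle i : c 0 i <= 0.
    by rewrite leNgt; apply/negP => ci; apply: H; exists i.
  move: c0; apply/negP; rewrite negbK; apply/eqP/rowP => i; rewrite mxE.
  have : \sum_i - c 0 i = 0 by rewrite sumrN c1 oppr0.
  move/eqP; rewrite psumr_eq0 => [/allP/(_ i (mem_index_enum i))|j _]; rewrite ?oppr_ge0//.
  by rewrite /= oppr_eq0 => /eqP.
have [i0 ci0 i0min] := @arg_minP _ _ _ i1 (fun i => 0 < c 0 i) (fun i => w i / c 0 i) ci1.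
pose tau := w i0 / c 0 i0.
have tau0 : 0 <= tau by rewrite divr_ge0// ltW.
pose w' i := w i - tau * c 0 i.
have w'i0 : w' i0 = 0 by rewrite /w' /tau divfK ?subrr// gt_eqF.
have w'0 i : 0 <= w' i.
  rewrite subr_ge0; have [ci|ci] := ltP 0 (c 0 i).
    by rewrite -ler_pdivlMr//; exact: i0min.
  by apply: le_trans (w0 i); rewrite mulr_ge0_le0.
exists (fun i => X (lift i0 i)), (fun i => w' (lift i0 i)); split => //.
- have : \sum_i w' i = 1 by rewrite sumrB w1 -mulr_sumr c1 mulr0 subr0.
  by rewrite (bigD1_ord i0)//= w'i0 add0r.
- have : \sum_i w' i *: X i = \sum_i w i *: X i.
    rewrite (eq_bigr (fun i => w i *: X i - tau *: (c 0 i *: X i))).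
      by rewrite sumrB -scaler_sumr cX scaler0 subr0.
    by move=> i _; rewrite /w' scalerBl scalerA.
  by rewrite (bigD1_ord i0)//= w'i0 scale0r add0r => <-.
Qed.

(** [S] joined [k] times to itself by segments: a description of the combinations
    of [k + 1] points from which compactness is immediate. *)
Fixpoint iterated_join (k : nat) S : set V :=
  if k is k'.+1 then
    (fun z : R * (V * V) => z.1 *: z.2.1 + (1 - z.1) *: z.2.2) @`
      (`[0, 1] `*` (iterated_join k' S `*` S))
  else S.

Lemma iterated_join_compact k S : compact S -> compact (iterated_join k S).
Proof.
move=> cS; elim: k => //= k IH; apply: continuous_compact; last first.
  by apply: compact_setX; [exact: segment_compact | exact: compact_setX].
apply: continuous_subspaceT => z.
apply: cvgD; apply: cvgZ.
- exact: cvg_fst.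
- by apply: (cvg_comp snd fst); [exact: cvg_snd | exact: cvg_fst].
- by apply: cvgB; [exact: cvg_cst | exact: cvg_fst].
- by apply: (cvg_comp snd snd); exact: cvg_snd.
Qed.

Lemma iterated_join_conv_hull k S : iterated_join k S `<=` conv_hull S.
Proof.
elim: k => [|k IH]; first exact: sub_conv_hull.
move=> _ [[t [x y]] [/= + [Cx Sy]] <-] /=; rewrite in_itv /= => /andP[t0 t1].
apply: (proj1 (convex_setP _) (@convex_conv_hull S)) => //; first exact: IH.
exact: sub_conv_hull.
Qed.

Lemma iterated_join_le k l S : (k <= l)%N -> iterated_join k S `<=` iterated_join l S.
Proof.
elim: l => [|l IH]; first by rewrite leqn0 => /eqP ->.
rewrite leq_eqVlt => /orP[/eqP ->//|/IH sub] x /sub xl.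
have [y Sy] : exists y, S y.
  elim: (l) x xl => [|j IHj] x /=; first by exists x.
  by move=> [z [/= _ [/= /IHj]]].
exists (1, (x, y)) => /=; last by rewrite scale1r subrr scale0r addr0.
by split => //=; rewrite in_itv /= lexx ler01.
Qed.

Lemma combinations_iterated_join k S : combinations k.+1 S `<=` iterated_join k S.
Proof.
elim: k => [|k IH] _ [X [w [SX w0 w1 ->]]].
  by rewrite big_ord1 /=; move: w1; rewrite big_ord1 => ->; rewrite scale1r.
have w1' : \sum_(i < k.+1) w (lift ord_max i) + w ord_max = 1.
  by rewrite -w1 [RHS](bigD1_ord ord_max)//= addrC.
pose t := \sum_(i < k.+1) w (lift ord_max i).
have tE : w ord_max = 1 - t by rewrite -w1' /t addrAC subrr add0r.
have t0 : 0 <= t by exact: sumr_ge0.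
have t1 : t <= 1 by rewrite -subr_ge0 -tE.
rewrite (bigD1_ord ord_max)//= addrC.
have [t_eq0|t_neq0] := eqVneq t 0.
  have tw i : w (lift ord_max i) = 0.
    move/eqP: t_eq0; rewrite psumr_eq0// => /allP/(_ i (mem_index_enum i)).
    by move=> /eqP.
  rewrite big1 ?add0r => [|i _]; last by rewrite tw scale0r.
  exists (0, (X ord0, X ord_max)) => /=; last by rewrite scale0r add0r tE t_eq0.
  split => /=; first by rewrite in_itv /= lexx ler01.
  by split => //=; exact: (iterated_join_le (leq0n k)) (SX ord0).
exists (t, (\sum_(i < k.+1) (w (lift ord_max i) / t) *: X (lift ord_max i), X ord_max)) => /=.
  split => /=; first by rewrite in_itv /= t0 t1.
  split => //=; apply: IH.
  exists (fun i => X (lift ord_max i)), (fun i => w (lift ord_max i) / t); split => //.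
    by move=> i; rewrite divr_ge0.
  by rewrite -mulr_suml divff.
rewrite -tE scaler_sumr; congr (_ + _); apply: eq_bigr => i _.
by rewrite scalerA mulrC divfK.
Qed.

(** By Caratheodory's theorem the hull is the image of a compact set. *)
Theorem conv_hull_compact S : compact S -> compact (conv_hull S).
Proof.
move=> cS; rewrite (_ : conv_hull S = iterated_join n S); first exact: iterated_join_compact.
apply/seteqP; split => [x /conv_hull_combinations[k]|]; last exact: iterated_join_conv_hull.
elim: k => [[X [w [_ _ + _]]]|k IH xk].
  by rewrite big_ord0 => /esym/eqP; rewrite oner_eq0.
have [nk|kn] := ltnP n k; first by apply: IH; apply: combinations_drop xk; rewrite ltnS.
exact: (iterated_join_le kn) (combinations_iterated_join xk).
Qed.

End ConvexHull.

Section Separation.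
Variables (R : realType) (n : nat).
Local Notation V := 'rV[R]_n.

Lemma dist2_expand (p y v : V) (t : R) :
  dist2 (p + t *: v) y = dist2 p y - 2 * t * (\sum_j (y - p) 0 j * v 0 j) + t ^+ 2 * dist2 v 0.
Proof.
rewrite dist2_0 /dist2 !mulr_sumr -sumrB -big_split; apply: eq_bigr => j _ /=.
by rewrite !mxE; ring.
Qed.

(** Separation by the direction from [y] to its nearest point, normalized on
    the unit sphere and with offset bounded in terms of a box around [C]. *)
Lemma strict_separation (C : set V) (K : R) (y : V) :
  compact C -> convex_set C -> C !=set0 -> C `<=` in_box K -> ~ C y ->
  exists (a : V) (b : R), [/\ dist2 a 0 = 1, `|b| <= n%:R * K + 1,
    forall x, C x -> 0 < peval (affine_form a b) x & peval (affine_form a b) y < 0].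
Proof.
move=> cC /convex_setP convC C0 CK nCy.
have [p pC pmin] := compact_EVT_min C0 cC (continuous_subspaceT (@continuous_dist2 _ _ y)).
rewrite inE in pC; have {}pmin x : C x -> dist2 p y <= dist2 x y.
  by move=> Cx; apply: pmin; rewrite inE.
have yp : y != p by apply/eqP => yp; apply: nCy; rewrite yp.
have obtuse x : C x -> \sum_j (y - p) 0 j * (x - p) 0 j <= 0.
  move=> Cx; rewrite leNgt; apply/negP; set al := \sum_j _ => al0.
  pose be := dist2 (x - p) 0; have be0 : 0 <= be := dist2_ge0 _ _.
  have ab0 : 0 < al + be by rewrite ltr_pwDl.
  pose t := al / (al + be).
  have t0 : 0 < t by rewrite divr_gt0.
  have t1 : t <= 1 by rewrite ler_pdivrMr// mul1r lerDl.
  have : C (p + t *: (x - p)).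
    have -> : p + t *: (x - p) = t *: x + (1 - t) *: p.
      by apply/rowP => j; rewrite !mxE; ring.
    by apply: convC => //; exact: ltW.
  move/pmin; rewrite dist2_expand -/al -/be -addrA lerDl => H.
  have tb : t * be <= al.
    by rewrite /t mulrAC ler_pdivrMr// ler_wpM2l ?(ltW al0)// lerDr ltW.
  have : t * (t * be) <= t * al by rewrite ler_wpM2l// ltW.
  have : 0 < t * al by rewrite mulr_gt0.
  by rewrite expr2 -mulrA in H; move: H; rewrite -mulrA; lra.
pose d := Num.sqrt (dist2 y p).
have d0 : 0 < d by rewrite sqrtr_gt0 dist2_gt0.
have d2 : d ^+ 2 = dist2 y p by rewrite sqr_sqrtr// dist2_ge0.
pose a := d^-1 *: (y - p).
pose h := Num.min (d / 2) 1.
have h0 : 0 < h by rewrite lt_min ltr01 divr_gt0.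
have h1 : h <= 1 by rewrite ge_min lexx orbT.
have hd : h <= d / 2 by rewrite ge_min lexx.
have yp0 : dist2 (y - p) 0 = d ^+ 2 by rewrite d2 -(dist2_line p) [p + _]addrC subrK.
have a1 : dist2 a 0 = 1.
  by rewrite /a dist2_scale yp0 -exprMn mulVf ?expr1n// gt_eqF.
have fE x : peval (affine_form a (\sum_j a 0 j * p 0 j + h)) x =
    h - d^-1 * (\sum_j (y - p) 0 j * (x - p) 0 j).
  rewrite affine_formE addrAC -sumrB addrC; congr (_ + _).
  rewrite mulr_sumr -sumrN; apply: eq_bigr => j _.
  by rewrite !mxE; ring.
exists a, (\sum_j a 0 j * p 0 j + h); split => // [|x Cx|].
- apply: le_trans (ler_normD _ _) _; apply: lerD; last by rewrite gtr0_norm.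
  apply: le_trans (ler_norm_sum _ _ _) _; apply: le_trans (_ : \sum_(j < n) K <= _).
    apply: ler_sum => j _; rewrite normrM -[leRHS]mul1r; apply: ler_pM => //; last exact: CK.
    have := @dist2_coord_le _ _ a 0 1 j ler01; rewrite a1 expr1n [(0 : V) 0 j]mxE subr0; exact.
  by rewrite sumr_const card_ord [leRHS]mulr_natl.
- rewrite fE subr_gt0; apply: le_lt_trans h0; rewrite mulr_ge0_le0 ?obtuse//.
  by rewrite invr_ge0 ltW.
- rewrite fE; have -> : \sum_j (y - p) 0 j * (y - p) 0 j = d ^+ 2.
    by rewrite -yp0 dist2_0; apply: eq_bigr => j _; rewrite expr2.
  have -> : d^-1 * d ^+ 2 = d by field; rewrite gt_eqF.
  by lra.
Qed.

End Separation.

(** Covering argument along the filter of the sequences that contain a given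
    finite sequence. *)
Lemma isolated_compact_finite (T : topologicalType) (K : set T) : compact K ->
  (forall x, K x -> \forall y \near x, K y -> y = x) ->
  exists s : seq T, forall x, K x -> x \in s.
Proof.
move=> /compact_near_coveringP cK isoK.
pose F : set_system (seq T) :=
  [set B : set (seq T) | exists s0 : seq T, forall s : seq T, {subset s0 <= s} -> B s].
have FF : Filter F.
  split; first by exists [::].
    move=> B C [s HB] [t HC]; exists (s ++ t) => r rs; split.
      by apply: HB => x xs; apply: rs; rewrite mem_cat xs.
    by apply: HC => x xs; apply: rs; rewrite mem_cat xs orbT.
  by move=> B C BC [s HB]; exists s => r /HB/BC.
have [|s Hs] := cK _ F (fun s x => K x -> x \in s) FF.
  move=> x Kx; exists ([set y | K y -> y = x], [set s : seq T | x \in s]) => /=.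
    split; first exact: isoK.
    by exists [:: x] => s; apply; rewrite inE.
  by move=> [y s] /= [H xs] /H ->.
by exists s => x Kx; apply: (Hs s).
Qed.

Section Exactness.
Variables (R : realType) (n m : nat) (g : m.-tuple {mpoly R[n]}).
Local Notation A := {mpoly R[n]}.
Local Notation V := 'rV[R]_n.
Local Notation S := (semialg g).
Hypothesis g_arch : archimedean_qmodule g.

Lemma semialg_closed : closed S.
Proof.
rewrite (_ : S = \bigcap_(i in setT) [set x | 0 <= peval (tnth g i) x]).
  by apply: closed_bigI => i _; apply: closed_preimage_ge; exact: continuous_peval.
by apply/seteqP; split => x Sx i; [move=> _; exact: Sx | exact: Sx].
Qed.

Lemma semialg_compact : compact S.
Proof.
have [K [_ SK]] := semialg_box g_arch.
exact: closed_box_compact semialg_closed SK.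
Qed.

Lemma dist2_perturb (u v u' v' : V) (e : R) : dist2 u' u <= e -> dist2 v' v <= e ->
  dist2 u v / 3 - 2 * e <= dist2 u' v'.
Proof.
move=> ue ve; have : dist2 u v <= 3 * (dist2 u' u + dist2 v' v + dist2 u' v').
  rewrite /dist2 -!big_split mulr_sumr; apply: ler_sum => j _ /=.
  move: (u 0 j) (v 0 j) (u' 0 j) (v' 0 j) => a b c d.
  have := sqr_ge0 ((a - c) - (c - d)); have := sqr_ge0 ((a - c) - (d - b)).
  have := sqr_ge0 ((c - d) - (d - b)); nra.
by lra.
Qed.

Hypothesis g_int : nonempty_interior_near_convbd S.
Hypothesis g_qc : forall i : 'I_m,
  strictly_quasiconcave_on (tnth g i) (convbd S `&` zeros (tnth g i)).

(** The local part of the argument at a support point [u] of [S] in direction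
    [a0]. The radius [r] and the constant [c] are fixed before the precision [e]
    on the moving point, which is what allows lower bounds on a ball around [u]
    to hold for all nearby linear forms at once. *)
Definition certified_near (a0 : V) (b0 : R) (u : V) (r c : R) : Prop :=
  [/\ 0 < r, 0 < c,
   forall x, S x -> dist2 x u <= r -> x != u -> 0 < peval (affine_form a0 b0) x &
   forall e : R, 0 < e -> exists theta : R, 0 < theta /\
    forall (T : Type) (a : T -> V) (b : T -> R),
    (forall t j, `|a t 0 j - a0 0 j| <= theta) -> (forall t, `|b t - b0| <= theta) ->
    (forall t x, S x -> 0 < peval (affine_form (a t) (b t)) x) ->
    exists (w : T -> V) (p : T -> A), [/\ forall t, dist2 (w t) u <= e, bfamily p,
    forall t x, dist2 x u <= r -> c <= peval (p t) x &
    btrunc g (fun t => affine_form (a t) (b t) - sq_dist w t * p t)]].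

(** One degree works for all linear forms positive on [S] and close to a given
    one: its zeros on [S] are finitely many nondegenerate support points. *)
Lemma local_degree_bound (a0 : V) (b0 : R) : a0 != 0 ->
  (forall x, S x -> 0 <= peval (affine_form a0 b0) x) ->
  exists (theta : R) (d : nat), 0 < theta /\ forall (a : V) (b : R),
    (forall j, `|a 0 j - a0 0 j| <= theta) -> `|b - b0| <= theta ->
    (forall x, S x -> 0 < peval (affine_form a b) x) ->
    trunc_qmodule g d (affine_form a b).
Proof.
move=> a00 f0_ge0; set f0 := affine_form a0 b0 in f0_ge0.
pose Z := [set x | S x /\ peval f0 x = 0].
have Zcvx u : Z u -> convbd S u by move=> [Su fu]; exact: support_point_convbd fu.
have Zint u : Z u -> closure S° u by move=> /Zcvx; exact: g_int.
have Zqc u : Z u -> forall i, peval (tnth g i) u = 0 -> strictly_quasiconcave_at (tnth g i) u.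
  by move=> Zu i gi; apply: g_qc; split => //; exact: Zcvx.
have Zcert u : Z u -> exists r c, certified_near a0 b0 u r c.
  move=> Zu; have [Su fu] := Zu.
  have [G [q [rho [c0 model]]]] := local_model_exists Su (Zqc u Zu).
  have [c [cp Hc]] := model_certificate Su (Zint u Zu) a00 f0_ge0 fu model.
  exists rho, c; split => //; first exact: model_rho model.
  by move=> x; exact: (support_point_isolated Su a00 f0_ge0 fu model).
have Zcpt : compact Z.
  rewrite (_ : Z = S `&` [set x | peval f0 x <= 0]).
    apply: compact_closedI; first exact: semialg_compact.
    by apply: closed_preimage_le; exact: continuous_peval.
  apply/seteqP; split => x [Sx] /= => [->//|fx]; split => //.
  by apply/eqP; rewrite eq_le fx f0_ge0.
have [s0 Hs0] : exists s : seq V, forall x, Z x -> x \in s.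
  apply: (isolated_compact_finite Zcpt) => u Zu.
  have [r [c [r0 _ iso _]]] := Zcert u Zu.
  apply: filterS (near_dist2 u r0) => x /ltW xr [Sx fx].
  by apply/eqP; apply: contraT => xu; have := iso x Sx xr xu; rewrite fx ltxx.
pose s := [seq x <- undup s0 | `[< Z x >]]; pose k := size s.
have sP x : reflect (Z x) (x \in s).
  apply: (iffP idP) => [|Zx]; rewrite mem_filter; first by case/andP => /asboolP.
  by rewrite mem_undup Hs0// andbT; apply/asboolP.
have s_uniq : uniq s by rewrite filter_uniq// undup_uniq.
pose u i : V := nth 0 s i.
have uZ i : (i < k)%N -> Z (u i) by move=> ik; apply/sP; exact: mem_nth.
have /choice[rc Hrc] : forall i, exists rc : R * R, (i < k)%N -> certified_near a0 b0 (u i) rc.1 rc.2.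
  move=> i; have [ik|_] := ltnP i k; last by exists (0, 0).
  by have [r [c H]] := Zcert _ (uZ i ik); exists (r, c).
have [r [r0 Hr]] : exists r, 0 < r /\ forall i : 'I_k, predT i -> r <= (rc i).1.
  by apply: finite_lower_bound => i _; have [] := Hrc i (ltn_ord i).
have [c [c0 Hc]] : exists c, 0 < c /\ forall i : 'I_k, predT i -> c <= (rc i).2.
  by apply: finite_lower_bound => i _; have [] := Hrc i (ltn_ord i).
have [sep [sep0 Hsep]] : exists sep, 0 < sep /\
    forall ij : 'I_k * 'I_k, ij.1 != ij.2 -> sep <= dist2 (u ij.1) (u ij.2).
  apply: (@finite_lower_bound _ _ (fun ij => ij.1 != ij.2)) => -[i j] /= ij.
  by apply: dist2_gt0; rewrite /u nth_uniq.
(* Away from the zeros, [f0] is bounded below by compactness. *)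
have [eta [eta0 Heta]] : exists eta, 0 < eta /\ forall x, S x ->
    (forall i, (i < k)%N -> r <= dist2 x (u i)) -> eta <= peval f0 x.
  have cL : compact (S `&` \bigcap_(i in setT) [set x | (i < k)%N -> r <= dist2 x (u i)]).
    apply: compact_closedI; first exact: semialg_compact.
    apply: closed_bigI => i _; case: (ltnP i k) => ik.
      rewrite (_ : [set x | _] = [set x | r <= dist2 x (u i)]).
        by apply: closed_preimage_ge; exact: continuous_dist2.
      by apply/seteqP; split => x /=; [exact | move=> H _].
    by rewrite (_ : [set x | _] = setT); [exact: closedT | apply/seteqP; split].
  have [|N HN] := penalty_eventually_positive cL (@continuous_peval _ _ f0)
     (@cst_continuous V R 0) (fun=> lexx 0).
    move=> x [Sx xr] _; rewrite lt_def f0_ge0// andbT; apply/eqP => fx.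
    have /sP/nthP : Z x by [].
    move=> /(_ 0)[i ik ui]; have := xr i I ik.
    by rewrite /u ui dist2xx leNgt r0.
  exists N.+1%:R^-1; split; first by rewrite invr_gt0.
  move=> x Sx xr; have := HN x (conj Sx (fun i _ => xr i)).
  by rewrite mulr0 addr0 => /ltW.
have [K [K0 SK]] := semialg_box g_arch.
have nK0 : 0 < 1 + n%:R * K by rewrite ltr_pwDl// mulr_ge0// ltW.
(* By [dist2_perturb], the moving points stay [sep / 6] apart when they are
   within [sep / 12] of their centers. *)
pose e := Num.min r (sep / 12).
have e0 : 0 < e by rewrite lt_min r0 divr_gt0.
have er : e <= r by rewrite ge_min lexx.
have es : e <= sep / 12 by rewrite ge_min lexx orbT.
have /choice[th Hth] : forall i, exists theta : R, 0 < theta /\ ((i < k)%N ->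
    forall (T : Type) (a : T -> V) (b : T -> R),
    (forall t j, `|a t 0 j - a0 0 j| <= theta) -> (forall t, `|b t - b0| <= theta) ->
    (forall t x, S x -> 0 < peval (affine_form (a t) (b t)) x) ->
    exists (w : T -> V) (p : T -> A), [/\ forall t, dist2 (w t) (u i) <= e, bfamily p,
    forall t x, dist2 x (u i) <= r -> c <= peval (p t) x &
    btrunc g (fun t => affine_form (a t) (b t) - sq_dist w t * p t)]).
  move=> i; have [ik|_] := ltnP i k; last by exists 1.
  have [_ _ _ /(_ e e0)[theta [th0 H]]] := Hrc i ik.
  exists theta; split => // _ T a b Ha Hb fpos.
  have [w [p [we bp pc Hp]]] := H T a b Ha Hb fpos.
  exists w, p; split => // t x xr.
  apply: le_trans (pc t x (le_trans xr (Hr (Ordinal ik) isT))).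
  exact: (Hc (Ordinal ik)).
have [th1 [th10 Hth1]] : exists th1, 0 < th1 /\ forall i : 'I_k, predT i -> th1 <= th i.
  by apply: finite_lower_bound => i _; have [] := Hth i.
pose theta := Num.min (Num.min 1 th1) (eta / 2 / (1 + n%:R * K)).
have theta0 : 0 < theta by rewrite !lt_min ltr01 th10 !divr_gt0.
have theta1 : theta <= 1 by rewrite !ge_min lexx.
have theta_th i : (i < k)%N -> theta <= th i.
  move=> ik; apply: le_trans (Hth1 (Ordinal ik) isT).
  by rewrite !ge_min lexx orbT.
have theta_eta : theta * (1 + n%:R * K) <= eta / 2.
  by rewrite -ler_pdivlMr// !ge_min lexx orbT.
exists theta.
pose T := {z : V * R | [/\ forall j, `|z.1 0 j - a0 0 j| <= theta, `|z.2 - b0| <= theta &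
   forall x, S x -> 0 < peval (affine_form z.1 z.2) x]}.
pose aT (t : T) := (sval t).1; pose bT (t : T) := (sval t).2.
have Ha t j : `|aT t 0 j - a0 0 j| <= theta by have [] := svalP t.
have Hb t : `|bT t - b0| <= theta by have [] := svalP t.
have fpos t x : S x -> 0 < peval (affine_form (aT t) (bT t)) x by have [_ _] := svalP t; exact.
suff [d Hd] : btrunc g (fun t : T => affine_form (aT t) (bT t)).
  exists d; split => // a b Hab Hbb Hf.
  by have := Hd (exist _ (a, b) (And3 Hab Hbb Hf)).
have /choice[wp Hwp] : forall i, exists wp : (T -> V) * (T -> A), (i < k)%N ->
    [/\ forall t, dist2 (wp.1 t) (u i) <= e, bfamily wp.2,
    forall t x, dist2 x (u i) <= r -> c <= peval (wp.2 t) x &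
    btrunc g (fun t => affine_form (aT t) (bT t) - sq_dist wp.1 t * wp.2 t)].
  move=> i; have [ik|_] := ltnP i k; last by exists (fun=> 0, fun=> 0).
  have [_ /(_ ik T aT bT)] := Hth i.
  case=> [t j|t|//|w [p H]]; last by exists (w, p).
    by apply: le_trans (Ha t j) _; exact: theta_th.
  by apply: le_trans (Hb t) _; exact: theta_th.
pose w i := (wp i).1; pose p i := (wp i).2.
have bw i : (i < k)%N -> bounded_point (w i).
  move=> ik; have [we _ _ _] := Hwp i ik.
  have [K1 [_ HK1]] := dist2_ball_box (u i) e.
  by exists K1 => t; apply: HK1; exact: we.
have baf : bfamily (fun t => affine_form (aT t) (bT t)).
  apply: bfamilyB.
    apply: bfamily_coef; exists (theta + `|b0|) => t.
    by rewrite -[bT t](subrK b0); apply: le_trans (ler_normD _ _) _; rewrite lerD2r.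
  apply: bfamily_sum => j; apply: bfamilyM; last exact: bfamily_cst.
  apply: bfamily_coef; exists (theta + `|a0 0 j|) => t.
  by rewrite -[aT t 0 j](subrK (a0 0 j)); apply: le_trans (ler_normD _ _) _; rewrite lerD2r.
have /choice[B HB] : forall i, exists B : R, 1 <= B /\ ((i < k)%N ->
    forall t x, S x -> dist2 x (w i t) <= B).
  move=> i; have [ik|_] := ltnP i k; last by exists 1.
  have [B [B1 H]] := dist2_bounded_on_semialg g_arch (bw i ik).
  by exists B.
pose W := \prod_(i < k) B i.
have B1 i : 1 <= B i by have [] := HB i.
have B0 i : 0 < B i := lt_le_trans ltr01 (B1 i).
have W0 : 0 < W by apply: prodr_gt0.
pose delta := Num.min (eta / 2) c / W.
have d1 : delta * W <= eta / 2 by rewrite /delta divfK ?gt_eqF// ge_min lexx.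
have d2 : delta * W <= c by rewrite /delta divfK ?gt_eqF// ge_min lexx orbT.
have delta0 : 0 < delta by rewrite divr_gt0// lt_min c0 andbT divr_gt0.
apply: (@nondegenerate_zeros_positivstellensatz _ _ _ g T g_arch k w _ delta (sep / 6)) => //.
- by rewrite divr_gt0.
- move=> i j /andP[ij jk] t; have ik := ltn_trans ij jk.
  have [wi _ _ _] := Hwp i ik; have [wj _ _ _] := Hwp j jk.
  have := dist2_perturb (wi t) (wj t).
  have := Hsep (Ordinal ik, Ordinal jk); rewrite /= -val_eqE /= ltn_eqF// => /(_ isT).
  by rewrite -/(w i) -/(w j); lra.
- move=> t x Sx.
  have wx i : 0 <= dist2 x (w i t) by exact: dist2_ge0.
  have wB (i : 'I_k) : dist2 x (w i t) <= B i by have [_ H] := HB i; exact: H (ltn_ord i) t x Sx.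
  have [[i xi]|xfar] := pselect (exists i : 'I_k, dist2 x (u i) < r).
    have [_ _ pc [d Hd]] := Hwp i (ltn_ord i).
    have := trunc_ge0 (Hd t) Sx; rewrite pevalB pevalM sq_distE subr_ge0; apply: le_trans.
    rewrite (bigD1 i)//= mulrCA; apply: ler_wpM2l => //.
    apply: le_trans (pc t x (ltW xi)); apply: le_trans d2; rewrite ler_wpM2l ?(ltW delta0)//.
    apply: le_trans (_ : \prod_(j | j != i) B j <= _).
      by apply: ler_prod => j _; rewrite wx wB.
    by rewrite /W [leRHS](bigD1 i)//= ler_peMl// prodr_ge0// => j _; rewrite ltW.
  apply: le_trans (_ : delta * W <= _).
    by rewrite ler_wpM2l ?(ltW delta0)//; apply: ler_prod => j _; rewrite wx wB.
  apply: le_trans d1 _.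
  have : eta <= peval f0 x.
    apply: Heta => // i ik; rewrite leNgt; apply/negP => xi; apply: xfar.
    by exists (Ordinal ik).
  suff : `|peval (affine_form (aT t) (bT t)) x - peval f0 x| <= eta / 2.
    by rewrite ler_norml => /andP[]; lra.
  by apply: le_trans theta_eta; apply: affine_perturb => //; exact: SK.
- move=> i ik; have [we bp pc Hp] := Hwp i ik.
  exists (p i), c; split => // t; apply: pc.
  exact: le_trans (we t) er.
Qed.

End Exactness.

(** * Lasserre relaxations *)

Section Lasserre.
Variables (R : realType) (n m : nat) (g : m.-tuple {mpoly R[n]}).
Local Notation A := {mpoly R[n]}.
Local Notation V := 'rV[R]_n.
Local Notation S := (semialg g).

Lemma near_pair (a0 : V) (b0 theta : R) : 0 < theta -> \forall z \near ((a0, b0) : V * R),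
  (forall j, `|(z.1 : V) 0 j - a0 0 j| <= theta) /\ `|z.2 - b0| <= theta.
Proof.
move=> th0; have th2 : 0 < theta ^+ 2 by rewrite exprn_gt0.
exists ([set a | dist2 a a0 < theta ^+ 2], [set b | `|b - b0| < theta]).
  split => /=; first exact: near_dist2.
  have := nbhsx_ballx b0 _ th0; apply: filterS => b.
  by rewrite /ball /= distrC.
move=> [a b] /= [/= ad bd]; split; last exact: ltW.
by move=> j; apply: dist2_coord_le; exact: ltW.
Qed.

Lemma sub_semialg_lasserre d : S `<=` lasserre g d.
Proof.
move=> x Sx; exists (fun p => peval p x); split.
- by move=> a p q _ _; rewrite pevalD -mul_mpolyC pevalM pevalC.
- by move=> f Mf; exact: trunc_ge0 Mf Sx.
- exact: peval1.
- by apply/rowP => i; rewrite mxE pevalX.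
Qed.

Lemma convex_lasserre d : convex_set (lasserre g d).
Proof.
apply/convex_setP => _ _ t t0 t1 [L [linL L0 L1 ->]] [N [linN N0 N1 ->]].
exists (fun p => t * L p + (1 - t) * N p); split.
- by move=> a p q dp dq; rewrite linL// linN//; ring.
- by move=> f Mf; rewrite addr_ge0// mulr_ge0 ?subr_ge0 ?L0 ?N0.
- by rewrite L1 N1 !mulr1 addrC subrK.
- by apply/rowP => i; rewrite !mxE.
Qed.

Lemma linear_upto0 d (L : A -> R) : linear_upto d L -> L 0 = 0.
Proof.
have deg0 : deg_le d (0 : A) by rewrite /deg_le msize0.
move=> linL; have := linL 1 0 0 deg0 deg0; rewrite scaler0 addr0 mul1r => /eqP.
by rewrite -{1}[L 0]addr0 => /eqP/addrI.
Qed.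

Lemma linear_upto_affine d (L : A -> R) (a : V) (b : R) : (0 < d)%N ->
  linear_upto d L -> L 1 = 1 ->
  L (affine_form a b) = peval (affine_form a b) (\row_i L 'X_i).
Proof.
move=> d0 linL L1; rewrite affine_formE.
have deg1 : deg_le d (1 : A) by rewrite /deg_le msize1.
have degX i : deg_le d ('X_i : A) by rewrite /deg_le msizeX mdeg1 ltnS.
have deg0 : deg_le d (0 : A) by rewrite /deg_le msize0.
have L0 := linear_upto0 linL.
have degS (r : seq 'I_n) : deg_le d (\sum_(j <- r) (- a 0 j) *: 'X_j : A).
  elim: r => [|j r IH]; rewrite ?big_nil// big_cons /deg_le.
  apply: leq_trans (msizeD_le _ _) _; rewrite geq_max; apply/andP; split=> //.
  by apply: leq_trans (msizeZ_le _ _) _; exact: degX.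
have LS (r : seq 'I_n) : L (\sum_(j <- r) (- a 0 j) *: 'X_j) = - \sum_(j <- r) a 0 j * L 'X_j.
  elim: r => [|j r IH]; rewrite ?big_nil ?oppr0// !big_cons linL// IH.
  by rewrite mulNr opprD.
have -> : affine_form a b = b *: 1 + \sum_j (- a 0 j) *: 'X_j.
  rewrite /affine_form -mul_mpolyC mulr1; congr (_ + _); rewrite -sumrN.
  by apply: eq_bigr => j _; rewrite -mul_mpolyC mpolyCN mulNr.
rewrite linL// L1 mulr1 LS; congr (_ - _).
by apply: eq_bigr => j _; rewrite mxE.
Qed.

Hypothesis g_arch : archimedean_qmodule g.

(** If [S] is empty, then [- 1] has a certificate, which no normalized linear
    form nonnegative on the truncated module survives. *)
Lemma lasserre_eq0 : S = set0 -> exists d, (0 < d)%N /\ lasserre g d = set0.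
Proof.
move=> S0; have [|d Md] := @archimedean_positivstellensatz R n m g g_arch (- 1).
  by move=> x Sx; suff : set0 x by []; rewrite -S0.
exists d.+1; split => //; apply/seteqP; split => // x [L [linL L0 L1 _]].
have deg1 : deg_le d.+1 (1 : A) by rewrite /deg_le msize1.
have := L0 _ (trunc_widen (leqnSn d) Md).
have deg0 : deg_le d.+1 (0 : A) by rewrite /deg_le msize0.
have -> : -1 = (-1) *: 1 + 0 :> A by rewrite addr0 scaleN1r.
by rewrite linL// L1 (linear_upto0 linL) addr0 mulr1 oppr_ge0 ler10.
Qed.

Hypothesis g_int : nonempty_interior_near_convbd S.
Hypothesis g_qc : forall i : 'I_m,
  strictly_quasiconcave_on (tnth g i) (convbd S `&` zeros (tnth g i)).

(** The local degree bounds are uniform because the normalized linear forms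
    with bounded offset form a compact set; around a form that is negative
    somewhere on [S] there is nothing to certify. *)
Lemma global_degree_bound (B : R) : exists d, forall (a : V) (b : R),
  dist2 a 0 = 1 -> `|b| <= B -> (forall x, S x -> 0 < peval (affine_form a b) x) ->
  trunc_qmodule g d (affine_form a b).
Proof.
pose P (d : nat) (z : V * R) := (forall x, S x -> 0 < peval (affine_form z.1 z.2) x) ->
  trunc_qmodule g d (affine_form z.1 z.2).
have cK : compact ([set a : V | dist2 a 0 = 1] `*` `[- B, B]).
  by apply: compact_setX; [exact: sphere_compact | exact: segment_compact].
have [[a0 b0] [/= a1 _]|d _ /(_ d (leqnn d)) Hd] :=
  proj1 (compact_near_coveringP _) cK nat \oo P _; last first.
  exists d => a b a1 bB; apply: (Hd (a, b)); split => //=.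
  by rewrite in_itv /= -ler_norml.
have a00 : a0 != 0 by apply/eqP => a0E; move/eqP: a1; rewrite a0E dist2xx eq_sym oner_eq0.
have [f0_ge0|] := pselect (forall x, S x -> 0 <= peval (affine_form a0 b0) x).
  have [theta [d [th0 Hd]]] := local_degree_bound g_arch g_int g_qc a00 f0_ge0.
  exists ([set z : V * R | (forall j, `|z.1 0 j - a0 0 j| <= theta) /\ `|z.2 - b0| <= theta],
          [set e | (d <= e)%N]).
    by split => /=; [exact: near_pair | exact: nbhs_infty_ge].
  move=> [[a b] e] /= [/= [Ha Hb] de] fpos.
  by apply: trunc_widen de _; exact: Hd.
move=> /existsNP[x /not_implyP[Sx /negP]]; rewrite -ltNge => fx.
pose K := \sum_j `|x 0 j|; pose sx := 1 + n%:R * K.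
have K0 : 0 <= K by exact: sumr_ge0.
have xK : in_box K x by move=> j; rewrite /K (bigD1 j)//= lerDl sumr_ge0.
have sx0 : 0 < sx by rewrite ltr_pwDl// mulr_ge0.
pose theta := - peval (affine_form a0 b0) x / sx.
have th0 : 0 < theta by rewrite divr_gt0// oppr_gt0.
exists ([set z : V * R | (forall j, `|z.1 0 j - a0 0 j| <= theta) /\ `|z.2 - b0| <= theta], setT).
  by split => /=; [exact: near_pair | exact: filterT].
move=> [[a b] e] /= [/= [Ha Hb] _] /(_ x Sx) /=.
have := affine_perturb xK Ha Hb; rewrite -/sx /theta divfK ?gt_eqF//.
by rewrite ler_norml => /andP[_]; lra.
Qed.

Lemma lasserre_sub_conv_hull : S !=set0 ->
  exists d, (0 < d)%N /\ lasserre g d `<=` conv_hull S.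
Proof.
move=> S0; have [K [K0 SK]] := semialg_box g_arch.
have [d Hd] := global_degree_bound (n%:R * K + 1).
exists d.+1; split => // y [L [linL L0 L1 yE]].
apply: contrapT => nCy.
have C0 : conv_hull S !=set0 by have [x Sx] := S0; exists x; exact: sub_conv_hull.
have CK : conv_hull S `<=` in_box K.
  apply: conv_hull_sub SK; apply/convex_setP => u v t t0 t1 uK vK i.
  rewrite !mxE; apply: le_trans (ler_normD _ _) _; rewrite !normrM.
  rewrite (ger0_norm t0) (ger0_norm (_ : 0 <= 1 - t)) ?subr_ge0//.
  have := uK i; have := vK i; have : t * `|u 0 i| <= t * K by rewrite ler_wpM2l.
  have : (1 - t) * `|v 0 i| <= (1 - t) * K by rewrite ler_wpM2l ?subr_ge0.
  by move: (t * `|u 0 i|) ((1 - t) * `|v 0 i|) => p q; lra.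
have cC := conv_hull_compact (semialg_compact g_arch).
have [a [b [a1 bB fC fy]]] := strict_separation cC (@convex_conv_hull _ _ S) C0 CK nCy.
have Mf : trunc_qmodule g d (affine_form a b).
  by apply: Hd => // x Sx; apply: fC; exact: sub_conv_hull.
have := L0 _ (trunc_widen (leqnSn d) Mf).
by rewrite (linear_upto_affine _ _ (ltn0Sn d) linL L1) -yE leNgt fy.
Qed.

End Lasserre.

Theorem corollary56 (R : realType) (n m : nat) (g : m.-tuple {mpoly R[n]})
    (g_arch : archimedean_qmodule g)
    (g_int : nonempty_interior_near_convbd (semialg g))
    (g_qc : forall i : 'I_m,
       strictly_quasiconcave_on (tnth g i)
         (convbd (semialg g) `&` zeros (tnth g i))) :
  exists d : nat, (0 < d)%N /\ conv_hull (semialg g) = lasserre g d.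
Proof.
have sub d : conv_hull (semialg g) `<=` lasserre g d.
  by apply: conv_hull_sub; [exact: convex_lasserre | exact: sub_semialg_lasserre].
have [S0|/set0P S0] := eqVneq (semialg g) set0.
  have [d [d0 L0]] := lasserre_eq0 g_arch S0; exists d; split => //.
  by apply/seteqP; split => [|x]; [exact: sub | rewrite L0].
have [d [d0 Ld]] := lasserre_sub_conv_hull g_arch g_int g_qc S0.
by exists d; split => //; apply/seteqP; split; [exact: sub | exact: Ld].
Qed.
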